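(* Let $\mathcal{H}=A_1^2(\mathbb{D})$ and let $\mathcal{H}_0$ be the closed linear span in $\mathcal{H}$ of the functions $s_k$, $k=2,3,\ldots$, where $$s_k(z)=\frac{1}{1-z}\frac{d}{dz}\log\Big(\sum_{j=0}^{k-1}z^j\Big)=\frac{1+2z+\cdots+(k-1)z^{k-2}}{1-z^k},\qquad z\in\mathbb{D}.$$ If $g$ is a non-zero function in $\mathcal{H}$ such that the function $z\mapsto\frac{g(z)}{1-z}$ belongs to $\mathcal{H}$, then $g\notin\mathcal{H}_0^{\perp}$, where $\mathcal{H}_0^\perp$ is the orthogonal complement of $\mathcal{H}_0$ in $\mathcal{H}$.
   Context: $\mathbb{D}=\{z\in\mathbb{C}:|z|<1\}$ is the open unit disk. $dA=\pi^{-1}\,dx\,dy$ is the normalized area measure on $\mathbb{D}$, and $dA_1(z)=2(1-|z|^2)\,dA(z)$, a probability measure on $\mathbb{D}$. The weighted Bergman space $\mathcal{H}=A_1^2(\mathbb{D})$ is the Hilbert space of all analytic functions on $\mathbb{D}$ lying in $L^2(\mathbb{D},dA_1)$, with the inner product of $L^2(\mathbb{D},dA_1)$; for $f(z)=\sum_{n\ge 0}a_nz^n$ one has $\|f\|_2^2=\sum_{n\ge 0}\frac{2|a_n|^2}{(n+1)(n+2)}$. *)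

(* Defs.v *)
From HB Require Import structures.
From mathcomp Require Import all_boot all_order all_algebra.
From mathcomp Require Import all_classical all_reals all_analysis.
From mathcomp.real_closed Require Import complex.

Set Implicit Arguments.
Unset Strict Implicit.
Unset Printing Implicit Defensive.

Import Order.TTheory GRing.Theory Num.Theory.
Import ComplexField.Normc numFieldNormedType.Exports.

Local Open Scope classical_set_scope.
Local Open Scope ring_scope.
Local Open Scope complex_scope.

(* R[i] does not inherit the norm topology of a numFieldType by unification. *)
HB.instance Definition _ (R : realType) := GRing.ComAlgebra.copy R[i] R[i]^o.
HB.instance Definition _ (R : realType) := Vector.copy R[i] R[i]^o.
HB.instance Definition _ (R : realType) := NormedModule.copy R[i] R[i]^o.

(* A function on the disk is represented by a total function R[i] -> R[i]
   whose values outside the disk are never used. *)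

Definition unit_disk (R : realType) : set R[i] := [set z | `|z| < 1].

(* In R[i], 0 < r forces r to be real; r is only a lower bound for the radius
   of convergence, so it can be shrunk to stay inside a given open set. *)
Definition analytic_at (R : realType) (f : R[i] -> R[i]) (z0 : R[i]) : Prop :=
  exists (r : R[i]) (a : nat -> R[i]), 0 < r /\
    forall z : R[i], `|z - z0| < r ->
      [series a n * (z - z0) ^+ n]_n @ \oo --> f z.

Definition analytic_on (R : realType) (A : set R[i]) (f : R[i] -> R[i]) : Prop :=
  forall z, A z -> analytic_at f z.

Definition cplx (R : realType) (p : R * R) : R[i] := p.1 +i* p.2.

Definition plane_disk (R : realType) : set (R * R) := @cplx R @^-1` @unit_disk R.

Definition plane_measure (R : realType) :=
  (@lebesgue_measure R \x @lebesgue_measure R)%E.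

(* dA_1 = 2 (1 - |z|^2) dA, dA = pi^-1 dx dy *)
Definition dA1_density (R : realType) (p : R * R) : R :=
  2 * (1 - normc (cplx p) ^+ 2) * pi^-1.

Definition dA1_Rintegral (R : realType) (u : R[i] -> R) : R :=
  Rintegral (@plane_measure R) (@plane_disk R)
    (fun p => u (cplx p) * dA1_density p).

Definition dA1_integral (R : realType) (f : R[i] -> R[i]) : R[i] :=
  dA1_Rintegral (fun z => complex.Re (f z)) +i*
  dA1_Rintegral (fun z => complex.Im (f z)).

Definition L2_dA1 (R : realType) (f : R[i] -> R[i]) : Prop :=
  [/\ measurable_fun (@plane_disk R) (fun p => complex.Re (f (cplx p))),
      measurable_fun (@plane_disk R) (fun p => complex.Im (f (cplx p))) &
      (@plane_measure R).-integrable (@plane_disk R)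
        (fun p => (normc (f (cplx p)) ^+ 2 * dA1_density p)%:E)].

Definition bergman (R : realType) : set (R[i] -> R[i]) :=
  [set f | analytic_on (@unit_disk R) f /\ L2_dA1 f].

Definition inner (R : realType) (f g : R[i] -> R[i]) : R[i] :=
  dA1_integral (fun z => f z * (g z)^*).

Definition bergman_norm (R : realType) (f : R[i] -> R[i]) : R :=
  Num.sqrt (complex.Re (inner f f)).

Definition linear_span (R : realType) (S : set (R[i] -> R[i])) :
    set (R[i] -> R[i]) :=
  [set f | exists (n : nat) (c : 'I_n -> R[i]) (v : 'I_n -> R[i] -> R[i]),
     (forall i, S (v i)) /\ f = (fun z => \sum_(i < n) c i * v i z)].

Definition closed_linear_span (R : realType) (S : set (R[i] -> R[i])) :
    set (R[i] -> R[i]) :=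
  [set f | bergman f /\ forall e : R, 0 < e ->
     exists2 h, linear_span S h & bergman_norm (fun z => f z - h z) < e].

Definition orthogonal_complement (R : realType) (M : set (R[i] -> R[i])) :
    set (R[i] -> R[i]) :=
  [set g | bergman g /\ forall f, M f -> inner f g = 0].

Definition sk (R : realType) (k : nat) (z : R[i]) : R[i] :=
  (\sum_(1 <= j < k) j%:R * z ^+ j.-1) / (1 - z ^+ k).

(* sk k is (1 - z)^-1 times the logarithmic derivative of 1 + z + ... + z^(k-1) *)
Lemma sk_log_derivative (R : realType) (k : nat) (z : R[i]) :
  let q : {poly R[i]} := \sum_(j < k) 'X^j in
  sk k z = (1 - z)^-1 * (q^`().[z] / q.[z]).
Proof.
move=> q.
have -> : q.[z] = \sum_(j < k) z ^+ j.
  by rewrite horner_sum; apply: eq_bigr => j _; rewrite hornerXn.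
have -> : q^`().[z] = \sum_(1 <= j < k) j%:R * z ^+ j.-1.
  rewrite raddf_sum horner_sum.
  under eq_bigr do rewrite /= derivXn hornerMn hornerXn -mulr_natl.
  case: k {q} => [|k]; first by rewrite big_ord0 big_geq.
  by rewrite -(big_mkord xpredT (fun j => j%:R * z ^+ j.-1)) big_nat_recl// mul0r
    add0r big_add1.
have qz : 1 - z ^+ k = (1 - z) * \sum_(j < k) z ^+ j.
  by rewrite -opprB subrX1 -mulNr opprB.
by rewrite /sk qz invfM mulrCA.
Qed.

Definition H0 (R : realType) : set (R[i] -> R[i]) :=
  closed_linear_span [set sk k | k in [set k : nat | (2 <= k)%N]].

(* Main.v *)
Require Import Defs.
From HB Require Import structures.
From mathcomp Require Import all_boot all_order all_algebra.
From mathcomp Require Import all_classical all_reals all_analysis.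
From mathcomp Require Import measurable_realfun.
From mathcomp Require Import ring lra zify.
From mathcomp.real_closed Require Import complex.

(* Write h = g / (1 - z) = sum_n a_n z^n, so that g = sum_n b_n z^n with
   b_n = a_n - a_(n-1).

   Since n+1 mod k is the n-th Taylor coefficient of s_k, orthogonality to s_k reads
   sum_n (n+1 mod k) b_n / ((n+1)(n+2)) = 0.  Put t_n - t_(n+1) = b_n / ((n+1)(n+2)) with
   t_n -> 0.  As h is in the Bergman space, sum_n |a_n| / (n+1)^2 converges, whence so does
   sum_n |t_n|; this is where the hypothesis on g / (1 - z) enters.  Abel summation turns
   the orthogonality relations into k * sum_(k | n) t_(n-1) = sum_n t_(n-1) for all k >= 1.
   Sieving out the primes gives k t_(k-1) = t_0, and the divergence of the harmonic series
   forces t = 0, so that b = 0.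

   To identify a_n with a multiple of the inner product <f, z^n> without Cauchy's formula,
   consider J(c) = int f(cz) conj(z^n) dA_1(z).  Rotation invariance gives
   J(cu) = u^n J(c) for |u| = 1; as f is complex differentiable, this yields
   t J'(t) = n J(t) for 0 < t < 1, so that J(t) / t^n is constant, and its value is
   read off as t -> 0.  Invariance of the area measure under a rotation holds because a
   rotation is a product of three shears. *)

Set Implicit Arguments.
Unset Strict Implicit.
Unset Printing Implicit Defensive.

Import Order.TTheory GRing.Theory Num.Theory.
Import numFieldNormedType.Exports.

Local Open Scope classical_set_scope.
Local Open Scope ring_scope.

(** * The arithmetic sieve *)

Section tails.
Variable R : realType.
Implicit Types a b : nat -> R.

(** Analyticity is given only as a local power series, so coefficients living near 0 have to be tied
    to integrals over the whole disk; J is the bridge. The equation t J' = n J is an integrated form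
    of the polar Cauchy-Riemann equations: a radial increment e and a rotation by an angle of about
    e/t displace tz by ez and by about iez, and the two difference quotients have the same complex
    derivative as limit.

    Summability of |a_n| / (n+1)^2 comes from Bessel's inequality together with 2|a_n| <= |a_n|^2 +
    1. The same bound for g alone would not do: estimating t_n termwise leads to sum |b_n| / (n+2),
    one power of n short. Writing b_n = a_n - a_(n-1) and summing by parts gains exactly this power.

    The sieve works with real sequences and is applied to the real and imaginary parts of a_n
    separately. *)

Definition tail a n : R := limn (series a) - series a n.

Lemma tailS a n : tail a n - tail a n.+1 = a n.
Proof. by rewrite /tail seriesSr /=; ring. Qed.

Lemma cvg_tail a : cvgn (series a) -> tail a @ \oo --> 0.
Proof.
move=> ca; rewrite /tail -[X in _ --> X](subrr (limn (series a))).
by apply: cvgB => //; exact: cvg_cst.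
Qed.

Lemma ler_norm_tail a b n : (forall k, `|a k| <= b k) -> cvgn (series b) ->
  `|tail a n| <= tail b n.
Proof.
move=> ab cb.
have ca : cvgn (series a).
  apply: normed_cvg; apply: series_le_cvg cb => // k; first exact: normr_ge0.
  exact: le_trans (normr_ge0 _) (ab k).
rewrite -[leRHS]subr0 -[leLHS]subr0.
have cl : (fun m => `|series a m - series a n|) @ \oo --> `|tail a n|.
  by apply: cvg_norm; apply: cvgB; [exact: ca|exact: cvg_cst].
have cr : (fun m => series b m - series b n) @ \oo --> tail b n.
  by apply: cvgB; [exact: cb|exact: cvg_cst].
rewrite !subr0 -(cvg_lim _ cl)// -(cvg_lim _ cr)//.
apply: ler_lim; [by apply/cvg_ex; eexists; exact: cl|
  by apply/cvg_ex; eexists; exact: cr|].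
near=> m; have nm : (n <= m)%N by near: m; exact: nbhs_infty_ge.
by rewrite !sub_series nm (le_trans (ler_norm_sum _ _ _))//; apply: ler_sum.
Unshelve. all: by end_near. Qed.

(** Each [b k] is counted in [tail b 0], ..., [tail b k], that is [k.+1] times. In finite form, the
    partial sum of the tails is that of [c] plus [n * tail b n], and this last term is at most
    [tail c n]. *)
Lemma cvg_series_tail b : (forall k, 0 <= b k) ->
  cvgn (series (fun k => k.+1%:R * b k)) -> cvgn (series (tail b)).
Proof.
move=> b0 cc; set c := (fun k => _) in cc.
have bc k : `|b k| <= c k.
  by rewrite ger0_norm// /c ler_peMl// ler1n.
have cb : cvgn (series b).
  apply: series_le_cvg cc => // k; [by rewrite /c mulr_ge0|by rewrite -(ger0_norm (b0 k))].
have t0 n : 0 <= tail b n.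
  apply: le_trans (normr_ge0 _) (ler_norm_tail (a := b) n _ cb) => k.
  by rewrite ger0_norm.
have ntail n : n%:R * tail b n <= tail c n.
  (* The boolean multiplicity cuts off the terms below [n], so the scaled tail of [b] becomes the
     tail of a sequence dominated by [c] at every index. *)
  have -> : n%:R * tail b n = tail (fun k => n%:R * b k *+ (n <= k)%N) n.
    have e m : (n <= m)%N -> series (fun k => n%:R * b k *+ (n <= k)%N) m =
       n%:R * (series b m - series b n).
      move=> nm; rewrite sub_series nm mulr_sumr /series/=.
      rewrite (big_cat_nat (n := n))//= big_nat_cond big1 ?add0r; last first.
        by move=> i /andP[/andP[_ i_n] _]; rewrite leqNgt i_n.
      by apply: eq_big_nat => i /andP[-> _].
    rewrite [RHS]/tail e// subrr mulr0 subr0; apply/esym/cvg_lim => //.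
    rewrite /tail; apply: cvg_trans (_ : n%:R * (series b m - series b n) @[m --> \oo] --> _).
      apply: near_eq_cvg; near=> m; rewrite e//; near: m; exact: nbhs_infty_ge.
    by apply: cvgM; [exact: cvg_cst|apply: cvgB => //; exact: cvg_cst].
  apply: le_trans (ler_norm _) _; apply: ler_norm_tail => // k.
  case: (leqP n k) => nk /=; last by rewrite mulr0n normr0 /c mulr_ge0.
  rewrite ger0_norm ?mulr_ge0// ?mulr1n /c ler_wpM2r// ler_nat; exact: leqW.
apply: nondecreasing_is_cvgn.
  by apply: nondecreasing_series => n _ _; exact: t0.
exists (limn (series c)) => _ [n _ <-].
have -> : series (tail b) n = series c n + n%:R * tail b n.
  elim: n => [|n ih]; first by rewrite /series/= !big_geq// mul0r addr0.
  rewrite !seriesSr [X in X + _]ih /c /= -[in RHS](tailS b n) -natr1; ring.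
by rewrite -lerBrDl; exact: ntail.
Unshelve. all: by end_near. Qed.

End tails.

Section sieve.
Variables (R : realType) (t : nat -> R).
Hypothesis ct : cvgn (series (fun i => `|t i|)).

Let ssum (phi : pred nat) := fun i => (phi i.+1)%:R * t i.

Let norm_ssum phi i : `|ssum phi i| <= `|t i|.
Proof.
by rewrite /ssum normrM; case: (phi _); rewrite ?normr1 ?mul1r// normr0 mul0r.
Qed.

Let cvg_ssum phi : cvgn (series (ssum phi)).
Proof.
apply: normed_cvg; apply: series_le_cvg ct => //; first by move=> k; exact: normr_ge0.
exact: norm_ssum.
Qed.

(** What remains of the multiples of [k] after sieving the cofactor by the primes up to [r]. Nothing
    is removed at [r = 0]; below any bound only [k] survives once [r] is large. *)
Let coprime_multiples r k : pred nat := fun j => ((k %| j) && coprime (j %/ k) r`!)%N.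

(** A prime common to the cofactor and to a non-prime [r.+1] is at most [r], so it already divides
    r!. *)
Let coprime_multiplesS r k j : (0 < k)%N ->
  ~~ prime r.+1 -> coprime_multiples r.+1 k j = coprime_multiples r k j.
Proof.
move=> k0 pr; rewrite /coprime_multiples factS coprimeMr; congr andb.
case: (boolP (coprime _ r`!)) => [cop|_]; last by rewrite andbF.
rewrite andbT; set x := (j %/ k)%N in cop *.
case: (boolP (coprime x r.+1)) => // d1.
have qp : prime (pdiv (gcdn x r.+1)).
  by apply: pdiv_prime; rewrite ltn_neqAle eq_sym -/(coprime _ _) d1 gcdn_gt0 orbT.
set q := pdiv _ in qp.
have qd : (q %| gcdn x r.+1)%N by exact: pdiv_dvd.
have qx : (q %| x)%N := dvdn_trans qd (dvdn_gcdl _ _).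
have qr : (q %| r.+1)%N := dvdn_trans qd (dvdn_gcdr _ _).
have : (q %| r`!)%N.
  apply: dvdn_fact; rewrite prime_gt0//= -ltnS ltn_neqAle dvdn_leq// andbT.
  by apply: contra pr => /eqP <-.
move: cop; rewrite coprime_sym => /coprime_dvdl /[apply].
by rewrite prime_coprime// qx.
Qed.

(** Inclusion-exclusion for one new prime: the cofactors divisible by [r.+1] are taken away. *)
Let coprime_multiples_prime r k j : (0 < k)%N -> prime r.+1 ->
  (coprime_multiples r.+1 k j)%:R =
  (coprime_multiples r k j)%:R - (coprime_multiples r (k * r.+1) j)%:R :> R.
Proof.
move=> k0 pr; rewrite /coprime_multiples factS coprimeMr.
(* By Wilson's theorem [r.+1] divides r! + 1, so it cannot divide r! as well. *)
have cpr : coprime r.+1 r`!.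
  rewrite prime_coprime//; apply/negP => rd; have := pr.
  rewrite Wilson ?prime_gt1//= -[r`!.+1]addn1 dvdn_addr// dvdn1 => /eqP r1.
  by rewrite r1 in pr.
case: (boolP (k %| j)%N) => [/dvdnP[x ->]|nkj]; last first.
  rewrite /= (_ : (k * r.+1 %| j)%N = false) ?subrr//.
  by apply/negP => /(dvdn_trans (dvdn_mulr _ (dvdnn k))); exact/negP.
rewrite mulnK// [(x * k)%N]mulnC dvdn_pmul2l//= [coprime _ r.+1]coprime_sym prime_coprime//.
case: (boolP (r.+1 %| x)%N) => [/dvdnP[y ->]|nx] /=; last by rewrite subr0.
by rewrite mulnCA mulnK ?muln_gt0 ?k0// coprimeMl cpr andbT subrr.
Qed.

(** The cofactor of [j] is at most [r], hence divides r!; being coprime to r! forces it to be 1. *)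
Let coprime_multiples_le r k j : (0 < k)%N -> (0 < j <= r)%N ->
  coprime_multiples r k j = (j == k).
Proof.
move=> k0 /andP[j0 jr]; rewrite /coprime_multiples.
case: (boolP (k %| j)%N) => [/dvdnP[x xE]|nkj]; last first.
  by apply/esym/negP => /eqP jk; rewrite jk dvdnn in nkj.
have x0 : (0 < x)%N by move: j0; rewrite xE; case: (x).
rewrite /= xE mulnK// -{2}[k]mul1n eqn_pmul2r//.
have xr : (x <= r)%N by apply: leq_trans jr; rewrite xE leq_pmulr.
case: (eqVneq x 1%N) => [->|x1]; first by rewrite coprime1n.
apply/negP => cop.
have xr' : (0 < x <= r)%N by rewrite x0.
have := coprime_dvdr (dvdn_fact xr') cop.
by rewrite /coprime gcdnn (negbTE x1).
Qed.

Let lim_pred1 k : limn (series (ssum (pred1 k.+1))) = t k.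
Proof.
apply/cvg_lim => //; apply: cvg_near_cst; near=> n.
have kn : (k < n)%N by near: n; exact: nbhs_infty_gt.
rewrite /series/= (big_cat_nat (n := k.+1))//= big_nat_recr//= big1_seq ?add0r; last first.
  by move=> i; rewrite mem_index_iota/= /ssum/= eqSS => ik; rewrite (ltn_eqF ik) mul0r.
rewrite [X in _ + X]big1_seq ?addr0; first by rewrite /ssum /= eqxx mul1r.
by move=> i; rewrite mem_index_iota/= /ssum/= eqSS => /andP[ki _]; rewrite (gtn_eqF ki) mul0r.
Unshelve. all: by end_near. Qed.

(** Up to [r] the sieved set is the single point [k.+1], so the error is dominated by the tail of
    the series of [|t i|]. *)
Let cvg_coprime_multiples k :
  limn (series (ssum (coprime_multiples r k.+1))) @[r --> \oo] --> t k.
Proof.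
apply/subr_cvg0/norm_cvg0P.
apply: (@squeeze_cvgr _ _ _ _ (cst 0) (tail (fun i => `|t i|))).
- near=> r; rewrite normr_ge0/= -[t k]lim_pred1 -lim_seriesB//.
  set d := (X in series X).
  have d0 : series d r = 0.
    rewrite /series/=; apply: big1_seq => i; rewrite mem_index_iota/= => ir.
    by rewrite /d !fctE /ssum coprime_multiples_le//= subrr.
  rewrite -[limn _]subr0 -d0 -/(tail d r); apply: ler_norm_tail ct => i.
  rewrite /d !fctE /ssum -mulrBl normrM ler_piMl//.
  by case: (coprime_multiples _ _ _); case: (pred1 _ _);
    rewrite ?subrr ?subr0 ?sub0r ?normrN ?normr1 ?normr0.
- exact: cvg_cst.
- exact: cvg_tail.
Unshelve. all: by end_near. Qed.

(* Indexing t from 1, sieving by the primes up to r turns the hypothesis into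
   k * sum_(j coprime to r!) t_(kj) = sum_(j coprime to r!) t_j,
   which tends to k t_k = t_1 as r grows. *)
Lemma sum_multiples_eq0 :
  (forall k, (0 < k)%N ->
    k%:R * limn (series (fun i => (k %| i.+1)%N%:R * t i)) = limn (series t)) ->
  forall i, t i = 0.
Proof.
move=> H.
have kL r k : (0 < k)%N -> k%:R * limn (series (ssum (coprime_multiples r k))) =
    limn (series (ssum (coprime_multiples r 1))).
  elim: r k => [|r ih] k k0.
    have e m : limn (series (ssum (coprime_multiples 0 m))) =
        limn (series (fun i => (m %| i.+1)%N%:R * t i)).
      by congr (limn (series _)); apply/funext => i;
        rewrite /ssum /coprime_multiples fact0 coprimen1 andbT.
    rewrite !e H//; congr (limn (series _)); apply/funext => i.
    by rewrite dvd1n mul1r.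
  case: (boolP (prime r.+1)) => pr; last first.
    rewrite [in LHS](_ : coprime_multiples r.+1 k = coprime_multiples r k); last first.
      by apply/funext => j; rewrite coprime_multiplesS.
    rewrite [in RHS](_ : coprime_multiples r.+1 1 = coprime_multiples r 1); last first.
      by apply/funext => j; rewrite coprime_multiplesS.
    exact: ih.
  have e m : (0 < m)%N -> limn (series (ssum (coprime_multiples r.+1 m))) =
    limn (series (ssum (coprime_multiples r m))) -
    limn (series (ssum (coprime_multiples r (m * r.+1)))).
    move=> m0; rewrite -lim_seriesB//; congr (limn (series _)); apply/funext => i.
    by rewrite /ssum coprime_multiples_prime// mulrBl.
  have r0 : r.+1%:R != 0 :> R by rewrite pnatr_eq0.
  (* The induction hypothesis is used at [k], at [k * r.+1] and at [r.+1]: removing the new prime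
     multiplies both sides by the same factor 1 - 1/(r+1). *)
  rewrite !e// mul1n mulrBr ih//; congr (_ - _); apply: (mulfI r0).
  by rewrite mulrA -natrM [(r.+1 * k)%N]mulnC ih ?muln_gt0 ?k0// ih.
have kt k : k.+1%:R * t k = t 0%N.
  have c1 : k.+1%:R * limn (series (ssum (coprime_multiples r k.+1))) @[r --> \oo]
      --> k.+1%:R * t k.
    by apply: cvgM; [exact: cvg_cst|exact: cvg_coprime_multiples].
  have c2 := @cvg_coprime_multiples 0%N.
  apply: (cvg_unique _ c1) => //.
  by rewrite (_ : (fun r => _) =
    (fun r => limn (series (ssum (coprime_multiples r 1)))))//; apply/funext => r; exact: kL.
have t0 : t 0%N = 0.
  apply/eqP/negP => /negP t0; apply: (@dvg_harmonic R).
  rewrite (_ : harmonic = (t 0%N)^-1 *: t).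
    by apply: is_cvg_seriesZ; exact: normed_cvg.
  apply/funext => k; have k0 : k.+1%:R != 0 :> R by rewrite pnatr_eq0.
  by apply: (mulfI k0); rewrite mulfV// mulrCA kt mulVf.
by move=> i; have /eqP := kt i; rewrite t0 mulf_eq0 pnatr_eq0/= => /eqP.
Qed.

End sieve.

Section abel.
Variables (R : realType) (h : nat -> R).

Let g n := h n - (if n is n'.+1 then h n' else 0).

Hypothesis ch : cvgn (series (fun n => `|h n| / n.+1%:R ^+ 2)).
Hypothesis gk : forall k, (2 <= k)%N ->
  series (fun n => (n.+1 %% k)%N%:R * (g n / (n.+1%:R * n.+2%:R))) @ \oo --> 0.

(** Summation by parts leaves on [h n] the difference of weights 1/((n+1)(n+2)) - 1/((n+2)(n+3)) =
    2/((n+1)(n+2)(n+3)), which is one power of n smaller than the original weight. *)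
Let a n := 2 * h n / (n.+1%:R * n.+2%:R * n.+3%:R).

(** The sum of [g n] / ((n+1)(n+2)) over n >= i after summation by parts, with its boundary term at
    i. In this form both terms can be summed absolutely over i. *)
Let t i := tail a i - (if i is i'.+1 then h i' else 0) / (i.+1%:R * i.+2%:R).

Let tS i : t i - t i.+1 = g i / (i.+1%:R * i.+2%:R).
Proof.
have -> : t i - t i.+1 = (tail a i - tail a i.+1) +
   (h i / (i.+2%:R * i.+3%:R) - (if i is i'.+1 then h i' else 0) / (i.+1%:R * i.+2%:R)).
  by rewrite /t; ring.
rewrite tailS /a /g; set u := (if _ is _.+1 then _ else _).
have x0 : 0 < i.+1%:R :> R by rewrite ltr0n.
rewrite -[i.+3%:R]natr1 -[i.+2%:R]natr1; field.
by apply/and3P; split; apply: lt0r_neq0; lra.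
Qed.

(** The weight [k.+1] is the one that [cvg_series_tail] asks for in order to sum the tails of
    [|a k|]. *)
Let cvg_wa : cvgn (series (fun k => k.+1%:R * `|a k|)).
Proof.
have c2 : cvgn (series (2 *: (fun n => `|h n| / n.+1%:R ^+ 2))).
  exact: is_cvg_seriesZ.
apply: series_le_cvg c2 => n.
- by rewrite mulr_ge0.
- by rewrite !fctE mulr_ge0// divr_ge0.
- rewrite !fctE /GRing.scale/= /a normrM normrM normfV normr_nat [`|_ * _ * _|]ger0_norm//.
  have x0 : 0 < n.+1%:R :> R by rewrite ltr0n.
  rewrite (_ : _ * _ = 2 * (`|h n| / (n.+2%:R * n.+3%:R))); last first.
    rewrite -[n.+3%:R]natr1 -[n.+2%:R]natr1; field.
    by apply/and3P; split; apply: lt0r_neq0; lra.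
  rewrite ler_wpM2l// ler_wpM2l// lef_pV2 ?posrE ?mulr_gt0 ?exprn_gt0 ?ltr0n//.
  by rewrite -natrX -natrM ler_nat expnS expn1; apply: leq_mul; lia.
Qed.

Let ct : cvgn (series (fun i => `|t i|)).
Proof.
pose v i : R := (if i is i'.+1 then `|h i'| else 0) / (i.+1%:R * i.+2%:R).
have cv : cvgn (series v).
  suff : cvgn [sequence series v n.+1]_n.
    by move=> /cvg_ex[l]; rewrite (cvg_shiftS (series v)) => vl; apply/cvg_ex; exists l.
  have -> : [sequence series v n.+1]_n = series (fun i => `|h i| / (i.+2%:R * i.+3%:R)).
    apply/funext => n; rewrite /series/= big_nat_recl// {1}/v mul0r add0r.
    by [].
  apply: series_le_cvg ch => n; [by rewrite divr_ge0|by rewrite divr_ge0|].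
  rewrite ler_wpM2l// lef_pV2 ?posrE ?mulr_gt0 ?exprn_gt0 ?ltr0n//.
  by rewrite -natrX -natrM ler_nat expnS expn1; apply: leq_mul; lia.
pose b n := `|a n|.
have cwb : cvgn (series (fun k => k.+1%:R * b k)) by [].
have cb : cvgn (series b).
  apply: series_le_cvg cwb => k; [exact: normr_ge0|by rewrite mulr_ge0 /b|].
  by rewrite /b ler_peMl// ler1n.
have ctb : cvgn (series (tail b)).
  by apply: cvg_series_tail => // k; exact: normr_ge0.
have tab n : `|tail a n| <= tail b n by exact: ler_norm_tail.
have v0 n : 0 <= v n by rewrite /v divr_ge0//; case: n.
have csum := is_cvg_seriesD ctb cv.
apply: series_le_cvg csum => n.
- exact: normr_ge0.
- by rewrite !fctE addr_ge0//; exact: le_trans (normr_ge0 _) (tab n).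
- rewrite !fctE; apply: le_trans (ler_normB _ _) _; apply: lerD => //.
  rewrite normrM normfV [`|_ * _|]ger0_norm// /v.
  by case: n => [|n]; rewrite ?normr0.
Qed.

Let abel (c : nat -> R) N : c 0%N = 0 ->
  \sum_(0 <= m < N) c m.+1 * (t m - t m.+1) =
  \sum_(0 <= i < N) (c i.+1 - c i) * t i - c N * t N.
Proof.
move=> c0; elim: N => [|N ih]; first by rewrite !big_geq// c0 mul0r subrr.
by rewrite !big_nat_recr//= ih; ring.
Qed.

(** [m %% k] is [m] minus [k] times the number of multiples of [k] among 1, ..., m, so each step
    adds 1 and each multiple of [k] resets the count. *)
Let modn_step k i : (0 < k)%N ->
  (i.+1 %% k)%N%:R - (i %% k)%N%:R = 1 - k%:R * (k %| i.+1)%N%:R :> R.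
Proof.
move=> k0.
have E m : (m %% k)%N%:R = m%:R - k%:R * (m %/ k)%N%:R :> R.
  by rewrite [in X in X - _](divn_eq m k) natrD natrM; ring.
rewrite !E !divn_count_dvd (big_nat_recr i.+1)//= natrD -natr1; ring.
Qed.

(** Abel summation with the weights [m %% k] turns [gk] into a series in [t] weighted by 1 - k
    [k | i+1]. The boundary term is at most [k |t n|] and vanishes in the limit. *)
Let sum_multiples k : (0 < k)%N ->
  k%:R * limn (series (fun i => (k %| i.+1)%N%:R * t i)) = limn (series t).
Proof.
move=> k0.
(* [gk] starts at [k = 2]; for [k = 1] both sides are the same series. *)
have [k1|k2] := leqP k 1.
  have -> : k = 1%N by apply/eqP; rewrite eqn_leq k1.
  rewrite mul1r; congr (limn (series _)); apply/funext => i.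
  by rewrite dvd1n mul1r.
have cnt : cvgn (series t) by exact: normed_cvg.
have cm : cvgn (series (fun i => (k %| i.+1)%N%:R * t i)).
  apply: normed_cvg; apply: series_le_cvg ct => i; [exact: normr_ge0|exact: normr_ge0|].
  by rewrite /= normrM; case: (k %| _)%N; rewrite ?normr1 ?mul1r// normr0 mul0r.
apply/esym/eqP; rewrite -subr_eq0; apply/eqP.
have l1 : series t n - k%:R * series (fun i => (k %| i.+1)%N%:R * t i) n @[n --> \oo] -->
   limn (series t) - k%:R * limn (series (fun i => (k %| i.+1)%N%:R * t i)).
  by apply: cvgB => //; apply: cvgM => //; exact: cvg_cst.
apply: (cvg_unique _ l1) => //.
have t0 : t n @[n --> \oo] --> 0 by exact: cvg_series_cvg_0.
have e n : series t n - k%:R * series (fun i => (k %| i.+1)%N%:R * t i) n =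
  series (fun n => (n.+1 %% k)%N%:R * (g n / (n.+1%:R * n.+2%:R))) n + (n %% k)%N%:R * t n.
  rewrite /series/=; under [in RHS]eq_bigr do rewrite -tS.
  rewrite (@abel (fun m => (m %% k)%N%:R)) ?mod0n// subrK.
  by rewrite mulr_sumr -sumrB; apply: eq_bigr => i _; rewrite modn_step//; ring.
suff mt0 : (n %% k)%N%:R * t n @[n --> \oo] --> (0 : R).
  rewrite /= -[0 : R]addr0 (_ : (fun n => _ - _) =
    series (fun n => (n.+1 %% k)%N%:R * (g n / (n.+1%:R * n.+2%:R))) +
    (fun n => (n %% k)%N%:R * t n)); last by apply/funext => n; rewrite e.
  by apply: cvgD => //; exact: gk.
apply/norm_cvg0P; apply: (@squeeze_cvgr _ _ _ _ (cst 0) (fun n => k%:R * `|t n|)).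
- near=> n; rewrite normr_ge0/= normrM normr_nat ler_wpM2r// ler_nat.
  by rewrite ltnW// ltn_pmod.
- exact: cvg_cst.
- rewrite -(mulr0 k%:R); apply: cvgM; first exact: cvg_cst.
  by rewrite -(normr0 R); exact: cvg_norm.
Unshelve. all: by end_near. Qed.

Lemma difference_eq0 n : g n = 0.
Proof.
have t0 := sum_multiples_eq0 ct sum_multiples.
have /eqP := tS n; rewrite !t0 subrr eq_sym mulf_eq0 invr_eq0 -natrM pnatr_eq0.
by rewrite muln_eq0 !orbF => /eqP.
Qed.

End abel.

(** * Planar Lebesgue measure under linear maps *)

Section change_of_variables.
Local Open Scope ereal_scope.
Context d1 d2 (X : measurableType d1) (Y : measurableType d2) (R : realType).
Variables (m : {measure set X -> \bar R}) (n : {measure set Y -> \bar R}).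
Variables (phi : X -> Y) (k : {nonneg R}).
Hypothesis mphi : measurable_fun setT phi.
Hypothesis mk : forall A, measurable A -> m (phi @^-1` A) = k%:num%:E * n A.

(** The pushforward of [m] along [phi] is [k] times [n]. This is applied to rotations with [k = 1]
    and to dilations by r with [k = r ^- 2]. *)
Lemma ge0_integral_comp D (f : Y -> \bar R) : measurable D ->
  measurable_fun D f -> (forall y, D y -> 0 <= f y) ->
  \int[m]_(x in phi @^-1` D) f (phi x) = k%:num%:E * \int[n]_(y in D) f y.
Proof.
move=> mD mf f0.
rewrite -ge0_integral_mscale//.
rewrite -[LHS](ge0_integral_pushforward mphi)//; last first.
  by move=> y; rewrite inE; exact: f0.
by apply: eq_measure_integral => A mA _; exact: mk.
Qed.

Lemma integrable_comp D (f : Y -> \bar R) : measurable D ->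
  n.-integrable D f -> m.-integrable (phi @^-1` D) (f \o phi).
Proof.
move=> mD /integrableP[mf foo].
have mpD : measurable (phi @^-1` D) by rewrite -[X in measurable X]setTI; exact: mphi.
apply/integrableP; split.
  by apply: (measurable_comp (F := D)) => //;
    [move=> _ [x + <-]|exact: measurable_funTS].
rewrite (ge0_integral_comp (f := fun y => `|f y|))//; last exact: measurableT_comp.
by apply: lte_mul_pinfty => //; rewrite lee_fin.
Qed.

(** Both parts of [f] have finite integrals, so the subtraction takes place among reals, where [k]
    distributes. *)
Lemma Rintegral_comp D (f : Y -> R) : measurable D ->
  n.-integrable D (EFin \o f) ->
  (\int[m]_(x in phi @^-1` D) f (phi x) = k%:num * \int[n]_(y in D) f y)%R.
Proof.
move=> mD fint; rewrite /Rintegral.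
have mpD : measurable (phi @^-1` D) by rewrite -[X in measurable X]setTI; exact: mphi.
have /integrableP[mf _] := fint.
rewrite integralE [in RHS]integralE.
have -> : \int[m]_(x in phi @^-1` D) (fun x => (f (phi x))%:E)^\+ x =
    k%:num%:E * \int[n]_(y in D) (EFin \o f)^\+ y.
  rewrite -ge0_integral_comp//; last exact: measurable_funepos.
  by apply: eq_integral => x _; rewrite -[RHS]/(((EFin \o f)^\+ \o phi) x) -funepos_comp.
have -> : \int[m]_(x in phi @^-1` D) (fun x => (f (phi x))%:E)^\- x =
    k%:num%:E * \int[n]_(y in D) (EFin \o f)^\- y.
  rewrite -ge0_integral_comp//; last exact: measurable_funeneg.
  by apply: eq_integral => x _; rewrite -[RHS]/(((EFin \o f)^\- \o phi) x) -funeneg_comp.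
have := integral_funepos_lt_pinfty mD fint; have := integral_funeneg_lt_pinfty mD fint.
have : 0 <= \int[n]_(y in D) (EFin \o f)^\+ y by apply: integral_ge0.
have : 0 <= \int[n]_(y in D) (EFin \o f)^\- y by apply: integral_ge0.
case: (\int[n]_(y in D) (EFin \o f)^\- y) => // b _.
case: (\int[n]_(y in D) (EFin \o f)^\+ y) => // a _ _ _ /=.
by rewrite mulrBr.
Qed.

End change_of_variables.

Section plane.
Variable R : realType.
Local Notation mu := (@lebesgue_measure R).
Local Notation mu2 := (@plane_measure R).

(** The pushforward under a translation gives half-open intervals their length, and this
    characterizes Lebesgue measure. *)
Lemma lebesgue_measure_translate (a : R) (A : set (measurableTypeR R)) :
  measurable A -> mu ((fun x : R => x + a : measurableTypeR R)%R @^-1` A) = mu A.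
Proof.
have mf : measurable_fun setT (fun x : R => x + a : measurableTypeR R).
  by apply: measurable_funD => //; exact: measurable_cst.
move=> mA; apply/esym.
apply: (@lebesgue_measure_unique R (pushforward mu (fun x : R => x + a : measurableTypeR R))) => //.
move=> _ [[b c]] _ <-; rewrite /pushforward.
transitivity (mu `]b - a, c - a]%classic); last first.
  by congr (mu _); apply/seteqP; split => x /=; rewrite !in_itv/= ltrBlDr lerBrDr.
rewrite !lebesgue_measure_itv/= !lte_fin ltrD2r.
by case: ifP => // _; rewrite -!EFinB; congr EFin; ring.
Qed.

Lemma lebesgue_measure_scale (c : R) (A : set (measurableTypeR R)) : 0 < c ->
  measurable A -> mu ((fun x : R => c * x : measurableTypeR R)%R @^-1` A) = (c^-1%:E * mu A)%E.
Proof.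
move=> c0; have mf : measurable_fun setT (fun x : R => c * x : measurableTypeR R).
  by apply: measurable_funM => //; exact: measurable_cst.
move=> mA; rewrite (@lebesgue_measure_unique R
  (mscale (NngNum (ltW c0)) (pushforward mu (fun x : R => c * x : measurableTypeR R))) _ A)//.
  by rewrite /= /mscale/= muleA -EFinM mulVf ?gt_eqF// mul1e.
move=> _ [[a b]] _ <-; rewrite /mscale/pushforward.
transitivity (c%:E * mu `](c^-1 * a)%R, (c^-1 * b)%R]%classic)%E; last first.
  congr (_ * mu _)%E; apply/seteqP; split => x /=; rewrite !in_itv/=.
    by rewrite ltr_pdivrMl// ler_pdivlMl.
  by rewrite ltr_pdivrMl// ler_pdivlMl.
rewrite !lebesgue_measure_itv/= !lte_fin ltr_pM2l ?invr_gt0//.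
case: ifP => // _; last by rewrite mule0.
by rewrite -!EFinB -EFinM mulrBr !mulrA mulfV ?gt_eqF// !mul1r.
Qed.

Definition cmul (u : R[i]) (p : R * R) : R * R :=
  (complex.Re u * p.1 - complex.Im u * p.2, complex.Im u * p.1 + complex.Re u * p.2).

Lemma cplx_cmul u p : cplx (cmul u p) = (u * cplx p)%R.
Proof. by case: u p => [a b] [x y]; congr Complex => //=; rewrite addrC. Qed.

Lemma measurable_cmul u : measurable_fun setT (cmul u).
Proof.
have m1 : measurable_fun setT (fun p : R * R => p.1) by exact: measurable_fst.
have m2 : measurable_fun setT (fun p : R * R => p.2) by exact: measurable_snd.
apply: measurable_fun_pair.
  by apply: measurable_funB; apply: measurable_funM => //; exact: measurable_cst.
by apply: measurable_funD; apply: measurable_funM => //; exact: measurable_cst.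
Qed.

Let shear (a : R) (p : R * R) : R * R := (p.1, p.2 + a * p.1).
Let shear' (a : R) (p : R * R) : R * R := (p.1 + a * p.2, p.2).

Let measurable_shear a : measurable_fun setT (shear a).
Proof.
have m1 : measurable_fun setT (fun p : R * R => p.1) by exact: measurable_fst.
have m2 : measurable_fun setT (fun p : R * R => p.2) by exact: measurable_snd.
apply: measurable_fun_pair => //.
by apply: measurable_funD => //; apply: measurable_funM => //; exact: measurable_cst.
Qed.

Let measurable_shear' a : measurable_fun setT (shear' a).
Proof.
have m1 : measurable_fun setT (fun p : R * R => p.1) by exact: measurable_fst.
have m2 : measurable_fun setT (fun p : R * R => p.2) by exact: measurable_snd.
apply: measurable_fun_pair => //.
by apply: measurable_funD => //; apply: measurable_funM => //; exact: measurable_cst.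
Qed.

Let mu2_shear a (A : set (R * R)) : measurable A -> mu2 (shear a @^-1` A) = mu2 A.
Proof.
move=> mA; apply: eq_integral => x _ /=.
rewrite -[RHS](@lebesgue_measure_translate (a * x)); last exact: measurable_xsection.
by congr (mu _); apply/seteqP; split => y; rewrite /xsection/= !inE.
Qed.

(** [mu2] integrates the measures of vertical sections, while [shear'] translates horizontal ones;
    this switches to the other order of integration. *)
Let mu2E (A : set (R * R)) : measurable A -> mu2 A = (mu \x^ mu)%E A.
Proof.
move=> mA; apply: product_measure_unique => // B C mB mC.
exact: product_measure2E.
Qed.

Let mu2_shear' a (A : set (R * R)) : measurable A -> mu2 (shear' a @^-1` A) = mu2 A.
Proof.
move=> mA; rewrite !mu2E//; last first.
  by rewrite -[X in measurable X]setTI; exact: measurable_shear'.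
apply: eq_integral => y _ /=.
rewrite -[RHS](@lebesgue_measure_translate (a * y)); last exact: measurable_ysection.
by congr (mu _); apply/seteqP; split => x; rewrite /ysection/= !inE.
Qed.

(* A rotation is a product of three shears, each of which preserves the product
   measure because Lebesgue measure is translation invariant on every section. *)
Lemma plane_measure_rotate (u : R[i]) (A : set (R * R)) :
  complex.Re u ^+ 2 + complex.Im u ^+ 2 = 1 -> complex.Im u != 0 ->
  measurable A -> mu2 (cmul u @^-1` A) = mu2 A.
Proof.
(* For u = exp(i theta) the coefficient [a] is -tan(theta/2), from the classical factorization of a
   rotation into horizontal, vertical and horizontal shears; it requires [s != 0]. *)
case: u => c s /= cs s0 mA; pose a := (c - 1) / s.
have -> : cmul (c +i* s)%C = shear' a \o shear s \o shear' a.
  apply/funext => -[x y]; rewrite /cmul /shear /shear' /=.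
  have cs' : c ^+ 2 = 1 - s ^+ 2 by rewrite -cs addrK.
  congr pair; last by rewrite /a; field.
  transitivity (c * x + (c ^+ 2 - 1) / s * y); last by rewrite /a; field.
  by rewrite cs'; field.
rewrite -[RHS](mu2_shear' a)// -[RHS](mu2_shear s); last first.
  by rewrite -[X in measurable X]setTI; exact: measurable_shear'.
rewrite -[RHS](mu2_shear' a)//.
rewrite -[X in measurable X]setTI; apply: measurable_shear => //.
by rewrite -[X in measurable X]setTI; exact: measurable_shear'.
Qed.

(** [r ^+ 2] times the pushforward agrees with the product measure on rectangles, where each
    coordinate scales separately, hence everywhere. *)
Lemma plane_measure_scale (r : R) (A : set (R * R)) : 0 < r -> measurable A ->
  mu2 (cmul r%:C%C @^-1` A) = ((r ^- 2)%:E * mu2 A)%E.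
Proof.
move=> r0 mA.
pose phi : measurableTypeR R * measurableTypeR R -> measurableTypeR R * measurableTypeR R
  := cmul r%:C%C.
have mr : measurable_fun setT phi by exact: measurable_cmul.
pose m' : {measure set (measurableTypeR R * measurableTypeR R) -> \bar R} :=
  mscale (NngNum (exprn_ge0 2 (ltW r0))) (pushforward (mu \x mu)%E phi).
have e (B : set (R * R)) : measurable B -> mu2 B = m' mr B.
  move=> mB; apply: product_measure_unique => // B1 B2 mB1 mB2.
  have -> : m' mr (B1 `*` B2) = ((r ^+ 2)%:E * (mu \x mu)
      (((fun x : R => r * x)%R @^-1` B1) `*` ((fun x : R => r * x)%R @^-1` B2)))%E.
    rewrite /m' /mscale/pushforward; congr (_ * _)%E; congr (product_measure1 _ _ _).
    by apply/seteqP; split => -[x y]; rewrite /phi /cmul/= !mul0r subr0 add0r.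
  have ms (C : set R) : measurable C -> measurable ((fun x : R => r * x) @^-1` C).
    move=> mC; rewrite -[X in measurable X]setTI.
    have mf : measurable_fun setT (fun x : R => r * x).
      by apply: measurable_funM => //; exact: measurable_cst.
    exact: mf.
  rewrite product_measure1E; [|exact: ms|exact: ms].
  have msE C : measurable C -> mu ((fun x : R => r * x)%R @^-1` C) = (r^-1%:E * mu C)%E.
    exact: lebesgue_measure_scale.
  transitivity ((r ^+ 2)%:E * (r^-1%:E * mu B1 * (r^-1%:E * mu B2)))%E.
    by rewrite -(msE B1 mB1) -(msE B2 mB2).
  rewrite muleACA !muleA -!EFinM (_ : r ^+ 2 * r^-1 * r^-1 = 1) ?mul1e//.
  by field; rewrite gt_eqF.
rewrite [in RHS]e// /m' /mscale/= muleA -EFinM mulVf ?mul1e//.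
by rewrite expf_neq0// gt_eqF.
Qed.

End plane.

Import ComplexField.Normc.

Local Notation Re := complex.Re.
Local Notation Im := complex.Im.
Local Notation "x ^*" := (conjc x) : complex_scope.
Local Open Scope complex_scope.

(** * Integration against the weighted area measure *)

Section normc.
Variable R : realType.
Implicit Types (z w : R[i]) (n : nat).

(** The norm of [R[i]] takes its values in [R[i]]; estimates and integrals below use the real-valued
    [normc]. *)
Lemma norm_normc z : `|z| = (normc z)%:C.
Proof. by rewrite normc_def; case: z. Qed.

Lemma unit_diskE z : unit_disk z = (normc z < 1).
Proof. by rewrite /unit_disk/= norm_normc -[1]/(1%:C) ltcR. Qed.

Lemma sqr_normcE z : normc z ^+ 2 = Re z ^+ 2 + Im z ^+ 2.
Proof. by case: z => a b /=; rewrite sqr_sqrtr// addr_ge0// sqr_ge0. Qed.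

Lemma normc_ge0 z : 0 <= normc z.
Proof. by case: z => a b /=; rewrite sqrtr_ge0. Qed.

Lemma normr_Re_le z : `|Re z| <= normc z.
Proof.
rewrite -(@ler_pXn2r _ 2)// ?nnegrE ?normc_ge0// real_normK ?num_real//.
by rewrite sqr_normcE lerDl sqr_ge0.
Qed.

Lemma normr_Im_le z : `|Im z| <= normc z.
Proof.
rewrite -(@ler_pXn2r _ 2)// ?nnegrE ?normc_ge0// real_normK ?num_real//.
by rewrite sqr_normcE lerDr sqr_ge0.
Qed.

Lemma normc_le_ReIm z : normc z <= `|Re z| + `|Im z|.
Proof.
rewrite -(@ler_pXn2r _ 2)// ?nnegrE ?normc_ge0 ?addr_ge0// sqr_normcE sqrrD.
rewrite !real_normK ?num_real// -addrA [X in _ <= _ + X]addrC addrA lerDl.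
by rewrite mulrn_wge0// mulr_ge0.
Qed.

Lemma normcX z n : normc (z ^+ n) = normc z ^+ n.
Proof. by elim: n => [|n ih]; rewrite ?expr0 ?normc1// !exprS normcM ih. Qed.

Lemma normcR (r : R) : normc r%:C = `|r|.
Proof. by rewrite /= expr0n/= addr0 sqrtr_sqr. Qed.

Lemma normc_conj z : normc z^* = normc z.
Proof. by case: z => a b /=; rewrite sqrrN. Qed.

Lemma normcD z w : normc (z + w) <= normc z + normc w.
Proof. exact: le_normcD. Qed.

Lemma normc_opp z : normc (- z) = normc z.
Proof. exact: normcN. Qed.

Lemma normcB z w : normc (z - w) <= normc z + normc w.
Proof. by rewrite -(normc_opp w); exact: normcD. Qed.

Lemma normc_distC z w : normc (z - w) = normc (w - z).
Proof. by rewrite -normc_opp opprB. Qed.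

Lemma normc_sum (I : Type) (r : seq I) (P : pred I) (F : I -> R[i]) :
  normc (\sum_(i <- r | P i) F i) <= \sum_(i <- r | P i) normc (F i).
Proof.
apply: (big_ind2 (fun x y => normc x <= y)) => //; first by rewrite normc0.
by move=> x1 x2 y1 y2 h1 h2; apply: le_trans (normcD _ _) _; exact: lerD.
Qed.

Lemma normc_eq0 z : (normc z == 0) = (z == 0).
Proof.
apply/eqP/eqP => [/eq0_normc//|->]; exact: normc0.
Qed.

Lemma mulc_conj z : z * z^* = (normc z ^+ 2)%:C.
Proof.
rewrite sqr_normcE; case: z => a b; apply/eqP; rewrite eq_complex/=.
by apply/andP; split; apply/eqP; ring.
Qed.

Lemma cReD z w : Re (z + w) = Re z + Re w. Proof. by case: z; case: w. Qed.
Lemma cImD z w : Im (z + w) = Im z + Im w. Proof. by case: z; case: w. Qed.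
Lemma cReM z w : Re (z * w) = Re z * Re w - Im z * Im w.
Proof. by case: z; case: w. Qed.
Lemma cImM z w : Im (z * w) = Re z * Im w + Im z * Re w.
Proof. by case: z; case: w. Qed.
Lemma cReJ z : Re z^* = Re z. Proof. by case: z. Qed.
Lemma cImJ z : Im z^* = - Im z. Proof. by case: z. Qed.

End normc.

Section weighted_integral.
Variable R : realType.
Local Notation D := (@plane_disk R).
Local Notation mu2 := (@plane_measure R).
Local Notation E := (@dA1_Rintegral R).
Local Notation dens := (@dA1_density R).
Implicit Types (u v : R[i] -> R) (F G : R[i] -> R[i]).

Let m1 : measurable_fun setT (fun p : R * R => p.1).
Proof. exact: measurable_fst. Qed.
Let m2 : measurable_fun setT (fun p : R * R => p.2).
Proof. exact: measurable_snd. Qed.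

Lemma plane_diskE p : D p = (normc (cplx p) < 1).
Proof. by rewrite -unit_diskE. Qed.

Lemma measurable_sqr_normc : measurable_fun setT (fun p : R * R => normc (cplx p) ^+ 2).
Proof.
under eq_fun do rewrite sqr_normcE /=.
by apply: measurable_funD; exact: measurable_funX.
Qed.

Lemma measurable_plane_disk : measurable D.
Proof.
rewrite (_ : D = (fun p => normc (cplx p) ^+ 2) @^-1` `]-oo, 1[%classic).
  rewrite -[X in measurable X]setTI; apply: measurable_sqr_normc => //.
apply/seteqP; split => p; rewrite plane_diskE /= in_itv/= => h.
  by rewrite expr_lt1 ?normc_ge0.
by rewrite expr_lt1 ?normc_ge0 in h.
Qed.
Hint Resolve measurable_plane_disk : core.

Lemma measurable_dens (A : set (R * R)) : measurable_fun A dens.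
Proof.
apply: measurable_funTS; apply: measurable_funM => //.
apply: measurable_funM => //; apply: measurable_funB => //.
exact: measurable_sqr_normc.
Qed.

Lemma dens_ge0 p : D p -> 0 <= dens p.
Proof.
rewrite plane_diskE => h; rewrite /dA1_density mulr_ge0 ?invr_ge0 ?pi_ge0//.
by rewrite mulr_ge0// subr_ge0 exprn_ile1 ?normc_ge0// ltW.
Qed.

Lemma plane_disk_lty : (mu2 D < +oo)%E.
Proof.
apply: (@le_lt_trans _ _ (mu2 (`[-1, 1] `*` `[-1, 1]))).
  apply: le_measure; rewrite ?inE//; first exact: measurableX.
  move=> p; rewrite plane_diskE => /ltW h /=; rewrite !in_itv/= -!ler_norml.
  by split; [exact: le_trans (normr_Re_le (cplx p)) h|
             exact: le_trans (normr_Im_le (cplx p)) h].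
have -> : mu2 (`[-1, 1] `*` `[-1, 1]) =
    (@lebesgue_measure R `[(-1)%R, 1%R]%classic * @lebesgue_measure R `[(-1)%R, 1%R]%classic)%E.
  exact: product_measure1E.
rewrite !lebesgue_measure_itv/=.
by rewrite lte_fin gtrN// -!EFinB -EFinM ltry.
Qed.

Definition meas u := measurable_fun D (u \o @cplx R).
Definition intg u := meas u /\ mu2.-integrable D (fun p => (u (cplx p) * dens p)%:E).

Lemma meas_dens u : meas u -> measurable_fun D (fun p => u (cplx p) * dens p).
Proof. by move=> mu; apply: measurable_funM => //; exact: measurable_dens. Qed.

Lemma intg_le u v : meas u -> intg v ->
  (forall z, unit_disk z -> `|u z| <= v z) -> intg u.
Proof.
move=> mu [mv iv] uv; split => //; apply: le_integrable iv => //.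
  by apply/measurable_EFinP; exact: meas_dens.
move=> p Dp; rewrite /= lee_fin !normrM ler_wpM2r//.
by rewrite (le_trans (uv _ Dp))// ler_norm.
Qed.

Lemma meas_norm u : meas u -> meas (fun z => `|u z|).
Proof. by move=> mu; rewrite /meas; apply: measurableT_comp mu; exact: normr_measurable. Qed.

Lemma intg_norm u : intg u -> intg (fun z => `|u z|).
Proof.
move=> [mu iu]; split; first exact: meas_norm.
apply: le_integrable iu => //.
  by apply/measurable_EFinP; apply: (meas_dens (meas_norm mu)).
by move=> p Dp; rewrite /= lee_fin !normrM normr_id.
Qed.

Lemma meas_cst (c : R) : meas (fun=> c).
Proof. exact: measurable_cst. Qed.

Lemma measD u v : meas u -> meas v -> meas (fun z => u z + v z).
Proof. exact: measurable_funD. Qed.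

Lemma measB u v : meas u -> meas v -> meas (fun z => u z - v z).
Proof. exact: measurable_funB. Qed.

Lemma measM u v : meas u -> meas v -> meas (fun z => u z * v z).
Proof. exact: measurable_funM. Qed.

Lemma measN u : meas u -> meas (fun z => - u z).
Proof. exact: measurable_funN. Qed.

Lemma meas_eq u v : (forall z, unit_disk z -> u z = v z) -> meas u -> meas v.
Proof.
by move=> uv; apply: eq_measurable_fun => p; rewrite inE => /uv.
Qed.

Lemma intg_eq u v : (forall z, unit_disk z -> u z = v z) -> intg u -> intg v.
Proof.
move=> uv [mu iu]; split; first exact: meas_eq mu.
by apply: eq_integrable iu => // p; rewrite inE => /uv/= ->.
Qed.

Lemma intg_cst (c : R) : intg (fun=> c).
Proof.
split; first exact: meas_cst.
apply: (@le_integrable _ _ _ mu2 D _ _ (fun=> (`|c| * (2 * pi^-1))%:E)) => //.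
- by apply/measurable_EFinP; apply: meas_dens; exact: meas_cst.
- move=> p Dp; rewrite lee_fin normrM [leRHS]ger0_norm; last first.
    by rewrite mulr_ge0// mulr_ge0// invr_ge0 pi_ge0.
  rewrite ler_wpM2l// ger0_norm ?dens_ge0// /dA1_density.
  rewrite ler_wpM2r ?invr_ge0 ?pi_ge0// ler_piMr//.
  by rewrite lerBlDr lerDl exprn_ge0// normc_ge0.
- apply: measurable_bounded_integrable => //; first exact: plane_disk_lty.
  exact: bounded_cst.
Qed.

Lemma intgD u v : intg u -> intg v -> intg (fun z => u z + v z).
Proof.
move=> [mu iu] [mv iv]; split; first exact: measD.
apply: eq_integrable (integrableD _ iu iv) => // p _.
by rewrite /= -EFinD mulrDl.
Qed.

Lemma intgZ (c : R) u : intg u -> intg (fun z => c * u z).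
Proof.
move=> [mu iu]; split; first by apply: measM => //; exact: meas_cst.
apply: eq_integrable (integrableZl _ c iu) => // p _.
by rewrite /= -EFinM mulrA.
Qed.

Lemma intgN u : intg u -> intg (fun z => - u z).
Proof. by move=> /(intgZ (-1)); apply: intg_eq => z _; rewrite mulN1r. Qed.

Lemma intgB u v : intg u -> intg v -> intg (fun z => u z - v z).
Proof. by move=> iu /intgN; exact: intgD. Qed.

Lemma EintD u v : intg u -> intg v -> E (fun z => u z + v z) = E u + E v.
Proof.
move=> [mu iu] [mv iv]; rewrite -RintegralD//.
by apply: eq_Rintegral => p _; rewrite mulrDl.
Qed.

Lemma EintZ (c : R) u : intg u -> E (fun z => c * u z) = c * E u.
Proof.
move=> [mu iu]; rewrite -RintegralZl//.
by apply: eq_Rintegral => p _; rewrite mulrA.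
Qed.

Lemma Eint_eq u v : (forall z, unit_disk z -> u z = v z) -> E u = E v.
Proof. by move=> uv; apply: eq_Rintegral => p; rewrite inE => /uv ->. Qed.

Lemma Eint0 : E (fun=> 0) = 0.
Proof.
rewrite -[RHS](mul0r (E (fun=> 0))) -EintZ; last exact: intg_cst.
by apply: Eint_eq => z _; rewrite mul0r.
Qed.

Lemma EintN u : intg u -> E (fun z => - u z) = - E u.
Proof.
move=> iu; rewrite -[RHS]mulN1r -EintZ//.
by apply: Eint_eq => z _; rewrite mulN1r.
Qed.

Lemma EintB u v : intg u -> intg v -> E (fun z => u z - v z) = E u - E v.
Proof. by move=> iu iv; rewrite EintD ?EintN//; exact: intgN. Qed.

Lemma Eint_le u v : intg u -> intg v -> (forall z, unit_disk z -> u z <= v z) ->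
  E u <= E v.
Proof.
move=> [mu iu] [mv iv] uv; apply: le_Rintegral => // p Dp.
by rewrite ler_wpM2r ?uv ?dens_ge0.
Qed.

Lemma Eint_ge0 u : (forall z, unit_disk z -> 0 <= u z) -> 0 <= E u.
Proof.
move=> u0; apply: Rintegral_ge0 => p Dp.
by rewrite mulr_ge0 ?dens_ge0// u0.
Qed.

Lemma intg_cvg (u_ : nat -> R[i] -> R) u v : (forall n, meas (u_ n)) -> intg v ->
  (forall n z, unit_disk z -> `|u_ n z| <= v z) ->
  (forall z, unit_disk z -> u_ n z @[n --> \oo] --> u z) ->
  intg u /\ E (u_ n) @[n --> \oo] --> E u.
Proof.
move=> mu_ iv uv uu.
have mu : meas u.
  by apply: (@measurable_fun_cvg _ _ R D (fun n => u_ n \o @cplx R)) => // p Dp; exact: uu.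
have iu : intg u.
  apply: intg_le iv _ => // z Dz.
  have c : `|u_ n z| @[n --> \oo] --> `|u z| by apply: cvg_norm; exact: uu.
  rewrite -(cvg_lim _ c)//; apply: limr_le; first by apply/cvg_ex; eexists; exact: c.
  by apply: nearW => n; exact: uv.
split => //; case: iu => _ iu; case: iv => mv iv.
apply: fine_cvg; rewrite fineK; last exact: integrable_fin_num.
have f_f : {ae mu2, forall p, D p ->
    (u_ n (cplx p) * dens p)%:E @[n --> \oo] --> (u (cplx p) * dens p)%:E}.
  apply: aeW => p Dp; apply: cvg_EFin; first exact: nearW.
  by apply: cvgM; [exact: uu|exact: cvg_cst].
have f_g : {ae mu2, forall p n, D p ->
    (`|(u_ n (cplx p) * dens p)%:E| <= (v (cplx p) * dens p)%:E)%E}.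
  apply: aeW => p n Dp; rewrite lee_fin normrM (ger0_norm (dens_ge0 Dp)).
  by rewrite ler_wpM2r ?dens_ge0 ?uv.
have mE w : meas w -> measurable_fun D (fun p => (w (cplx p) * dens p)%:E).
  by move=> mw; apply/measurable_EFinP; exact: meas_dens.
have dc := @dominated_convergence _ _ _ mu2 D measurable_plane_disk
  (fun n p => (u_ n (cplx p) * dens p)%:E) (fun p => (u (cplx p) * dens p)%:E)
  (fun p => (v (cplx p) * dens p)%:E) (fun n => mE _ (mu_ n)) (mE _ mu).
by have [_ _] := dc f_f iv f_g.
Qed.

End weighted_integral.

Lemma cReB (R : realType) (z w : R[i]) : Re (z - w) = Re z - Re w.
Proof. by case: z; case: w. Qed.
Lemma cImB (R : realType) (z w : R[i]) : Im (z - w) = Im z - Im w.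
Proof. by case: z; case: w. Qed.

Section complex_cvg.
Variable R : realType.
Implicit Types (x y : nat -> R[i]) (l : R[i]).

(** Positive elements of [R[i]] are real, so complex and real epsilons correspond. *)
Lemma cvgc_normP x l : x @ \oo --> l <-> normc (x n - l) @[n --> \oo] --> (0 : R).
Proof.
split=> [/cvgrPdist_lt xl|xl].
  apply/cvgrPdist_lt => e e0.
  have e0' : 0 < e%:C :> R[i] by rewrite -[0]/(0%:C) ltcR.
  have := xl _ e0'; apply: filterS => n; rewrite norm_normc ltcR.
  by rewrite sub0r normrN ger0_norm ?normc_ge0// normc_distC.
apply/cvgrPdist_lt => e e0.
have [e' eE] : exists e' : R, e = e'%:C.
  by apply/complex_realP; rewrite realE (ltW e0).
move: e0; rewrite eE -[0]/(0%:C) ltcR => e0.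
move/cvgrPdist_lt : xl => /(_ _ e0); apply: filterS => n.
by rewrite sub0r normrN ger0_norm ?normc_ge0// norm_normc ltcR normc_distC.
Qed.

Lemma cvgc_Re x l : x @ \oo --> l -> Re (x n) @[n --> \oo] --> Re l.
Proof.
move/cvgc_normP => xl; apply/subr_cvg0/norm_cvg0P.
apply: (@squeeze_cvgr _ _ _ _ (cst 0) (fun n => normc (x n - l))) => //.
- near=> n; rewrite normr_ge0/= (le_trans _ (normr_Re_le _))//.
  by rewrite cReD; case: (l).
- exact: cvg_cst.
Unshelve. all: by end_near. Qed.

Lemma cvgc_Im x l : x @ \oo --> l -> Im (x n) @[n --> \oo] --> Im l.
Proof.
move/cvgc_normP => xl; apply/subr_cvg0/norm_cvg0P.
apply: (@squeeze_cvgr _ _ _ _ (cst 0) (fun n => normc (x n - l))) => //.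
- near=> n; rewrite normr_ge0/= (le_trans _ (normr_Im_le _))//.
  by rewrite cImD; case: (l).
- exact: cvg_cst.
Unshelve. all: by end_near. Qed.

Lemma cvgc_ReIm x l : Re (x n) @[n --> \oo] --> Re l -> Im (x n) @[n --> \oo] --> Im l ->
  x @ \oo --> l.
Proof.
move=> xr xi; apply/cvgc_normP.
apply: (@squeeze_cvgr _ _ _ _ (cst 0)
  (fun n => `|Re (x n) - Re l| + `|Im (x n) - Im l|)).
- near=> n; rewrite normc_ge0/= (le_trans (normc_le_ReIm _))//.
  by rewrite cReD cImD; case: (l).
- exact: cvg_cst.
- rewrite -[X in _ --> X](addr0 0); apply: cvgD; apply/norm_cvg0P/subr_cvg0; by [].
Unshelve. all: by end_near. Qed.

Lemma ler_dist_normc (z w : R[i]) : `|normc z - normc w| <= normc (z - w).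
Proof.
have h a b : normc a <= normc (a - b) + normc b :> R.
  by rewrite -{1}(subrK b a); exact: normcD.
rewrite ler_norml lerBlDr h andbT lerBrDr addrC lerBlDl normc_distC.
exact: h.
Qed.

Lemma cvgc_norm x l : x @ \oo --> l -> normc (x n) @[n --> \oo] --> normc l.
Proof.
move/cvgc_normP => xl; apply/subr_cvg0/norm_cvg0P.
apply: (@squeeze_cvgr _ _ _ _ (cst 0) (fun n => normc (x n - l))) => //.
- by near=> n; rewrite normr_ge0/= ler_dist_normc.
- exact: cvg_cst.
Unshelve. all: by end_near. Qed.

Lemma cvgc_cst l : (fun _ : nat => l) @ \oo --> l.
Proof. by apply: cvgc_ReIm; exact: cvg_cst. Qed.

Lemma cvgcD x y l m : x @ \oo --> l -> y @ \oo --> m ->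
  (fun n => x n + y n) @ \oo --> l + m.
Proof.
move=> xl ym; apply: cvgc_ReIm.
  by under eq_cvg do rewrite cReD; rewrite cReD; apply: cvgD; exact: cvgc_Re.
by under eq_cvg do rewrite cImD; rewrite cImD; apply: cvgD; exact: cvgc_Im.
Qed.

Lemma cvgcM x y l m : x @ \oo --> l -> y @ \oo --> m ->
  (fun n => x n * y n) @ \oo --> l * m.
Proof.
move=> xl ym; apply: cvgc_ReIm.
  under eq_cvg do rewrite cReM; rewrite cReM.
  by apply: cvgB; apply: cvgM; (exact: cvgc_Re || exact: cvgc_Im).
under eq_cvg do rewrite cImM; rewrite cImM.
by apply: cvgD; apply: cvgM; (exact: cvgc_Re || exact: cvgc_Im).
Qed.

Lemma cvgcB x y l m : x @ \oo --> l -> y @ \oo --> m ->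
  (fun n => x n - y n) @ \oo --> l - m.
Proof.
move=> xl ym; apply: cvgc_ReIm.
  by under eq_cvg do rewrite cReB; rewrite cReB; apply: cvgB; exact: cvgc_Re.
by under eq_cvg do rewrite cImB; rewrite cImB; apply: cvgB; exact: cvgc_Im.
Qed.

Lemma cvgc_unique x l m : x @ \oo --> l -> x @ \oo --> m -> l = m.
Proof.
move=> xl xm; apply/eqP; rewrite eq_complex; apply/andP; split; apply/eqP.
  by apply: (cvg_unique _ (cvgc_Re xl) (cvgc_Re xm)).
by apply: (cvg_unique _ (cvgc_Im xl) (cvgc_Im xm)).
Qed.

End complex_cvg.

Section complex_integral.
Variable R : realType.
Local Notation D := (@plane_disk R).
Local Notation mu2 := (@plane_measure R).
Local Notation E := (@dA1_Rintegral R).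
Local Notation I := (@dA1_integral R).
Implicit Types (u v : R[i] -> R) (F G : R[i] -> R[i]).

Definition cmeas F := meas (fun z => Re (F z)) /\ meas (fun z => Im (F z)).
Definition cint F := intg (fun z => Re (F z)) /\ intg (fun z => Im (F z)).

Lemma cmeas_eq F G : (forall z, unit_disk z -> F z = G z) -> cmeas F -> cmeas G.
Proof. by move=> FG [a b]; split; [move: a|move: b]; apply: meas_eq => z /FG ->. Qed.

Lemma cint_eq F G : (forall z, unit_disk z -> F z = G z) -> cint F -> cint G.
Proof. by move=> FG [a b]; split; [move: a|move: b]; apply: intg_eq => z /FG ->. Qed.

Lemma cmeas_cst c : cmeas (fun=> c).
Proof. by split; exact: meas_cst. Qed.

Lemma cmeas_id : cmeas (fun z => z).
Proof.
by split; apply: measurable_funTS; [exact: measurable_fst|exact: measurable_snd].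
Qed.

Lemma cmeasD F G : cmeas F -> cmeas G -> cmeas (fun z => F z + G z).
Proof.
move=> [a b] [c d]; split.
  by apply: meas_eq (measD a c) => z _; rewrite cReD.
by apply: meas_eq (measD b d) => z _; rewrite cImD.
Qed.

Lemma cmeasM F G : cmeas F -> cmeas G -> cmeas (fun z => F z * G z).
Proof.
move=> [a b] [c d]; split.
  by apply: meas_eq (measB (measM a c) (measM b d)) => z _; rewrite cReM.
by apply: meas_eq (measD (measM a d) (measM b c)) => z _; rewrite cImM.
Qed.

Lemma cmeasJ F : cmeas F -> cmeas (fun z => (F z)^*).
Proof.
move=> [a b]; split; first by apply: meas_eq a => z _; rewrite cReJ.
by apply: meas_eq (measN b) => z _; rewrite cImJ.
Qed.

Lemma cmeasN F : cmeas F -> cmeas (fun z => - F z).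
Proof.
by move=> mF; apply: cmeas_eq (cmeasM (cmeas_cst (-1)) mF) => z _; rewrite mulN1r.
Qed.

Lemma cmeasB F G : cmeas F -> cmeas G -> cmeas (fun z => F z - G z).
Proof. by move=> mF /cmeasN; exact: cmeasD. Qed.

Lemma cmeasX F n : cmeas F -> cmeas (fun z => F z ^+ n).
Proof.
move=> mF; elim: n => [|n ih].
  by apply: cmeas_eq (cmeas_cst 1) => z _; rewrite expr0.
by apply: cmeas_eq (cmeasM mF ih) => z _; rewrite exprS.
Qed.

Lemma cmeas_sum (J : Type) (s : seq J) (F : J -> R[i] -> R[i]) :
  (forall j, cmeas (F j)) -> cmeas (fun z => \sum_(j <- s) F j z).
Proof.
move=> mF; elim: s => [|j s ih].
  by apply: cmeas_eq (cmeas_cst 0) => z _; rewrite big_nil.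
by apply: cmeas_eq (cmeasD (mF j) ih) => z _; rewrite big_cons.
Qed.

Lemma cmeas_sqr_normc F : cmeas F -> meas (fun z => normc (F z) ^+ 2).
Proof.
move=> [a b]; apply: meas_eq (measD (measM a a) (measM b b)) => z _.
by rewrite sqr_normcE !expr2.
Qed.

Lemma cint_le F v : cmeas F -> intg v ->
  (forall z, unit_disk z -> normc (F z) <= v z) -> cint F.
Proof.
move=> [a b] iv Fv; split; apply: intg_le iv _ => // z Dz.
  exact: le_trans (normr_Re_le _) (Fv _ Dz).
exact: le_trans (normr_Im_le _) (Fv _ Dz).
Qed.

Lemma cint_bounded F (M : R) : cmeas F ->
  (forall z, unit_disk z -> normc (F z) <= M) -> cint F.
Proof. by move=> mF; apply: cint_le => //; exact: intg_cst. Qed.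

Lemma cintD F G : cint F -> cint G -> cint (fun z => F z + G z).
Proof.
move=> [a b] [c d]; split.
  by apply: intg_eq (intgD a c) => z _; rewrite cReD.
by apply: intg_eq (intgD b d) => z _; rewrite cImD.
Qed.

Lemma cintZ c F : cint F -> cint (fun z => c * F z).
Proof.
move=> [a b]; split.
  by apply: intg_eq (intgB (intgZ (Re c) a) (intgZ (Im c) b)) => z _; rewrite cReM.
by apply: intg_eq (intgD (intgZ (Re c) b) (intgZ (Im c) a)) => z _; rewrite cImM.
Qed.

Lemma cint0 : cint (fun=> 0).
Proof. by split; exact: intg_cst. Qed.

Lemma cint_sum (J : Type) (s : seq J) (F : J -> R[i] -> R[i]) :
  (forall j, cint (F j)) -> cint (fun z => \sum_(j <- s) F j z).
Proof.
move=> iF; elim: s => [|j s ih].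
  by apply: cint_eq cint0 => z _; rewrite big_nil.
by apply: cint_eq (cintD (iF j) ih) => z _; rewrite big_cons.
Qed.

Lemma Cint_eq F G : (forall z, unit_disk z -> F z = G z) -> I F = I G.
Proof.
by move=> FG; congr Complex; apply: Eint_eq => z Dz; rewrite FG.
Qed.

Lemma CintD F G : cint F -> cint G -> I (fun z => F z + G z) = I F + I G.
Proof.
move=> [a b] [c d]; apply/eqP; rewrite eq_complex/=; apply/andP; split; apply/eqP.
  by rewrite -EintD//; apply: Eint_eq => z _; rewrite cReD.
by rewrite -EintD//; apply: Eint_eq => z _; rewrite cImD.
Qed.

Lemma CintZ c F : cint F -> I (fun z => c * F z) = c * I F.
Proof.
move=> [a b]; apply/eqP; rewrite eq_complex cReM cImM /=; apply/andP; split; apply/eqP.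
  rewrite -!EintZ// -EintB//; [|exact: intgZ|exact: intgZ].
  by apply: Eint_eq => z _; rewrite cReM.
rewrite -!EintZ// -EintD//; [|exact: intgZ|exact: intgZ].
by apply: Eint_eq => z _; rewrite cImM.
Qed.

Lemma CintJ F : cint F -> I (fun z => (F z)^*) = (I F)^*.
Proof.
move=> [a b]; apply/eqP; rewrite eq_complex cReJ cImJ/=; apply/andP; split; apply/eqP.
  by apply: Eint_eq => z _; rewrite cReJ.
by rewrite -EintN//; apply: Eint_eq => z _; rewrite cImJ.
Qed.

Lemma Cint0 : I (fun=> 0) = 0.
Proof.
rewrite -[RHS](mul0r (I (fun=> 0))) -CintZ; last exact: cint0.
by apply: Cint_eq => z _; rewrite mul0r.
Qed.

Lemma CintB F G : cint F -> cint G -> I (fun z => F z - G z) = I F - I G.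
Proof.
move=> iF iG; rewrite -[- I G]mulN1r -CintZ// -CintD//; last exact: cintZ.
by apply: Cint_eq => z _; rewrite mulN1r.
Qed.

Lemma Cint_sum (J : Type) (s : seq J) (F : J -> R[i] -> R[i]) :
  (forall j, cint (F j)) -> I (fun z => \sum_(j <- s) F j z) = \sum_(j <- s) I (F j).
Proof.
move=> iF; elim: s => [|j s ih].
  by rewrite big_nil -[RHS]Cint0; apply: Cint_eq => z _; rewrite big_nil.
rewrite big_cons -ih -CintD//; last exact: cint_sum.
by apply: Cint_eq => z _; rewrite big_cons.
Qed.

(** Real and imaginary parts are estimated separately, whence the factor 2. *)
Lemma normc_Cint_le F v : cmeas F -> intg v ->
  (forall z, unit_disk z -> normc (F z) <= v z) -> normc (I F) <= 2 * E v.
Proof.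
move=> mF iv Fv; have [iR iI] := cint_le mF iv Fv.
rewrite (le_trans (normc_le_ReIm _))//= mulrDl !mul1r; apply: lerD.
  rewrite ler_norml lerNl -EintN//; apply/andP; split; apply: Eint_le => //;
    (try exact: intgN) => z Dz; apply: le_trans (Fv _ Dz);
    apply: le_trans (normr_Re_le _); rewrite ?ler_norm// -normrN ler_norm//.
rewrite ler_norml lerNl -EintN//; apply/andP; split; apply: Eint_le => //;
    (try exact: intgN) => z Dz; apply: le_trans (Fv _ Dz);
    apply: le_trans (normr_Im_le _); rewrite ?ler_norm// -normrN ler_norm//.
Qed.

Lemma Cint_cvg (F_ : nat -> R[i] -> R[i]) F v : (forall n, cmeas (F_ n)) -> intg v ->
  (forall n z, unit_disk z -> normc (F_ n z) <= v z) ->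
  (forall z, unit_disk z -> F_ n z @[n --> \oo] --> F z) ->
  cint F /\ I (F_ n) @[n --> \oo] --> I F.
Proof.
move=> mF iv Fv FF.
have [i1 c1] : intg (fun z => Re (F z)) /\
    E (fun z => Re (F_ n z)) @[n --> \oo] --> E (fun z => Re (F z)).
  apply: (@intg_cvg _ (fun n z => Re (F_ n z)) _ v) => //.
  - by move=> n; case: (mF n).
  - by move=> n z Dz; exact: le_trans (normr_Re_le _) (Fv n _ Dz).
  - by move=> z Dz; apply: cvgc_Re; exact: FF.
have [i2 c2] : intg (fun z => Im (F z)) /\
    E (fun z => Im (F_ n z)) @[n --> \oo] --> E (fun z => Im (F z)).
  apply: (@intg_cvg _ (fun n z => Im (F_ n z)) _ v) => //.
  - by move=> n; case: (mF n).
  - by move=> n z Dz; exact: le_trans (normr_Im_le _) (Fv n _ Dz).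
  - by move=> z Dz; apply: cvgc_Im; exact: FF.
by split => //; exact: cvgc_ReIm.
Qed.

End complex_integral.

(** * Rotation invariance and the moments of the weight *)

Section symmetries.
Variable R : realType.
Local Notation D := (@plane_disk R).
Local Notation mu2 := (@plane_measure R).
Local Notation E := (@dA1_Rintegral R).
Local Notation I := (@dA1_integral R).
Local Notation dens := (@dA1_density R).
Implicit Types (u v : R[i] -> R) (F G : R[i] -> R[i]).

Let mD : measurable D.
Proof. exact: measurable_plane_disk. Qed.
Hint Resolve mD : core.

Lemma unit_disk_mul (c z : R[i]) : normc c <= 1 -> unit_disk z -> unit_disk (c * z).
Proof.
rewrite !unit_diskE normcM => c1 z1; apply: le_lt_trans z1.
by rewrite ler_piMl ?normc_ge0.
Qed.

Lemma meas_mul v (c : R[i]) : normc c <= 1 -> meas v -> meas (fun z => v (c * z)).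
Proof.
move=> c1 mv; rewrite /meas.
have -> : (fun z => v (c * z)) \o @cplx R = (v \o @cplx R) \o cmul c.
  by apply/funext => p; rewrite /= cplx_cmul.
refine (@measurable_comp _ _ _ _ _ _ D (v \o @cplx R) D (cmul c) mD _ mv _).
  by move=> _ [p Dp <-]; rewrite /plane_disk/= cplx_cmul; exact: unit_disk_mul.
by apply: measurable_funTS; exact: measurable_cmul.
Qed.

Lemma cmeas_mul F (c : R[i]) : normc c <= 1 -> cmeas F -> cmeas (fun z => F (c * z)).
Proof.
by move=> c1 [a b]; split;
  [exact: (meas_mul (v := fun z => Re (F z)))|exact: (meas_mul (v := fun z => Im (F z)))].
Qed.

Lemma rotate_disk (c : R[i]) : normc c = 1 -> cmul c @^-1` D = D.
Proof.
move=> c1; apply/seteqP; split => p /=; rewrite !plane_diskE cplx_cmul normcM c1 mul1r//.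
Qed.

(** The disk and the density depend only on the modulus; [Im c != 0] is inherited from the
    factorization into shears. *)
Lemma Eint_rotate v (c : R[i]) : normc c = 1 -> Im c != 0 -> intg v ->
  intg (fun z => v (c * z)) /\ E (fun z => v (c * z)) = E v.
Proof.
move=> c1 c0 [mv iv].
have c11 : Re c ^+ 2 + Im c ^+ 2 = 1 by rewrite -sqr_normcE c1 expr1n.
have mk A : measurable A -> mu2 (cmul c @^-1` A) = ((1%:nng : {nonneg R})%:num%:E * mu2 A)%E.
  by move=> mA; rewrite mul1e plane_measure_rotate.
have de p : dens (cmul c p) = dens p.
  by rewrite /dA1_density cplx_cmul normcM c1 mul1r.
split.
  split; first by apply: meas_mul => //; rewrite c1.
  have := @integrable_comp _ _ _ _ R mu2 mu2 (cmul c) _ (measurable_cmul c) mk D _ mD iv.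
  rewrite rotate_disk//; apply: eq_integrable => // p _.
  by rewrite /= cplx_cmul de.
have := @Rintegral_comp _ _ _ _ R mu2 mu2 (cmul c) _ (measurable_cmul c) mk D _ mD iv.
rewrite rotate_disk// mul1r => h; apply: etrans h.
by apply: eq_Rintegral => p _; rewrite /= cplx_cmul de.
Qed.

Lemma Cint_rotate F (c : R[i]) : normc c = 1 -> Im c != 0 -> cint F ->
  I (fun z => F (c * z)) = I F.
Proof.
move=> c1 c0 [a b]; congr Complex.
  by have [_ ->] := Eint_rotate c1 c0 a.
by have [_ ->] := Eint_rotate c1 c0 b.
Qed.

(** The dilated density divided by the density. Substituting w = rz moves the dilation from [v] to
    the weight, and since this quotient lies in [0, 1] and tends to 1 as r tends to 1, dominated
    convergence applies to a merely integrable [v]. *)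
Let kappa (r : R) (z : R[i]) : R :=
  Num.max 0 (1 - normc z ^+ 2 / r ^+ 2) / (1 - normc z ^+ 2).

Let meas_kappa r : meas (kappa r).
Proof.
have mn : meas (fun z : R[i] => normc z ^+ 2).
  by apply: cmeas_sqr_normc; exact: cmeas_id.
apply: measurable_funM.
  have m0 : meas (fun=> 0 : R) by exact: meas_cst.
  have m1 : meas (fun z : R[i] => 1 - normc z ^+ 2 / r ^+ 2).
    apply: (measB (meas_cst 1)); apply: (measM mn (meas_cst _)).
  exact: measurable_maxr m0 m1.
(* 1 / (1 - |z|^2) is measurable on the disk as a pointwise limit of geometric partial sums. *)
apply: (@measurable_fun_cvg _ _ R D (fun n p => series (geometric 1 (normc (cplx p) ^+ 2)) n)).
  move=> n; apply: measurable_sum => k; apply: measurable_funM => //.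
  exact: measurable_funX.
move=> p Dp.
have := @cvg_geometric_series R 1 (normc (cplx p) ^+ 2).
rewrite mul1r; apply; rewrite ger0_norm ?exprn_ge0 ?normc_ge0//.
by rewrite expr_lt1 ?normc_ge0// -plane_diskE.
Qed.

Let kappa_le1 (r : R) z : 0 < r -> r <= 1 -> unit_disk z -> 0 <= kappa r z <= 1.
Proof.
move=> r0 r1; rewrite unit_diskE => z1.
have z2 : normc z ^+ 2 < 1 by rewrite expr_lt1 ?normc_ge0.
have d0 : 0 < 1 - normc z ^+ 2 by rewrite subr_gt0.
rewrite /kappa divr_ge0 ?le_max ?lexx ?(ltW d0)//= ler_pdivrMr// mul1r.
rewrite ge_max (ltW d0)/= lerD2l lerN2 ler_pdivlMr ?exprn_gt0//.
by rewrite ler_piMr ?exprn_ge0 ?normc_ge0// exprn_ile1// ltW.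
Qed.

Let sub_disk (r : R) : set (R * R) := [set p | normc (cplx p) < r].

Let measurable_sub_disk (r : R) : 0 < r -> measurable (sub_disk r).
Proof.
move=> r0; have rV0 : 0 < r^-1 by rewrite invr_gt0.
rewrite (_ : sub_disk r = cmul r^-1%:C @^-1` D).
  by rewrite -[X in measurable X]setTI; exact: measurable_cmul.
apply/seteqP; split => p; rewrite /sub_disk /preimage /mkset (plane_diskE (cmul _ _));
  by rewrite cplx_cmul normcM normcR gtr0_norm// mulrC ltr_pdivrMr// mul1r.
Qed.

Let scale_sub_disk (r : R) : 0 < r -> cmul r%:C @^-1` sub_disk r = D.
Proof.
move=> r0; apply/seteqP; split => p;
  by rewrite /sub_disk /preimage /mkset plane_diskE cplx_cmul normcM normcR gtr0_norm// gtr_pMr.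
Qed.

Let intg_kappa v (r : R) : 0 < r -> r <= 1 -> intg v -> intg (fun z => v z * kappa r z).
Proof.
move=> r0 r1 iv; case: (iv) => mv _; apply: (@intg_le _ _ (fun z => `|v z|)).
- by apply: measM.
- exact: intg_norm.
- move=> z Dz; have /andP[k0 k1] := kappa_le1 r0 r1 Dz.
  by rewrite normrM ler_piMr// ger0_norm.
Qed.

Let scaled_measure (r : R) (r0 : 0 < r) A : measurable A ->
  mu2 (cmul r%:C @^-1` A) =
    ((NngNum (ltW (etrans (invr_gt0 _) (exprn_gt0 2 r0)) : 0 <= r ^- 2))%:num%:E * mu2 A)%E.
Proof. by move=> mA; rewrite plane_measure_scale. Qed.

Let Eint_scale v (r : R) : 0 < r -> r <= 1 -> intg v ->
  E (fun z => v (r%:C * z)) = r ^- 2 * E (fun z => v z * kappa r z).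
Proof.
move=> r0 r1 iv; have [mvk ivk] := intg_kappa r0 r1 iv.
pose f p := v (cplx p) * kappa r (cplx p) * dens p.
have iS : mu2.-integrable (sub_disk r) (EFin \o f).
  apply: integrableS ivk => //; first exact: measurable_sub_disk.
  by move=> p; rewrite /sub_disk plane_diskE /= => /lt_le_trans; apply.
have := @Rintegral_comp _ _ _ _ R mu2 mu2 (cmul r%:C) _ (measurable_cmul r%:C)
  (scaled_measure r0) (sub_disk r) _ (measurable_sub_disk r0) iS.
rewrite scale_sub_disk//= (_ : Rintegral _ _ _ = E (fun z => v (r%:C * z))); last first.
  apply: eq_Rintegral => p; rewrite inE plane_diskE => p1.
  rewrite /f cplx_cmul -mulrA; congr (_ * _).
  rewrite /kappa /dA1_density cplx_cmul normcM normcR gtr0_norm// exprMn.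
  rewrite [X in _ - X / _]mulrC mulfK ?expf_neq0 ?gt_eqF//.
  have p2 : normc (cplx p) ^+ 2 < 1 by rewrite expr_lt1 ?normc_ge0.
  rewrite max_r ?subr_ge0 ?(ltW p2)//.
  have d0 : 0 < 1 - r ^+ 2 * normc (cplx p) ^+ 2.
    rewrite subr_gt0; apply: le_lt_trans p2; rewrite ler_piMl ?exprn_ge0 ?normc_ge0//.
    by rewrite exprn_ile1// ltW.
  by move: pi^-1 => q; field; rewrite exprMn gt_eqF.
move=> ->; congr (_ * _); rewrite /dA1_Rintegral.
(* [kappa] vanishes outside the disk of radius [r], so both integrands, extended by zero to the
   plane, coincide. *)
rewrite [RHS]Rintegral_mkcond [LHS]Rintegral_mkcond.
apply: eq_Rintegral => p _; rewrite /patch.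
case: ifPn => [pS|pS].
  rewrite ifT// inE plane_diskE; move: pS; rewrite inE /sub_disk/= => /lt_le_trans; exact.
case: ifPn => // _; rewrite /kappa max_l ?mul0r ?mulr0 ?mul0r//.
move: pS; rewrite notin_setE /sub_disk/= => /negP; rewrite -leNgt => rp.
by rewrite subr_le0 ler_pdivlMr ?exprn_gt0// mul1r ler_pXn2r ?nnegrE ?normc_ge0// ltW.
Qed.

(** The radii 1 - 1/(k+2); the shift keeps the first one positive. *)
Let rho (k : nat) : R := 1 - harmonic k.+1.

Lemma Eint_scale_cvg v : intg v ->
  E (fun z => v ((rho k)%:C * z)) @[k --> \oo] --> E v.
Proof.
move=> iv.
have rho0 k : 0 < rho k by rewrite subr_gt0 invf_lt1 ?ltr1n.
have rho1 k : rho k <= 1 by rewrite lerBlDr lerDl harmonic_ge0.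
have crho : rho @ \oo --> (1 : R).
  rewrite -[X in _ --> X]subr0; apply: cvgB; first exact: cvg_cst.
  by rewrite (cvg_shiftS (@harmonic R)); exact: cvg_harmonic.
have [_ c] : intg v /\ E (fun z => v z * kappa (rho k) z) @[k --> \oo] --> E v.
  apply: (@intg_cvg _ (fun k z => v z * kappa (rho k) z) _ (fun z => `|v z|)).
  - by move=> k; case: (intg_kappa (rho0 k) (rho1 k) iv).
  - exact: intg_norm.
  - move=> k z Dz; have /andP[k0 k1] := kappa_le1 (rho0 k) (rho1 k) Dz.
    by rewrite normrM ler_piMr// ger0_norm.
  - move=> z; rewrite unit_diskE => z1; rewrite -[X in _ --> X]mulr1.
    apply: cvgM; first exact: cvg_cst.
    have z2 : normc z ^+ 2 < 1 by rewrite expr_lt1 ?normc_ge0.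
    have e : Num.max 0 (1 - normc z ^+ 2 / 1 ^+ 2) / (1 - normc z ^+ 2) = 1.
      by rewrite expr1n divr1 max_r ?subr_ge0 ?(ltW z2)// mulfV// gt_eqF// subr_gt0.
    rewrite -[X in _ --> X]e /kappa; apply: cvgM; last exact: cvg_cst.
    under eq_cvg do rewrite maxr_absE; rewrite maxr_absE.
    have ca : 1 - normc z ^+ 2 / rho k ^+ 2 @[k --> \oo] --> 1 - normc z ^+ 2 / 1 ^+ 2.
      apply: cvgB; first exact: cvg_cst.
      apply: cvgM; first exact: cvg_cst.
      apply: cvgV; first by rewrite expr1n oner_neq0.
      exact: (cvgM crho crho).
    apply: cvgM; last exact: cvg_cst.
    apply: cvgD; first by apply: cvgD ca; exact: cvg_cst.
    by apply: cvg_norm; apply: cvgB ca; exact: cvg_cst.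
under eq_cvg do rewrite Eint_scale//.
have -> : E v = (1 ^+ 2)^-1 * E v by rewrite expr1n invr1 mul1r.
by apply: cvgM => //; apply: cvgV; [rewrite expr1n oner_neq0|exact: (cvgM crho crho)].
Qed.

(** Lets the radius tend to 1 once the moments of the dilates of an analytic function are known. *)
Lemma Cint_scale_cvg F : cint F ->
  exists rho : nat -> R, [/\ forall k, 0 < rho k < 1, rho @ \oo --> (1 : R) &
  I (fun z => F ((rho k)%:C * z)) @[k --> \oo] --> I F].
Proof.
move=> [a b]; exists rho; split.
- by move=> k; rewrite subr_gt0 invf_lt1 ?ltr1n//= ltrBlDr ltrDl harmonic_gt0.
- rewrite -[X in _ --> X]subr0; apply: cvgB; first exact: cvg_cst.
  by rewrite (cvg_shiftS (@harmonic R)); exact: cvg_harmonic.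
- by apply: cvgc_ReIm; [exact: Eint_scale_cvg a|exact: Eint_scale_cvg b].
Qed.

(** Its value is pi/(n+1); it is found relative to [M 0] by comparing integrals over thin annuli. *)
Let M (n : nat) : R := Rintegral mu2 D (fun p => (normc (cplx p) ^+ 2) ^+ n).

Let integrable_bounded (A : set (R * R)) (f : R * R -> R) (c : R) : measurable A ->
  A `<=` D -> measurable_fun A f -> (forall p, A p -> `|f p| <= c) ->
  mu2.-integrable A (EFin \o f).
Proof.
move=> mA AD mf fc.
apply: (@le_integrable _ _ _ mu2 A _ _ (fun=> c%:E)) => //.
- exact/measurable_EFinP.
- by move=> p Ap; rewrite /= lee_fin; apply: le_trans (fc _ Ap) _; exact: ler_norm.
- apply: measurable_bounded_integrable => //; last exact: bounded_cst.
  by apply: le_lt_trans (@plane_disk_lty R); apply: le_measure; rewrite ?inE.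
Qed.

Let even_power_le1 n p : D p -> 0 <= (normc (cplx p) ^+ 2) ^+ n <= 1.
Proof.
rewrite plane_diskE => /ltW p1; rewrite ?exprn_ge0 ?normc_ge0//=.
by rewrite exprn_ile1// ?exprn_ge0 ?normc_ge0// exprn_ile1 ?normc_ge0.
Qed.

Let measurable_even_power (A : set (R * R)) n :
  measurable_fun A (fun p : R * R => (normc (cplx p) ^+ 2) ^+ n).
Proof.
by apply: measurable_funX; apply: measurable_funTS; exact: measurable_sqr_normc.
Qed.

Let integrable_even_power (A : set (R * R)) n : measurable A -> A `<=` D ->
  mu2.-integrable A (EFin \o (fun p => (normc (cplx p) ^+ 2) ^+ n)).
Proof.
move=> mA AD; apply: (@integrable_bounded _ _ 1) => // p /AD /(even_power_le1 n) /andP[p0 p1].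
by rewrite ger0_norm.
Qed.

(** Substituting z -> rz contributes r^2 from the area and r^(2n) from the integrand. *)
Let M_sub_disk (r : R) n : 0 < r -> r <= 1 ->
  Rintegral mu2 (sub_disk r) (fun p => (normc (cplx p) ^+ 2) ^+ n) = (r ^+ 2) ^+ n.+1 * M n.
Proof.
move=> r0 r1.
have sD : sub_disk r `<=` D.
  by move=> p; rewrite /sub_disk plane_diskE /= => /lt_le_trans; apply.
have iS := @integrable_even_power (sub_disk r) n (measurable_sub_disk r0) sD.
have := @Rintegral_comp _ _ _ _ R mu2 mu2 (cmul r%:C) _ (measurable_cmul r%:C)
  (scaled_measure r0) (sub_disk r) _ (measurable_sub_disk r0) iS.
rewrite scale_sub_disk//=.
have -> : Rintegral mu2 D (fun p => (normc (cplx (cmul r%:C p)) ^+ 2) ^+ n) =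
    (r ^+ 2) ^+ n * M n.
  rewrite /M -RintegralZl//; last exact: integrable_even_power.
  by apply: eq_Rintegral => p _; rewrite cplx_cmul normcM normcR gtr0_norm// !exprMn mulrACA.
by move=> h; rewrite exprS -mulrA h mulrA mulfV ?mul1r// expf_neq0// gt_eqF.
Qed.

(* The annulus r <= |z| < 1 has |z|^2n-integral (1 - r^(2n+2)) M_n, which lies between
   r^2n (1 - r^2) M_0 and (1 - r^2) M_0. *)
Let M_annulus (r : R) n : 0 < r -> r < 1 ->
  (r ^+ 2) ^+ n * M 0 <= (\sum_(i < n.+1) (r ^+ 2) ^+ i) * M n <= M 0.
Proof.
move=> r0 r1; pose B := D `\` sub_disk r.
have r1' := ltW r1.
have mS := measurable_sub_disk r0.
have mB : measurable B by exact: measurableD.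
have sD : sub_disk r `<=` D.
  by move=> p; rewrite /sub_disk plane_diskE /= => /lt_le_trans; apply.
have BD : B `<=` D by move=> p [].
have x1 : 0 < 1 - r ^+ 2 by rewrite subr_gt0 expr_lt1// ltW.
have MB k : Rintegral mu2 B (fun p => (normc (cplx p) ^+ 2) ^+ k) =
    (1 - (r ^+ 2) ^+ k.+1) * M k.
  have DE : D = sub_disk r `|` B.
    by rewrite /B setUDr setDv setD0; apply/seteqP; split => p; [right|case => //; exact: sD].
  rewrite mulrBl mul1r -M_sub_disk// /M [in X in _ = X - _]DE Rintegral_setU//.
  - by rewrite addrC addKr.
  - by rewrite -DE; exact: integrable_even_power.
  - by apply/disj_setPS => p [Sp []].
have B0 : Rintegral mu2 B (fun p => (normc (cplx p) ^+ 2) ^+ 0) = (1 - r ^+ 2) * M 0.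
  by rewrite MB expr1.
have Bn : Rintegral mu2 B (fun p => (normc (cplx p) ^+ 2) ^+ n) =
    (1 - r ^+ 2) * ((\sum_(i < n.+1) (r ^+ 2) ^+ i) * M n).
  rewrite MB mulrA; congr (_ * _).
  by rewrite -opprB subrX1 -mulNr opprB.
apply/andP; split; rewrite -(ler_pM2l x1) -Bn.
  rewrite mulrCA -B0 -RintegralZl//; last exact: integrable_even_power.
  apply: le_Rintegral => //.
  - apply: (@integrable_bounded _ _ 1) => //.
      by apply: measurable_funM; [exact: measurable_cst|exact: measurable_even_power].
    have xle : r ^+ 2 <= 1 by rewrite -subr_ge0 ltW.
    have x0 : 0 <= r ^+ 2 by exact: sqr_ge0.
    by move=> p _; rewrite expr0 mulr1 (ger0_norm (exprn_ge0 n x0)) exprn_ile1.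
  - exact: integrable_even_power.
  - move=> p [_]; rewrite /sub_disk/= => /negP; rewrite -leNgt => rp.
    rewrite expr0 mulr1 lerXn2r// ?nnegrE ?exprn_ge0 ?normc_ge0// ?(ltW r0)//.
    by rewrite lerXn2r// ?nnegrE ?normc_ge0// ltW.
rewrite -B0; apply: le_Rintegral => //;
  [exact: integrable_even_power|exact: integrable_even_power|].
move=> p [+ _]; rewrite plane_diskE expr0 => p1.
by rewrite exprn_ile1// ?exprn_ge0 ?normc_ge0// exprn_ile1 ?normc_ge0// ltW.
Qed.

Let rho01 k : 0 < rho k < 1.
Proof. by rewrite subr_gt0 invf_lt1 ?ltr1n//= ltrBlDr ltrDl harmonic_gt0. Qed.

Let cvg_rho : rho @ \oo --> (1 : R).
Proof.
rewrite -[X in _ --> X]subr0; apply: cvgB; first exact: cvg_cst.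
by rewrite (cvg_shiftS (@harmonic R)); exact: cvg_harmonic.
Qed.

(** As r tends to 1 in [M_annulus], the geometric sum tends to n + 1 and the lower bound to
    [M 0]. *)
Let M_ratio n : n.+1%:R * M n = M 0.
Proof.
have cX i : (rho k ^+ 2) ^+ i @[k --> \oo] --> (1 : R).
  elim: i => [|i ih]; first exact: cvg_cst.
  rewrite -[X in _ --> X]mulr1 -[X in X * _]mulr1.
  by under eq_cvg do rewrite exprS expr2; apply: cvgM => //; apply: cvgM.
have cS m : \sum_(i < m) (rho k ^+ 2) ^+ i @[k --> \oo] --> (m%:R : R).
  elim: m => [|m ih].
    by under eq_cvg do rewrite big_ord0; exact: cvg_cst.
  under eq_cvg do rewrite big_ord_recr.
  by rewrite -natr1; apply: cvgD.
apply/eqP; rewrite eq_le; apply/andP; split.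
  have c : (\sum_(i < n.+1) (rho k ^+ 2) ^+ i) * M n @[k --> \oo] --> n.+1%:R * M n.
    by apply: cvgM => //; exact: cvg_cst.
  rewrite -(cvg_lim _ c)//; apply: limr_le; first by apply/cvg_ex; eexists; exact: c.
  by apply: nearW => k; have /andP[a b] := rho01 k; have /andP[] := M_annulus n a b.
have c : (\sum_(i < n.+1) (rho k ^+ 2) ^+ i) * M n - (rho k ^+ 2) ^+ n * M 0
    @[k --> \oo] --> n.+1%:R * M n - 1 * M 0.
  by apply: cvgB; apply: cvgM => //; exact: cvg_cst.
rewrite -subr_ge0 -[X in _ - X]mul1r -(cvg_lim _ c)//.
apply: limr_ge; first by apply/cvg_ex; eexists; exact: c.
apply: nearW => k; have /andP[a b] := rho01 k; have /andP[] := M_annulus n a b.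
by rewrite subr_ge0.
Qed.

Let M0_gt0 : 0 < M 0.
Proof.
have -> : M 0 = fine (mu2 D).
  rewrite /M; under eq_Rintegral do rewrite expr0.
  by rewrite Rintegral_cst// mul1r.
apply: fine_gt0; rewrite plane_disk_lty andbT.
(* This square lies in the disk, its points having squared modulus at most 1/2. *)
apply: (@lt_le_trans _ _ (mu2 (`[0, 2^-1] `*` `[0, 2^-1]))).
  have -> : mu2 (`[0, 2^-1] `*` `[0, 2^-1]) =
    (@lebesgue_measure R `[0%R, 2^-1%R]%classic * @lebesgue_measure R `[0%R, 2^-1%R]%classic)%E.
    exact: product_measure1E.
  rewrite !lebesgue_measure_itv/= lte_fin invr_gt0 ltr0n/= -!EFinB subr0 -EFinM lte_fin.
  by rewrite mulr_gt0 ?invr_gt0.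
apply: le_measure; rewrite ?inE//; first exact: measurableX.
move=> [x y] /= []; rewrite !in_itv/= => /andP[x0 x2] /andP[y0 y2].
rewrite plane_diskE; rewrite -(@expr_lt1 _ 2)// ?normc_ge0// sqr_normcE/=.
have : x ^+ 2 <= 2^-1 ^+ 2 by rewrite lerXn2r// nnegrE ?invr_ge0.
have : y ^+ 2 <= 2^-1 ^+ 2 by rewrite lerXn2r// nnegrE ?invr_ge0.
lra.
Qed.

Definition disk_moment (n : nat) : R := E (fun z => (normc z ^+ 2) ^+ n).

(** The constant is 2, the disk having area pi. It is kept as an unspecified [c > 0] because it
    divides out of the orthogonality relations. *)
Lemma disk_momentE : exists2 c : R, 0 < c &
  forall n, disk_moment n = c / (n.+1%:R * n.+2%:R).
Proof.
exists (2 * pi^-1 * M 0).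
  by rewrite !mulr_gt0// ?invr_gt0 ?pi_gt0.
move=> n.
have -> : disk_moment n = 2 * pi^-1 * (M n - M n.+1).
  rewrite /M -RintegralB//; [|exact: integrable_even_power|exact: integrable_even_power].
  rewrite -RintegralZl//.
    apply: eq_Rintegral => p _; rewrite /dA1_density (exprS _ n).
    by move: (pi^-1) (normc (cplx p) ^+ 2) => q x; move: (x ^+ n) => y; ring.
  apply: (@integrable_bounded _ _ 1) => //.
    by apply: measurable_funB; exact: measurable_even_power.
  move=> p Dp; have /andP[a0 a1] := even_power_le1 n Dp.
  have /andP[b0 b1] := even_power_le1 n.+1 Dp.
  by rewrite ler_norml; apply/andP; split; lra.
have Mn k : M k = M 0 / k.+1%:R.
  by rewrite -(M_ratio k) mulrAC mulfV ?mul1r// pnatr_eq0.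
rewrite (Mn n) (Mn n.+1) -[n.+2%:R]natr1; move: (pi^-1) (M 0) => q m.
have x0 : 0 < n.+1%:R :> R by rewrite ltr0n.
by field; apply/andP; split; apply: lt0r_neq0; lra.
Qed.

Let pythagorean : R[i] := (3 / 5) +i* (4 / 5).

(* (3 + 4i)^n is congruent to 3 + 4i modulo 5, hence (3 + 4i) / 5 is not a root of unity. *)
Let pythagoreanX n : pythagorean ^+ n.+1 != 1.
Proof.
have [x [y e]] : exists x y : int, ((3 : R) +i* 4) ^+ n.+1 =
    (5 * x + 3)%:~R +i* (5 * y + 4)%:~R.
  elim: n => [|n [x [y ih]]]; first by exists 0, 0; rewrite expr1 !mulr0 !add0r.
  exists (3 * x - 4 * y - 2), (4 * x + 3 * y + 4); rewrite exprS ih.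
  apply/eqP; rewrite eq_complex /= !(rmorphD, rmorphB, rmorphM) /=.
  by apply/andP; split; apply/eqP; ring.
have pE : pythagorean = (5^-1)%:C * (3 +i* 4).
  apply/eqP; rewrite eq_complex /pythagorean/= !mul0r subr0 addr0.
  by apply/andP; split; apply/eqP; rewrite mulrC.
apply/eqP; rewrite pE exprMn -rmorphXn/= e => /(congr1 (@complex.Im R)) /=.
rewrite mul0r addr0 => /eqP; rewrite mulf_eq0 expf_eq0 invr_eq0 pnatr_eq0/= intr_eq0.
by move=> /eqP; lia.
Qed.

(** A rotation by u multiplies the integral by u^(m-n). Since [pythagorean] has infinite order on
    the circle, this single rotation settles every [m != n]. *)
Lemma Cint_monomial m n :
  I (fun z => z ^+ m * (z ^+ n)^*) = ((disk_moment n)%:C *+ (m == n)).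
Proof.
case: (eqVneq m n) => [->|mn].
  rewrite mulr1n; apply/eqP; rewrite eq_complex/=; apply/andP; split; apply/eqP.
    by apply: Eint_eq => z _; rewrite mulc_conj normcX exprAC.
  by rewrite -[RHS](@Eint0 R); apply: Eint_eq => z _; rewrite mulc_conj.
wlog nm : m n mn / (n < m)%N.
  move=> h; case: (ltngtP m n) mn => // c _; last by apply: h => //; rewrite gt_eqF.
  have := h n m; rewrite gt_eqF// => /(_ isT c) e.
  have ci : cint (fun z : R[i] => z ^+ n * (z ^+ m)^*).
    apply: (@cint_bounded _ _ 1).
      by apply: cmeasM; [|apply: cmeasJ]; apply: cmeasX; exact: cmeas_id.
    move=> z; rewrite unit_diskE => /ltW z1; rewrite normcM normc_conj !normcX.
    by rewrite mulr_ile1// ?exprn_ge0 ?normc_ge0// exprn_ile1 ?normc_ge0.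
  rewrite [LHS](_ : _ = (I (fun z => z ^+ n * (z ^+ m)^*))^*); first by rewrite e conjc0.
  rewrite -CintJ//; apply: Cint_eq => z _.
  by rewrite rmorphM /= conjcK mulrC.
have ci : cint (fun z : R[i] => z ^+ m * (z ^+ n)^*).
  apply: (@cint_bounded _ _ 1).
    by apply: cmeasM; [|apply: cmeasJ]; apply: cmeasX; exact: cmeas_id.
  move=> z; rewrite unit_diskE => /ltW z1; rewrite normcM normc_conj !normcX.
  by rewrite mulr_ile1// ?exprn_ge0 ?normc_ge0// exprn_ile1 ?normc_ge0.
have p1 : normc pythagorean = 1.
  apply/eqP; rewrite -(@eqrXn2 _ 2)// ?normc_ge0// sqr_normcE /=; by apply/eqP; field.
have := @Cint_rotate _ pythagorean p1 _ ci.
have -> : Im pythagorean != 0 by rewrite /= mulf_neq0// ?invr_eq0 pnatr_eq0.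
move=> /(_ isT).
rewrite (@Cint_eq _ _ (fun z => pythagorean ^+ (m - n) * (z ^+ m * (z ^+ n)^*))); last first.
  move=> z _; rewrite !exprMn rmorphM /= mulrACA; congr (_ * _).
  rewrite -{1}(subnK (ltnW nm)) exprD -mulrA mulc_conj normcX p1 !expr1n.
  by rewrite mulr1.
rewrite CintZ// => /eqP; rewrite -subr_eq0 -[X in _ - X]mul1r -mulrBl mulf_eq0.
rewrite subr_eq0 => /orP[|/eqP//].
by rewrite -(subnSK nm) (negbTE (pythagoreanX _)).
Qed.

End symmetries.

(** * Power series and analytic functions *)

Section power_series.
Variable R : realType.
Implicit Types (f : R[i] -> R[i]) (a : nat -> R[i]) (rho : R).

Definition psum f a (z0 : R[i]) rho :=
  forall w, normc w < rho -> series (fun n => a n * w ^+ n) @ \oo --> f (z0 + w).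

Lemma analytic_at_psum f z0 : analytic_at f z0 ->
  exists2 rho, 0 < rho & exists a, psum f a z0 rho.
Proof.
move=> [r [a [r0 fa]]].
have [e rE] : exists e : R, r = e%:C by apply/complex_realP; rewrite realE (ltW r0).
move: r0 fa; rewrite rE -[0]/(0%:C) ltcR => e0 fa.
exists e => //; exists a => w we.
have := fa (z0 + w); rewrite [z0 + w]addrC addrK norm_normc ltcR; exact.
Qed.

Lemma cvgc_dist_le (x : nat -> R[i]) (l c : R[i]) (B : R) : x @ \oo --> l ->
  (\forall n \near \oo, normc (x n - c) <= B) -> normc (l - c) <= B.
Proof.
move=> xl xB.
have cl := cvgcB xl (@cvgc_cst R c).
have cn := cvgc_norm cl.
by rewrite -(cvg_lim _ cn)//; apply: limr_le => //; apply/cvg_ex; eexists; exact: cn.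
Qed.

(** The terms of the series at the point [rho / 2] tend to 0, hence are bounded: a Cauchy estimate
    inside the disk of convergence. *)
Lemma psum_bound f a z0 rho : 0 < rho -> psum f a z0 rho ->
  exists2 C : R, 0 < C & forall n, normc (a n) * (rho / 2) ^+ n <= C.
Proof.
move=> r0 fa; set s := rho / 2; have s0 : 0 < s by rewrite divr_gt0.
have sr : normc s%:C < rho by rewrite normcR gtr0_norm// /s; lra.
have c := fa _ sr.
have c0 : a n * s%:C ^+ n @[n --> \oo] --> (0 : R[i]).
  rewrite -(subrr (f (z0 + s%:C))).
  have c1 := c; rewrite -(cvg_shiftS (series _)) in c1.
  have := cvgcB c1 c.
  by under eq_fun do rewrite /= seriesSB.
have /cvg_seq_bounded [M [_ /(_ (M + 1))]] : cvgn (fun n => normc (a n * s%:C ^+ n)).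
  by apply/cvg_ex; eexists; exact: cvgc_norm c0.
rewrite ltrDl => /(_ ltr01) hM; exists (`|M + 1| + 1); first by rewrite ltr_wpDl.
move=> n; have := hM n I; rewrite /= ger0_norm ?normc_ge0// normcM normcX normcR gtr0_norm//.
by move=> /le_trans; apply; rewrite (le_trans (ler_norm _))// lerDl.
Qed.

Lemma sum_half (N K : nat) : (\sum_(K <= n < N) (2^-1 : R) ^+ n <= 2 * 2^-1 ^+ K).
Proof.
have [KN|NK] := leqP K N; last by rewrite big_geq ?mulr_ge0 ?exprn_ge0 ?invr_ge0// ltnW.
suff : \sum_(K <= n < N) (2^-1 : R) ^+ n = 2 * 2^-1 ^+ K - 2 * 2^-1 ^+ N.
  by move=> ->; rewrite lerBlDr lerDl mulr_ge0 ?exprn_ge0 ?invr_ge0.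
elim: N KN => [|N ih]; first by rewrite leqn0 => /eqP ->; rewrite big_geq// subrr.
rewrite leq_eqVlt => /predU1P[<-|]; first by rewrite big_geq// subrr.
rewrite ltnS => KN; rewrite big_nat_recr//= ih// exprS; by field.
Qed.

(* Here s = rho / 2 and |w| <= s / 2, so the terms beyond K decrease at least geometrically
   with ratio 1/2. *)
Lemma psum_tail f a z0 rho (K : nat) : 0 < rho -> psum f a z0 rho ->
  exists2 C : R, 0 < C & forall w, normc w <= rho / 4 ->
    normc (f (z0 + w) - \sum_(0 <= n < K) a n * w ^+ n) <= C * normc w ^+ K.
Proof.
move=> r0 fa; have [C C0 aC] := psum_bound r0 fa.
set s := rho / 2 in aC; have s0 : 0 < s by rewrite divr_gt0.
exists (C * 2 / s ^+ K); first by rewrite divr_gt0 ?exprn_gt0// mulr_gt0.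
move=> w ws; have wr : normc w < rho by apply: le_lt_trans ws _; lra.
apply: (cvgc_dist_le (fa _ wr)); near=> N.
have KN : (K <= N)%N by near: N; exact: nbhs_infty_ge.
rewrite /series/= (big_cat_nat (n := K))//=.
rewrite [X in normc X](_ : _ = \sum_(K <= n < N) a n * w ^+ n); last first.
  by rewrite [X in X - _]addrC addrK.
rewrite (le_trans (normc_sum _ _ _))//.
set q := normc w / s.
have q0 : 0 <= q by rewrite divr_ge0 ?normc_ge0// ltW.
have q2 : q <= 2^-1 by rewrite ler_pdivrMr// /s; lra.
have aq n : normc (a n * w ^+ n) <= C * q ^+ n.
  rewrite normcM normcX /q expr_div_n [leRHS]mulrCA [leLHS]mulrC ler_wpM2l ?exprn_ge0 ?normc_ge0//.
  by rewrite ler_pdivlMr ?exprn_gt0.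
apply: (@le_trans _ _ (\sum_(K <= n < N) C * q ^+ K * 2^-1 ^+ (n - K))).
  apply: ler_sum_nat => n /andP[Kn nN]; apply: le_trans (aq n) _.
  rewrite -mulrA ler_wpM2l ?(ltW C0)// -{1}(subnKC Kn) exprD ler_wpM2l ?exprn_ge0//.
  by rewrite lerXn2r// nnegrE invr_ge0.
rewrite -mulr_sumr.
have -> : \sum_(K <= n < N) 2^-1 ^+ (n - K) = \sum_(0 <= n < N - K) 2^-1 ^+ n :> R.
  by rewrite -{1}[K]add0n big_addn; apply: eq_bigr => i _; rewrite addnK.
rewrite (le_trans (ler_wpM2l _ (sum_half _ _)))//.
  by rewrite mulr_ge0 ?exprn_ge0// ltW.
by rewrite expr0 mulr1 /q expr_div_n; rewrite le_eqVlt; apply/predU1P; left;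
    field; rewrite expf_neq0// gt_eqF.
Unshelve. all: by end_near. Qed.

Lemma normc_subX (w v : R[i]) (t : R) n : normc w <= t -> normc v <= t ->
  normc (w ^+ n.+1 - v ^+ n.+1) <= n.+1%:R * t ^+ n * normc (w - v).
Proof.
move=> wt vt; have t0 : 0 <= t := le_trans (normc_ge0 _) wt.
rewrite subrXX normcM mulrC ler_wpM2r ?normc_ge0//.
rewrite (le_trans (normc_sum _ _ _))//.
apply: (@le_trans _ _ (\sum_(i < n.+1) t ^+ n)); last first.
  by rewrite sumr_const card_ord mulr_natl.
apply: ler_sum => i _; rewrite normcM !normcX.
have -> : t ^+ n = t ^+ (n - i) * t ^+ i by rewrite -exprD subnK// -ltnS.
by apply: ler_pM; rewrite ?exprn_ge0 ?normc_ge0// lerXn2r// ?nnegrE ?normc_ge0.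
Qed.

(** Termwise estimate of differences of powers. With s = rho/2 the radius is s/4, so the n-th term
    carries 4^-n = 2^-n 2^-n: one factor absorbs the n + 1 coming from the difference of powers, the
    other one is summed. *)
Lemma psum_lipschitz f a z0 rho : 0 < rho -> psum f a z0 rho ->
  exists2 L : R, 0 < L & forall w v, normc w <= rho / 8 -> normc v <= rho / 8 ->
    normc (f (z0 + w) - f (z0 + v)) <= L * normc (w - v).
Proof.
move=> r0 fa; have [C C0 aC] := psum_bound r0 fa.
set s := rho / 2 in aC; have s0 : 0 < s by rewrite divr_gt0.
exists (C * 4 / s); first by rewrite divr_gt0// mulr_gt0.
move=> w v ws vs.
have wr : normc w < rho by apply: le_lt_trans ws _; lra.
have vr : normc v < rho by apply: le_lt_trans vs _; lra.
rewrite -[X in normc X]subr0; have c := cvgcB (fa _ wr) (fa _ vr).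
apply: (cvgc_dist_le c); apply: nearW => N; rewrite subr0.
rewrite [X in normc X](_ : _ = \sum_(0 <= n < N) a n * (w ^+ n - v ^+ n)); last first.
  by rewrite /series/= -sumrB; apply: eq_bigr => i _; rewrite mulrBr.
rewrite (le_trans (normc_sum _ _ _))//.
apply: (@le_trans _ _ (\sum_(0 <= n < N) C * 2 / s * 2^-1 ^+ n * normc (w - v))).
  apply: ler_sum => -[|n] _.
    rewrite !expr0 subrr mulr0 normc0 !mulr_ge0 ?normc_ge0 ?invr_ge0//; exact: ltW.
  rewrite normcM; have ws4 : normc w <= s / 4 by rewrite /s; lra.
  have vs4 : normc v <= s / 4 by rewrite /s; lra.
  apply: (le_trans (ler_wpM2l (normc_ge0 _) (normc_subX n ws4 vs4))).
  rewrite mulrA ler_wpM2r ?normc_ge0//.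
  have -> : normc (a n.+1) * (n.+1%:R * (s / 4) ^+ n) =
     normc (a n.+1) * s ^+ n.+1 * (n.+1%:R / 2 ^+ n) * (2^-1 ^+ n) / s.
    have -> : (s / 4) ^+ n = s ^+ n * 2^-1 ^+ n * 2^-1 ^+ n :> R.
      by rewrite -!exprMn; congr (_ ^+ n); field.
    by rewrite exprS -exprVn; move: (2^-1 ^+ n) (s ^+ n) => q y; field; rewrite gt_eqF.
  have n2 : n.+1%:R / 2 ^+ n <= 1 :> R.
    by rewrite ler_pdivrMr ?exprn_gt0// mul1r -natrX ler_nat; exact: ltn_expl.
  have -> : C * 2 / s * 2^-1 ^+ n.+1 = C * 1 * 2^-1 ^+ n / s.
    by rewrite exprS; field; rewrite gt_eqF.
  rewrite ler_wpM2r ?invr_ge0 ?(ltW s0)// ler_wpM2r ?exprn_ge0 ?invr_ge0//.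
  apply: ler_pM => //; rewrite ?mulr_ge0 ?normc_ge0 ?exprn_ge0 ?invr_ge0 ?exprn_ge0//.
  exact: ltW.
rewrite -mulr_suml ler_wpM2r ?normc_ge0// -mulr_sumr.
rewrite (le_trans (ler_wpM2l _ (sum_half _ _)))//.
  by rewrite divr_ge0 ?mulr_ge0// ltW.
by rewrite expr0 mulr1; rewrite le_eqVlt; apply/predU1P; left; field; rewrite gt_eqF.
Qed.

(** If the coefficients below n vanish, a zero at distance |w| gives |a_n| |w|^n <= C |w|^(n+1),
    that is |a_n| <= C |w|; zeros with |w| < |a_n| / C exclude [a n != 0]. *)
Lemma psum_isolated f a z0 rho : 0 < rho -> psum f a z0 rho ->
  (forall e : R, 0 < e -> exists w, [/\ w != 0, normc w < e & f (z0 + w) = 0]) ->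
  forall w, normc w < rho -> f (z0 + w) = 0.
Proof.
move=> r0 fa H.
have a0 n : a n = 0.
  elim/ltn_ind: n => n ih.
  have [C C0 hC] := psum_tail n.+1 r0 fa.
  apply/eqP; rewrite -normc_eq0 eq_le normc_ge0 andbT leNgt; apply/negP => an.
  have e0 : 0 < Num.min (rho / 4) (normc (a n) / C).
    by rewrite lt_min !divr_gt0.
  have [w [w0 + fw]] := H _ e0; rewrite lt_min => /andP[w1 w2].
  have := hC w (ltW w1); rewrite fw sub0r normc_opp big_nat_recr//= big1_seq ?add0r.
    rewrite normcM normcX exprS mulrA ler_pM2r; last first.
      by rewrite exprn_gt0// lt_neqAle eq_sym normc_eq0 w0 normc_ge0.
    rewrite leNgt => /negP; apply.
    by rewrite mulrC -ltr_pdivlMr.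
  by move=> i; rewrite mem_index_iota/= => /ih ->; rewrite mul0r.
move=> w wr; have c := fa _ wr.
apply: (cvgc_unique c).
rewrite (_ : series _ = cst 0); first exact: cvgc_cst.
by apply/funext => N; rewrite /series/= big1// => i _; rewrite a0 mul0r.
Qed.

End power_series.

Section analytic_on_disk.
Variable R : realType.
Variable f : R[i] -> R[i].
Hypothesis fA : analytic_on (@unit_disk R) f.

(** Continuation along the segment from 0 to [z1], where [t] is the supremum of the initial pieces
    on which [f] vanishes. Zeros accumulate at [t z1], so [f] vanishes around this point: either t =
    1 and [z1] is reached, or t is not an upper bound. *)
Lemma analytic_identity (d : R) : 0 < d -> (forall z, normc z < d -> f z = 0) ->
  forall z, unit_disk z -> f z = 0.
Proof.
move=> d0 fd z1; rewrite unit_diskE => Dz1.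
have [->|z10] := eqVneq z1 0; first by apply: fd; rewrite normc0.
have n0 : 0 < normc z1 by rewrite lt_neqAle eq_sym normc_eq0 z10 normc_ge0.
pose S := [set t : R | 0 <= t <= 1 /\ forall s, 0 <= s <= t -> f (s%:C * z1) = 0].
have S0 : S 0.
  split; first by rewrite lexx ler01.
  by move=> s; rewrite -eq_le => /eqP <-; rewrite mul0r; apply: fd; rewrite normc0.
have hS : has_sup S.
  by split; [exists 0|exists 1 => t [/andP[]]].
pose t := sup S.
have t1 : t <= 1 by apply: ge_sup; [exists 0|move=> s [/andP[]]].
have ft s : 0 <= s -> s < t -> f (s%:C * z1) = 0.
  move=> s0 st; have ts : 0 < t - s by rewrite subr_gt0.
  have [u [_ uS] us] := sup_adherent ts hS.
  by apply: uS; rewrite s0 ltW//; move: us; rewrite /t subKr.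
have t0 : 0 < t.
  pose e := Num.min 1 (d / 2).
  have e0 : 0 < e by rewrite lt_min ltr01 divr_gt0.
  apply: (lt_le_trans e0); apply: (sup_upper_bound hS); split.
    by rewrite (ltW e0) ge_min lexx.
  move=> s /andP[s0 se]; apply: fd; rewrite normcM normcR ger0_norm//.
  apply: (@le_lt_trans _ _ (d / 2 * 1)); last lra.
  apply: ler_pM => //; rewrite ?normc_ge0//; last exact: ltW.
  by apply: le_trans se _; rewrite ge_min lexx orbT.
have Dt : unit_disk (t%:C * z1).
  by apply: unit_disk_mul; rewrite ?unit_diskE// normcR ger0_norm// ltW.
have [rho rho0 [a fa]] := analytic_at_psum (fA Dt).
have loc := psum_isolated rho0 fa.
have ext w : normc w < rho -> f (t%:C * z1 + w) = 0.
  apply: loc => e e0.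
  (* The zero is taken at (t - x) z1, just below the supremum: [t / 2] keeps it on the segment, the
     other entry within distance [e]. *)
  pose x := Num.min (t / 2) (e / 2 / normc z1).
  have x0 : 0 < x by rewrite lt_min !divr_gt0.
  exists ((- x)%:C * z1); split.
  - by rewrite mulf_neq0// eq_complex /= oppr_eq0 gt_eqF.
  - rewrite normcM normcR normrN gtr0_norm//.
    apply: (@le_lt_trans _ _ (e / 2)); last lra.
    by rewrite -ler_pdivlMr// ge_min lexx orbT.
  - rewrite -mulrDl -rmorphD/=; apply: ft; last by rewrite ltrBlDr ltrDl.
    rewrite subr_ge0; apply: (@le_trans _ _ (t / 2)); first by rewrite ge_min lexx.
    by rewrite ler_pdivrMr// ler_pMr// ler1n.
have [t1'|] := ltP t 1; last first.
  move=> t1'; have tE : t = 1 by apply/eqP; rewrite eq_le t1 t1'.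
  have := ext 0; rewrite normc0 addr0 tE mul1r; exact.
exfalso; pose h := Num.min (1 - t) (rho / 2 / normc z1).
have h0 : 0 < h by rewrite lt_min subr_gt0 t1' !divr_gt0.
have : S (t + h).
  split.
    apply/andP; split; first by rewrite addr_ge0// ltW.
    by rewrite -lerBrDl ge_min lexx.
  move=> s /andP[s0 sth].
  have [st|ts] := ltP s t; first exact: ft.
  have := ext ((s - t)%:C * z1); rewrite -mulrDl -rmorphD/= subrKC; apply.
  rewrite normcM normcR ger0_norm ?subr_ge0//.
  apply: (@le_lt_trans _ _ (rho / 2)); last lra.
  rewrite -ler_pdivlMr//; apply: (@le_trans _ _ h); first by rewrite lerBlDl.
  by rewrite ge_min lexx orbT.
by move=> /(sup_upper_bound hS); rewrite -/t leNgt ltrDl h0.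
Qed.

End analytic_on_disk.

Section compact_disk.
Variable R : realType.

Lemma compact_closed_disk (r : R) : compact [set p : R * R | normc (cplx p) <= r].
Proof.
apply: (@subclosed_compact _ _ (`[-r, r] `*` `[-r, r])).
- have -> : [set p : R * R | normc (cplx p) <= r] =
    (fun p : R * R => Num.sqrt (p.1 * p.1 + p.2 * p.2)) @^-1` [set x | x <= r].
    by apply/seteqP; split => p /=; rewrite !expr2.
  apply: closed_comp; last exact: closed_le.
  move=> p _; apply: continuous_comp; last exact: sqrt_continuous.
  by apply: cvgD; apply: cvgM; (exact: cvg_fst || exact: cvg_snd).
- by apply: compact_setX; exact: segment_compact.
- move=> p /= pr; rewrite !in_itv/= -!ler_norml.
  by split; [exact: le_trans (normr_Re_le (cplx p)) pr|
             exact: le_trans (normr_Im_le (cplx p)) pr].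
Qed.

Variable f : R[i] -> R[i].
Hypothesis fA : analytic_on (@unit_disk R) f.

(** A single constant serves as bound, as Lipschitz constant and, inverted, as radius. Locally the
    property then holds for all large [L], and compactness of the closed disk yields one [L] for all
    its points. *)
Lemma analytic_uniform_lipschitz (r : R) : r < 1 ->
  exists2 L : R, 0 < L & forall x, normc x <= r ->
    normc (f x) <= L /\
    forall w, normc (w - x) < L^-1 -> normc (f w - f x) <= L * normc (w - x).
Proof.
move=> r1.
have /compact_near_coveringP := @compact_closed_disk r.
pose P (L : R) (p : R * R) := 0 < L /\ normc (f (cplx p)) <= L /\
    forall w, normc (w - cplx p) < L^-1 -> normc (f w - f (cplx p)) <= L * normc (w - cplx p).
move=> /(_ R (pinfty_nbhs R) P _); case.
- move=> p /= pr.
  have Dp : unit_disk (cplx p) by rewrite unit_diskE; exact: le_lt_trans r1.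
  have [rho rho0 [a fa]] := analytic_at_psum (fA Dp).
  have [L L0 Lip] := psum_lipschitz rho0 fa.
  pose t := rho / 8; have t0 : 0 < t by rewrite divr_gt0.
  (* [2 / t] makes 1/K less than half the local radius, so [w] stays where the local estimate is
     valid; the second entry bounds [f] near [p] and is at least [L]. *)
  pose M := Num.max (2 / t) (normc (f (cplx p)) + L * t + L).
  have M0 : 0 < M by rewrite lt_max divr_gt0.
  have ML : L <= M.
    by rewrite le_max lerDr addr_ge0 ?normc_ge0 ?orbT// mulr_ge0// ltW.
  exists ([set q | normc (cplx q - cplx p) < t / 2], [set K | M < K]); last first.
    move=> [q K] [/= qp MK].
    have K0 : 0 < K := lt_trans M0 MK.
    have qt : normc (cplx q - cplx p) <= t.
      by apply: ltW; apply: lt_trans qp _; lra.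
    split=> //; split.
      apply: le_trans (ltW MK); rewrite le_max; apply/orP; right.
      have := Lip (cplx q - cplx p) 0 qt; rewrite normc0 addr0 subr0 subrKC => /(_ (ltW t0)) h.
      rewrite -[X in normc (f X)](subrKC (cplx p)).
      rewrite -[f _](subrK (f (cplx p))) (le_trans (normcD _ _))// addrC -addrA lerD2l.
      rewrite subrKC (le_trans h)//.
      apply: (@le_trans _ _ (L * t)); last by rewrite lerDl ltW.
      by rewrite ler_wpM2l// ltW.
    move=> w wq.
    have Kt : K^-1 < t / 2.
      rewrite -[t / 2]invrK ltf_pV2 ?posrE ?invr_gt0 ?divr_gt0//.
      by apply: le_lt_trans MK; rewrite le_max invf_div lexx.
    have wt : normc (w - cplx p) <= t.
      have -> : w - cplx p = (w - cplx q) + (cplx q - cplx p) by rewrite addrA subrK.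
      rewrite (le_trans (normcD _ _))//.
      by rewrite [t]splitr lerD// ltW// (lt_trans wq Kt).
    have := Lip _ _ wt qt; rewrite !subrKC opprB addrA subrK => /le_trans; apply.
    by rewrite ler_wpM2r ?normc_ge0// (le_trans ML)// ltW.
  split => /=; last by exists M; split => //; exact: num_real.
  have t4 : 0 < t / 4 by rewrite divr_gt0.
  exists (ball p.1 (t / 4), ball p.2 (t / 4)); first by split; exact: nbhsx_ballx.
  move=> q [] /=; rewrite /ball/= => q1 q2.
  apply: le_lt_trans (normc_le_ReIm (cplx q - cplx p)) _; rewrite cReB cImB /=.
  by rewrite distrC [X in _ + X]distrC; lra.
- move=> N [Nr NP]; pose K := Num.max 1 (N + 1).
  have NK : N < K by rewrite lt_max ltrDl ltr01 orbT.
  have K0 : 0 < K by rewrite lt_max ltr01.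
  exists K => // -[x y] xr.
  by have [_] := NP K NK (x, y) xr.
Qed.

Lemma analytic_derivative x : unit_disk x -> exists (b : R[i]) (C r : R), 
  [/\ 0 < r, 0 < C & forall w, normc w <= r ->
  normc (f (x + w) - f x - b * w) <= C * normc w ^+ 2].
Proof.
move=> Dx; have [rho rho0 [a fa]] := analytic_at_psum (fA Dx).
have [C C0 hC] := psum_tail 2 rho0 fa.
exists (a 1%N), C, (rho / 4); split=> //; first by rewrite divr_gt0.
have e : f x = a 0%N.
  have := hC 0; rewrite normc0 expr0n/= mulr0 => /(_ _) h.
  apply/eqP; rewrite -subr_eq0 -normc_eq0 eq_le normc_ge0 andbT.
  have := h _; rewrite addr0 !big_nat_recr//= big_geq// expr0 mulr1 expr1 mulr0 addr0 add0r.
  by apply; rewrite divr_ge0// ltW.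
move=> w wr; have := hC w wr.
by rewrite !big_nat_recr//= big_geq// expr0 expr1 mulr1 add0r -e opprD addrA.
Qed.

End compact_disk.

Section real_derivative.
Variable R : realType.

(** Dominated convergence provides limits along sequences only. Were the derivative to fail,
    increments below 1/(k+1) with a fixed error could be chosen, against the sequential
    hypothesis. *)
Lemma is_derive_seq (g : R -> R) (t l d : R) : 0 < d ->
  (forall e : nat -> R, (forall k, e k != 0 /\ `|e k| < d) -> e @ \oo --> (0 : R) ->
     (g (t + e k) - g t) / e k @[k --> \oo] --> l) ->
  is_derive t (1 : R) g l.
Proof.
move=> d0 H.
suff c : (fun h => h^-1 *: ((g \o shift t) (h *: (1 : R)) - g t)) @ 0^' --> l.
  by apply: DeriveDef; [apply/cvg_ex; exists l|exact: cvg_lim c].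
apply: contrapT => /cvgrPdist_lt nc.
have [eps [eps0 heps]] : exists eps : R, 0 < eps /\ forall k : nat, exists e : R,
    [/\ e != 0, `|e| < d, `|e| < harmonic k & eps <= `|l - (g (t + e) - g t) / e|].
  apply: contrapT => h; apply: nc => eps eps0.
  have [k hk] : exists k : nat, forall e : R, e != 0 -> `|e| < d -> `|e| < harmonic k ->
      `|l - (g (t + e) - g t) / e| < eps.
    apply: contrapT => nk; apply: h; exists eps; split=> // k.
    apply: contrapT => ne; apply: nk; exists k => e e0 ed ek.
    by rewrite ltNge; apply/negP => le; apply: ne; exists e.
  have m0 : 0 < Num.min d (harmonic k) by rewrite lt_min d0 harmonic_gt0.
  exists (Num.min d (harmonic k)) => //= e.
  rewrite /ball_/= sub0r normrN lt_min => /andP[ed ek] e0.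
  by have := hk e e0 ed ek; rewrite /GRing.scale/= mulr1 [t + e]addrC [_ / e]mulrC.
have [e he] := choice heps.
have e0 : e @ \oo --> (0 : R).
  apply/norm_cvg0P; apply: (@squeeze_cvgr _ _ _ _ (cst 0) (@harmonic R)).
  - by apply: nearW => k; have [_ _ /ltW h _] := he k; rewrite normr_ge0.
  - exact: cvg_cst.
  - exact: cvg_harmonic.
have /cvgrPdist_lt/(_ _ eps0) := H e (fun k => let: And4 a b _ _ := he k in conj a b) e0.
move=> [N _ /(_ N (leqnn N))]/=; have [_ _ _] := he N.
by rewrite leNgt => /negP.
Qed.

(** Under the equation t g' = n g the quotient [g t / t ^+ n] has derivative zero, so the mean value
    theorem makes it constant. *)
Lemma power_ode (g : R -> R) (n : nat) :
  (forall t : R, 0 < t < 1 -> is_derive t (1 : R) g (n%:R * g t / t)) ->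
  forall s t : R, 0 < s < 1 -> 0 < t < 1 -> g s / s ^+ n = g t / t ^+ n.
Proof.
move=> dg.
have dpsi (x : R) : 0 < x < 1 -> is_derive x (1 : R) (fun t => g t * (t^-1) ^+ n) 0.
  move=> x01; have /andP[x0 x1] := x01; have dx := dg _ x01.
  have dV : is_derive x (1 : R) (fun t : R => t^-1) (- x ^- 2).
    have := @is_deriveV _ id x (1 : R) (1 : R) (lt0r_neq0 x0) _.
    by rewrite /GRing.scale/= mulr1; exact.
  have dX := @is_deriveX _ _ (fun t : R => t^-1) n x (1 : R) _ dV.
  have -> : (fun t : R => g t * (t^-1) ^+ n) = g * ((fun t : R => t^-1) ^+ n).
    by apply/funext => y; rewrite /= !fctE.
  have dM := is_deriveM dx dX.
  apply: (is_derive_eq dM).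
  rewrite /GRing.scale/=; clear dM dX dx dg; case: n => [|n] /=.
    by rewrite !mul0r !mulr0 addr0.
  by rewrite !fctE !exprVn (exprS x n); field; rewrite expf_neq0 gt_eqF.
suff H : forall s t : R, 0 < s < 1 -> 0 < t < 1 -> s < t -> g s / s ^+ n = g t / t ^+ n.
  move=> s t s01 t01; have [st'|ts|->//] := ltgtP s t; first exact: H.
  by apply/esym; exact: H.
move=> s t /andP[s0 s1] /andP[t0 t1] lst.
have in01 (x : R) : x \in `[s, t] -> 0 < x < 1.
  by rewrite in_itv/= => /andP[sx xt]; rewrite (lt_le_trans s0 sx) (le_lt_trans xt t1).
have [||c _] := @MVT R (fun t => g t * (t^-1) ^+ n) (fun=> 0) s t lst.
- by move=> x /subset_itv_oo_cc/in01; exact: dpsi.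
- apply: continuous_in_subspaceT => x; rewrite inE => /in01 x01.
  by apply/differentiable_continuous/derivable1_diffP; have [] := dpsi _ x01.
rewrite mul0r => /eqP; rewrite subr_eq0 !exprVn => /eqP ->.
by [].
Qed.

End real_derivative.

(** * Taylor coefficients as moments *)

Section square_integrable.
Variable R : realType.
Implicit Types F G : R[i] -> R[i].

Lemma L2_cmeas F : L2_dA1 F -> cmeas F.
Proof. by move=> [a b _]; split. Qed.

Lemma L2_intg F : L2_dA1 F -> intg (fun z => normc (F z) ^+ 2).
Proof. by move=> FL; split; [exact: cmeas_sqr_normc (L2_cmeas FL)|case: FL]. Qed.

Lemma L2_cint_mul F G : L2_dA1 F -> L2_dA1 G -> cint (fun z => F z * (G z)^*).
Proof.
move=> FL GL; apply: (cint_le _ (intgZ 2^-1 (intgD (L2_intg FL) (L2_intg GL)))).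
  by apply: cmeasM; [|apply: cmeasJ]; exact: L2_cmeas.
move=> z _; rewrite normcM normc_conj.
have := sqr_ge0 (normc (F z) - normc (G z)); rewrite sqrrB.
by set x := normc _; set y := normc _; lra.
Qed.

Lemma L2_bounded F (M : R) : cmeas F -> (forall z, unit_disk z -> normc (F z) <= M) ->
  L2_dA1 F.
Proof.
move=> mF FM; have [a b] := mF; split => //.
have [] : intg (fun z => normc (F z) ^+ 2); last by [].
apply: (intg_le (cmeas_sqr_normc mF) (intg_cst (M ^+ 2))) => z Dz.
rewrite ger0_norm ?sqr_ge0// lerXn2r// ?nnegrE ?normc_ge0// ?FM//.
exact: le_trans (normc_ge0 _) (FM _ Dz).
Qed.

Lemma normc_expr_le1 (z : R[i]) n : unit_disk z -> normc (z ^+ n) <= 1.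
Proof. by rewrite unit_diskE normcX => /ltW z1; rewrite exprn_ile1 ?normc_ge0. Qed.

Lemma L2_monomial n : L2_dA1 (fun z : R[i] => z ^+ n).
Proof.
apply: (@L2_bounded _ 1) => [|z]; first by apply: cmeasX; exact: cmeas_id.
exact: normc_expr_le1.
Qed.

End square_integrable.

Section rational_rotation.
Variable R : realType.

(** The point (1 + iq) / (1 - iq) of the unit circle, with q the tangent of half the angle. It
    supplies rotations near the identity, with tangent 2iq and algebraic error bounds. *)
Definition cayley (q : R) : R[i] := ((1 - q ^+ 2) / (1 + q ^+ 2)) +i* (2 * q / (1 + q ^+ 2)).

Let dpos (q : R) : 0 < 1 + q ^+ 2.
Proof. by rewrite ltr_wpDr ?sqr_ge0. Qed.

Lemma normc_cayley q : normc (cayley q) = 1.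
Proof.
apply/eqP; rewrite -(@eqrXn2 _ 2)// ?normc_ge0// sqr_normcE /=; apply/eqP.
by field; rewrite gt_eqF.
Qed.

Lemma Im_cayley_neq0 q : q != 0 -> complex.Im (cayley q) != 0.
Proof. by move=> q0; rewrite /= !mulf_neq0// invr_eq0 gt_eqF. Qed.

Lemma cayley_dist1 q : normc (cayley q - 1) <= 2 * `|q|.
Proof.
rewrite -(@ler_pXn2r _ 2)// ?nnegrE ?normc_ge0 ?mulr_ge0// sqr_normcE exprMn.
rewrite real_normK ?num_real// cReB cImB /= subr0.
rewrite (_ : _ + _ = 4 * q ^+ 2 / (1 + q ^+ 2)); last by field; rewrite gt_eqF.
rewrite (_ : 2 ^+ 2 = 4); last by rewrite expr2 -natrM.
rewrite ler_pdivrMr//; apply: ler_peMr; first by apply: mulr_ge0 => //; exact: sqr_ge0.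
by rewrite lerDl sqr_ge0.
Qed.

Lemma cayley_tangent q : normc (cayley q - 1 - (0 +i* (2 * q))) <= 2 * q ^+ 2.
Proof.
have q0 : 0 <= 2 * q ^+ 2 by apply: mulr_ge0 => //; exact: sqr_ge0.
rewrite -(@ler_pXn2r _ 2)// ?nnegrE ?normc_ge0// sqr_normcE exprMn.
rewrite !cReB !cImB /= !subr0.
rewrite (_ : _ + _ = 4 * (q ^+ 2) ^+ 2 / (1 + q ^+ 2)); last by field; rewrite gt_eqF.
rewrite (_ : 2 ^+ 2 = 4); last by rewrite expr2 -natrM.
rewrite ler_pdivrMr//; apply: ler_peMr; first by apply: mulr_ge0 => //; exact: sqr_ge0.
by rewrite lerDl sqr_ge0.
Qed.

End rational_rotation.

Section moments.
Variables (R : realType) (f : R[i] -> R[i]).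
Hypothesis fA : analytic_on (@unit_disk R) f.
Hypothesis fL : L2_dA1 f.
Variables (a : nat -> R[i]) (rho : R).
Hypothesis rho0 : 0 < rho.
Hypothesis fa : psum f a 0 rho.
Variable n : nat.
Local Notation I := (@dA1_integral R).
Local Notation E := (@dA1_Rintegral R).

Let F (c z : R[i]) : R[i] := f (c * z) * (z ^+ n)^*.
Let J (c : R[i]) : R[i] := I (F c).

Let cmeas_f c : normc c <= 1 -> cmeas (fun z => f (c * z)).
Proof. by move=> c1; apply: cmeas_mul => //; exact: L2_cmeas. Qed.

Let cmeas_pow : cmeas (fun z : R[i] => (z ^+ n)^*).
Proof. by apply: cmeasJ; apply: cmeasX; exact: cmeas_id. Qed.

Let normc_pow (z w : R[i]) : unit_disk z -> normc (w * (z ^+ n)^*) <= normc w.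
Proof. by move=> Dz; rewrite normcM normc_conj ler_piMr ?normc_ge0 ?normc_expr_le1. Qed.

Let cint_F c : normc c < 1 -> cint (F c).
Proof.
move=> c1; have [L L0 hL] := analytic_uniform_lipschitz fA c1.
apply: (@cint_bounded _ _ L); first by apply: cmeasM => //; apply: cmeas_f; exact: ltW.
move=> z Dz; apply: le_trans (normc_pow _ Dz) _.
have [] := hL (c * z) _ => //; rewrite normcM ler_piMr ?normc_ge0//.
by move: Dz; rewrite unit_diskE => /ltW.
Qed.

Let J_rotate c u : normc u = 1 -> Im u != 0 -> normc c < 1 -> J (c * u) = u ^+ n * J c.
Proof.
move=> u1 u0 c1; have uu : u ^+ n * (u ^+ n)^* = 1.
  by rewrite mulc_conj normcX u1 !expr1n.
have -> : J c = (u ^+ n)^* * J (c * u).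
  rewrite /J -(Cint_rotate u1 u0 (cint_F c1)) -CintZ; last first.
    by apply: cint_F; rewrite normcM u1 mulr1.
  by apply: Cint_eq => z _; rewrite /F exprMn rmorphM /= mulrA mulrCA mulrA.
by rewrite mulrA uu mul1r.
Qed.

(** For small t the Taylor expansion at 0 is valid on all of t times the disk. Against the conjugate
    of z^n only the n-th term of the Taylor polynomial survives, and the remainder is of order
    t^(n+1). *)
Let J_small : exists2 C : R, 0 < C & forall t : R, 0 < t -> t <= rho / 4 -> t < 1 ->
  normc (J t%:C - a n * t%:C ^+ n * (disk_moment R n)%:C) <= C * t ^+ n.+1.
Proof.
have [C C0 hC] := psum_tail n.+1 rho0 fa.
(* The 2 comes from [normc_Cint_le]; adding 1 makes the constant positive. *)
exists (2 * E (fun=> C) + 1).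
  by rewrite ltr_wpDl// mulr_ge0// Eint_ge0// => z _; exact: ltW.
move=> t t0 tr t1; have nt : normc t%:C = t by rewrite normcR gtr0_norm.
pose S z := \sum_(0 <= m < n.+1) (a m * t%:C ^+ m) * (z ^+ m * (z ^+ n)^*).
have cS m : cint (fun z : R[i] => z ^+ m * (z ^+ n)^*).
  by apply: L2_cint_mul; exact: L2_monomial.
have IS : I S = a n * t%:C ^+ n * (disk_moment R n)%:C.
  rewrite /S Cint_sum; last by move=> m; exact: cintZ.
  rewrite big_nat_recr//= big1_seq ?add0r; last first.
    move=> m; rewrite mem_index_iota/= => mn.
    by rewrite CintZ// Cint_monomial (ltn_eqF mn) mulr0n mulr0.
  by rewrite CintZ// Cint_monomial eqxx.
have cS' : cint S by apply: cint_sum => m; exact: cintZ.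
have cF : cint (F t%:C) by apply: cint_F; rewrite nt.
rewrite -IS /J -CintB//.
have e : 2 * E (fun=> C * t ^+ n.+1) <= (2 * E (fun=> C) + 1) * t ^+ n.+1.
  rewrite (@Eint_eq _ _ (fun=> t ^+ n.+1 * C)); last by move=> z _; rewrite mulrC.
  rewrite EintZ; last exact: intg_cst.
  rewrite (_ : 2 * (t ^+ n.+1 * _) = 2 * E (fun=> C) * t ^+ n.+1); last by ring.
  by rewrite ler_wpM2r ?exprn_ge0 ?(ltW t0)// lerDl.
apply: le_trans e; apply: normc_Cint_le.
- have [cF1 _] := cF; have [cS1 _] := cS'.
  apply: cmeasB; first by apply: cmeasM => //; apply: cmeas_f; rewrite nt ltW.
  apply: cmeas_sum => m; apply: cmeasM; first exact: cmeas_cst.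
  by apply: cmeasM => //; apply: cmeasX; exact: cmeas_id.
- exact: intg_cst.
- move=> z Dz; rewrite /F /S.
  rewrite [X in normc X](_ : _ = (f (t%:C * z) - \sum_(0 <= m < n.+1) a m * (t%:C * z) ^+ m)
      * (z ^+ n)^*); last first.
    rewrite mulrBl mulr_suml; congr (_ - _); apply: eq_bigr => m _.
    by rewrite exprMn !mulrA.
  apply: le_trans (normc_pow _ Dz) _.
  have tz : normc (t%:C * z) <= t.
    rewrite normcM nt ler_piMr ?(ltW t0)//.
    by move: Dz; rewrite unit_diskE => /ltW.
  have := hC _ (le_trans tz tr); rewrite add0r => /le_trans; apply.
  rewrite ler_wpM2l ?(ltW C0)// lerXn2r// ?nnegrE ?normc_ge0//; exact: ltW.
Qed.

Let i_neq0 : (0 +i* 1 : R[i]) != 0.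
Proof. by rewrite eq_complex /= oner_eq0 andbF. Qed.

(** The radial difference quotient of [J] is compared with the quotient along a rotation that
    displaces tz by about iez. Both quotients of [f] tend to the same multiple of its complex
    derivative, so the difference of their integrals tends to 0; by [J_rotate] the second one is
    explicit and tends to n J(t) / t. *)
Let J_step (t : R) : 0 < t -> t < 1 -> exists2 d : R, 0 < d &
  forall e : nat -> R, (forall k, e k != 0 /\ `|e k| < d) -> e @ \oo --> (0 : R) ->
  (fun k => (J (t + e k)%:C - J t%:C) / (e k)%:C) @ \oo --> n%:R * J t%:C / t%:C.
Proof.
move=> t0 t1; have nt : normc t%:C = t by rewrite normcR gtr0_norm.
have [L L0 hL] := analytic_uniform_lipschitz fA t1.
(* The first bound allows the uniform Lipschitz estimate, the second keeps t + e inside (-1, 1). *)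
exists (Num.min L^-1 ((1 - t) / 2)); first by rewrite lt_min invr_gt0 L0 divr_gt0// subr_gt0.
move=> e he ce.
have e0 k : (e k)%:C != 0 :> R[i].
  by have [ek _] := he k; rewrite eq_complex /= negb_and ek.
have eL k : `|e k| < L^-1 by have [_] := he k; rewrite lt_min => /andP[].
have e1 k : t + e k < 1.
  by have [_] := he k; rewrite lt_min => /andP[_]; have := ler_norm (e k); lra.
have e2 k : -1 < t + e k.
  by have [_] := he k; rewrite lt_min => /andP[_]; have := ler_norm (- e k); rewrite normrN; lra.
have nte k : normc (t + e k)%:C < 1 by rewrite normcR ltr_norml e2 e1.
(* Chosen so that the first-order displacement t * 2iq of the rotation is exactly ie. *)
pose q (j : nat) := e j / t / 2; pose u (j : nat) := cayley (q j).
have q0 k : q k != 0.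
  by have [ek _] := he k; rewrite /q !mulf_neq0// invr_eq0 gt_eqF.
have tq k : t%:C * (0 +i* (2 * q k)) = (0 +i* 1) * (e k)%:C.
  apply/eqP; rewrite eq_complex /= /q; apply/andP; split; apply/eqP; first by ring.
  by field; rewrite gt_eqF.
have normq k : t * (2 * `|q k|) = `|e k|.
  by rewrite /q !normrM !normfV (gtr0_norm t0) normr_nat; field; rewrite gt_eqF.
have u1 k : normc (t%:C * (u k - 1)) <= `|e k|.
  by rewrite normcM nt -normq ler_wpM2l ?cayley_dist1// ltW.
have u2 k : normc (t%:C * (u k - 1) - (0 +i* 1) * (e k)%:C) <= `|e k| ^+ 2 / t.
  rewrite -tq -mulrBr normcM nt.
  apply: le_trans (ler_wpM2l (ltW t0) (cayley_tangent _)) _.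
  rewrite -normq; move: (q k) => x.
  rewrite [in leRHS]exprMn exprMn real_normK ?num_real//.
  rewrite (_ : _ / t = 4 * (t * x ^+ 2)); last by field; rewrite gt_eqF.
  by have := mulr_ge0 (ltW t0) (sqr_ge0 x); rewrite mulrCA; lra.
pose ie k : R[i] := (0 +i* 1) * (e k)%:C.
have nie k : normc (ie k) = `|e k|.
  by rewrite normcM normcR /= expr0n/= add0r expr1n sqrtr1 mul1r.
have ie0 k : ie k != 0 by rewrite mulf_neq0.
have tuE k z : t%:C * u k * z = t%:C * z + t%:C * (u k - 1) * z by ring.
have teE k z : (t + e k)%:C * z = t%:C * z + (e k)%:C * z by rewrite rmorphD/= mulrDl.
(* Radial minus rotational quotient: bounded by 2L and pointwise null, which is what dominated
   convergence requires. *)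
pose D k z := (f ((t + e k)%:C * z) - f (t%:C * z)) / (e k)%:C
  - (f (t%:C * u k * z) - f (t%:C * z)) / ie k.
have Dz_le (z : R[i]) (w : R[i]) : unit_disk z -> normc (w * z) <= normc w.
  by rewrite unit_diskE => /ltW z1; rewrite normcM ler_piMr ?normc_ge0.
have nx z : unit_disk z -> normc (t%:C * z) <= t by move=> /(Dz_le _ t%:C); rewrite nt.
have ek0 k : 0 < `|e k| by rewrite normr_gt0; have [] := he k.
have incr k z w : unit_disk z -> normc w <= `|e k| ->
    normc (f (t%:C * z + w) - f (t%:C * z)) <= L * `|e k|.
  move=> Dz wk; have [_ hx] := hL _ (nx _ Dz).
  have e3 : t%:C * z + w - t%:C * z = w by rewrite addrC addKr.
  have := hx (t%:C * z + w); rewrite e3 => /(_ (le_lt_trans wk (eL k))) /le_trans.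
  by apply; rewrite ler_wpM2l// ltW.
have D_bounded k z : unit_disk z -> normc (D k z) <= L + L.
  move=> Dz; apply: le_trans (normcB _ _) _.
  rewrite !normcM !normcV nie normcR; apply: lerD; rewrite ler_pdivrMr//.
    by rewrite teE; apply: incr => //; rewrite -normcR; exact: Dz_le.
  by rewrite tuE; apply: incr => //; apply: le_trans (Dz_le _ _ Dz) _.
have cabs : (fun k => `|e k|) @ \oo --> (0 : R) by rewrite -(normr0 R); exact: cvg_norm.
have csqueeze (x : nat -> R[i]) (c : R[i]) (B : R) :
    (\forall k \near \oo, normc (x k - c) <= B * `|e k|) -> x @ \oo --> c.
  move=> xB; apply/cvgc_normP.
  apply: (@squeeze_cvgr _ _ _ _ (cst 0) (fun k => B * `|e k|)).
  - by near=> k; rewrite normc_ge0/=; near: k.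
  - exact: cvg_cst.
  - by rewrite -(mulr0 B); apply: cvgM => //; exact: cvg_cst.
have D_cvg z : unit_disk z -> (fun k => D k z) @ \oo --> (0 : R[i]).
  move=> Dz; have Dx : unit_disk (t%:C * z) by apply: unit_disk_mul => //; rewrite nt ltW.
  have [b [C [r [r0 C0 hb]]]] := analytic_derivative fA Dx.
  apply: (csqueeze _ _ (C + C + normc b / t)); near=> k.
  have er : `|e k| <= r.
    near: k; move/cvgrPdist_le : cabs => /(_ _ r0); apply: filterS => k.
    by rewrite sub0r normrN normr_id.
  have incr2 w : normc w <= `|e k| ->
      normc (f (t%:C * z + w) - f (t%:C * z) - b * w) / `|e k| <= C * `|e k|.
    move=> wk; rewrite ler_pdivrMr// -mulrA -expr2.
    apply: le_trans (hb _ (le_trans wk er)) _.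
    by rewrite ler_wpM2l ?(ltW C0)// lerXn2r// ?nnegrE ?normc_ge0.
  rewrite subr0 /D teE tuE.
  set w1 := (e k)%:C * z; set w2 := t%:C * (u k - 1) * z.
  have w1k : normc w1 <= `|e k| by rewrite -normcR; exact: Dz_le.
  have w2k : normc w2 <= `|e k| by apply: le_trans (Dz_le _ _ Dz) _.
  (* Two second-order Taylor remainders and the defect between t(u - 1) and ie; the linear terms
     cancel because [f] has one complex derivative [b] in both directions. *)
  rewrite (_ : _ - _ = (f (t%:C * z + w1) - f (t%:C * z) - b * w1) / (e k)%:C -
    (f (t%:C * z + w2) - f (t%:C * z) - b * w2) / ie k -
    b * ((t%:C * (u k - 1) - ie k) * z) / ie k); last first.
    by rewrite /w1 /w2; field; rewrite ie0 e0.
  apply: le_trans (normcB _ _) _; rewrite [leRHS]mulrDl; apply: lerD.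
    apply: le_trans (normcB _ _) _; rewrite [leRHS]mulrDl; apply: lerD.
      by rewrite normcM normcV normcR; exact: incr2.
    by rewrite normcM normcV nie; exact: incr2.
  rewrite !normcM normcV nie ler_pdivrMr// -!mulrA; apply: ler_wpM2l; first exact: normc_ge0.
  rewrite -normcM; apply: le_trans (Dz_le _ _ Dz) _.
  by rewrite [leRHS]mulrC -expr2; exact: u2.
have ID k : I (fun z => D k z * (z ^+ n)^*) =
    (J (t + e k)%:C - J t%:C) / (e k)%:C - (u k ^+ n - 1) / ie k * J t%:C.
  have nt1 : normc t%:C < 1 by rewrite nt.
  have un : normc (u k) = 1 := normc_cayley _.
  have i0 := Im_cayley_neq0 (q0 k).
  have ntu : normc (t%:C * u k) < 1 by rewrite normcM un mulr1.
  rewrite (@Cint_eq _ _ (fun z => (e k)%:C^-1 * (F (t + e k)%:C z - F t%:C z) -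
     (ie k)^-1 * (F (t%:C * u k) z - F t%:C z))); last first.
    by move=> z _; rewrite /D /F; ring.
  have cB c d : normc c < 1 -> normc d < 1 -> cint (fun z => F c z - F d z).
    move=> c1 d1; apply: cint_eq (cintD (cint_F c1) (cintZ (-1) (cint_F d1))) => z _.
    by rewrite mulN1r.
  rewrite CintB; [|exact/cintZ/cB|exact/cintZ/cB].
  rewrite !CintZ; [|exact: cB|exact: cB].
  rewrite !CintB; [|exact: cint_F..].
  rewrite -!/(J _) J_rotate//; ring.
have cID : (fun k => I (fun z => D k z * (z ^+ n)^*)) @ \oo --> (0 : R[i]).
  rewrite -(@Cint0 R).
  have [] // := @Cint_cvg R (fun k z => D k z * (z ^+ n)^*) (fun=> 0) (fun=> L + L).
  - move=> k; apply: cmeasM => //.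
    have ft1 : cmeas (fun z => f (t%:C * z)) by apply: cmeas_f; rewrite nt ltW.
    apply: cmeasB; apply: cmeasM; try exact: cmeas_cst.
      by apply: cmeasB => //; apply: cmeas_f; exact: ltW.
    apply: cmeasB => //; apply: cmeas_f.
    by rewrite normcM (normc_cayley (q k)) mulr1 nt ltW.
  - exact: intg_cst.
  - by move=> k z Dz; apply: le_trans (normc_pow _ Dz) _; exact: D_bounded.
  - move=> z Dz; rewrite -(mul0r (z ^+ n)^*).
    by apply: cvgcM; [exact: D_cvg|exact: cvgc_cst].
have cu : (fun k => u k) @ \oo --> (1 : R[i]).
  apply: (csqueeze _ _ t^-1); apply: nearW => k.
  by rewrite -(ler_pM2l t0) -nt -normcM nt mulrA mulfV ?mul1r// gt_eqF.
have cu1 : (fun k => (u k - 1) / ie k) @ \oo --> (t%:C^-1 : R[i]).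
  apply: (csqueeze _ _ (t ^- 2)); apply: nearW => k.
  have tC0 : t%:C != 0 by rewrite eq_complex /= negb_and gt_eqF.
  rewrite (_ : _ - _ = (t%:C * (u k - 1) - ie k) / (t%:C * ie k)); last first.
    by field; rewrite ie0.
  rewrite normcM normcV normcM nt nie ler_pdivrMr ?mulr_gt0//.
  apply: le_trans (u2 k) _; rewrite le_eqVlt; apply/predU1P; left.
  by field; rewrite gt_eqF.
have cuX i : (fun k => u k ^+ i) @ \oo --> (1 : R[i]).
  elim: i => [|i ih]; first exact: cvgc_cst.
  have := cvgcM cu ih; rewrite mulr1.
  by under eq_fun do rewrite -exprS.
have cS m : (fun k => \sum_(i < m) u k ^+ i) @ \oo --> ((m%:R : R)%:C : R[i]).
  elim: m => [|m ih].
    under eq_fun do rewrite big_ord0; exact: (@cvgc_cst R 0).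
  under eq_fun do rewrite big_ord_recr /=.
  by rewrite -natr1 rmorphD /=; exact: (cvgcD ih (cuX m)).
(* The rotational quotient is used through u^n - 1 = (u - 1)(1 + u + ... + u^(n-1)), where (u -
   1)/(ie) tends to 1/t and the sum to n. *)
have h := cvgcD cID (cvgcM (cvgcM cu1 (cS n)) (@cvgc_cst R (J t%:C))).
rewrite (_ : (fun k => _) = (fun k => I (fun z => D k z * (z ^+ n)^*) +
    (u k - 1) / ie k * (\sum_(i < n) u k ^+ i) * J t%:C)); last first.
  by apply/funext => k; rewrite ID subrX1; ring.
rewrite (_ : _ / _ = 0 + t%:C^-1 * (n%:R)%:C * J t%:C); first exact: h.
by rewrite add0r rmorph_nat; ring.
Unshelve. all: by end_near. Qed.

(** [P] stands for the real or the imaginary part, since [power_ode] concerns real functions. The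
    constant value of P(J(t)) / t^n is identified with the help of [J_small]. *)
Let J_power (P : R[i] -> R) : (forall z w, P (z - w) = P z - P w) ->
  (forall (r : R) z, P (r%:C * z) = r * P z) -> (forall z, `|P z| <= normc z) ->
  (forall x l, x @ \oo --> l -> P (x k) @[k --> \oo] --> P l) ->
  forall t, 0 < t -> t < 1 -> P (J t%:C) = P (a n * (disk_moment R n)%:C) * t ^+ n.
Proof.
move=> PB PZ Pn Pc t t0 t1; set A := a n * _.
have Pdiv z (r : R) : P (z / r%:C) = P z / r.
  have -> : z / r%:C = (r^-1)%:C * z by rewrite fmorphV mulrC.
  by rewrite PZ mulrC.
have ode := @power_ode R (fun t => P (J t%:C)) n.
have cst s : 0 < s < 1 -> P (J s%:C) / s ^+ n = P (J t%:C) / t ^+ n.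
  move=> s01; apply: ode => //; last by rewrite t0.
  move=> {s01}s /andP[s0 s1]; have [d d0 hd] := J_step s0 s1.
  apply: (is_derive_seq d0) => e he e0; have := Pc _ _ (hd e he e0).
  rewrite Pdiv -(rmorph_nat (real_complex R)) PZ.
  by under eq_fun do rewrite Pdiv PB.
have [C C0 hC] := J_small.
have tn0 : t ^+ n != 0 by rewrite expf_neq0// gt_eqF.
apply: (mulIf (invr_neq0 tn0)); rewrite mulfK//.
apply/eqP; rewrite -subr_eq0 -normr_eq0; apply/negPn/negP => D0.
set D := `| _ | in D0; have Dp : 0 < D by rewrite lt_neqAle eq_sym D0 normr_ge0.
(* Within the range of [J_small], and with C s <= D/2: the estimate at [s] then reads D <= D/2,
   against D > 0. *)
pose s := Num.min (Num.min (rho / 4) (1 / 2)) (D / (2 * C)).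
have s0 : 0 < s by rewrite !lt_min !divr_gt0// mulr_gt0.
have s1 : s < 1.
  apply: (@le_lt_trans _ _ (1 / 2)); last lra.
  by rewrite /s !ge_min lexx orbT.
have sr : s <= rho / 4 by rewrite /s !ge_min lexx.
have sD : s <= D / (2 * C) by rewrite /s !ge_min lexx !orbT.
have sn0 : 0 < s ^+ n by rewrite exprn_gt0.
have := hC s s0 sr s1.
rewrite (_ : a n * _ * _ = (s ^+ n)%:C * A); last by rewrite rmorphXn /= /A; ring.
move=> /(le_trans (Pn _)); rewrite PB PZ.
rewrite -(ler_pM2r (_ : 0 < (s ^+ n)^-1)) ?invr_gt0//.
rewrite -[X in _ * X]gtr0_norm ?invr_gt0// -normrM mulrBl cst ?s0//.
rewrite [s ^+ n * _]mulrC mulfK ?gt_eqF// -/D exprS mulrA mulfK ?gt_eqF//.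
move=> h; have : D <= D / 2.
  apply: le_trans h _; have := ler_wpM2l (ltW C0) sD.
  by rewrite (_ : C * (D / (2 * C)) = D / 2)//; field; rewrite gt_eqF.
lra.
Qed.

(** The whole integrand is dilated: replacing z by rz in f(z) times the conjugate of z^n gives r^n
    J(r) = A r^(2n), which tends to A as r tends to 1. *)
Lemma Cint_moment : I (fun z => f z * (z ^+ n)^*) = a n * (disk_moment R n)%:C.
Proof.
set A := a n * _.
have JE t : 0 < t -> t < 1 -> J t%:C = A * t%:C ^+ n.
  move=> t0 t1; rewrite -rmorphXn /= mulrC; apply/eqP; rewrite eq_complex.
  apply/andP; split; apply/eqP.
    rewrite (@J_power (@complex.Re R))//.
    - by rewrite (cReM (t ^+ n)%:C) /= mul0r subr0 mulrC.
    - exact: cReB.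
    - by move=> r z; rewrite cReM /= mul0r subr0.
    - exact: normr_Re_le.
    - exact: cvgc_Re.
  rewrite (@J_power (@complex.Im R))//.
  - by rewrite (cImM (t ^+ n)%:C) /= mul0r addr0 mulrC.
  - exact: cImB.
  - by move=> r z; rewrite cImM /= mul0r addr0.
  - exact: normr_Im_le.
  - exact: cvgc_Im.
have [r [r01 r1 cr]] := Cint_scale_cvg (L2_cint_mul fL (L2_monomial R n)).
apply: (cvgc_unique cr).
have cC : (fun k => (r k)%:C) @ \oo --> (1 : R[i]).
  by apply: cvgc_ReIm => //=; exact: cvg_cst.
have cX i : (fun k => (r k)%:C ^+ i) @ \oo --> (1 : R[i]).
  elim: i => [|i ih]; first exact: cvgc_cst.
  have := cvgcM cC ih; rewrite mulr1.
  by under eq_fun do rewrite -exprS.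
have h := cvgcM (@cvgc_cst R A) (cvgcM (cX n) (cX n)); rewrite !mulr1 in h.
rewrite (_ : (fun k => _) = (fun k => A * ((r k)%:C ^+ n * (r k)%:C ^+ n))); first exact: h.
apply/funext => k; have /andP[k0 k1] := r01 k.
rewrite mulrA -JE// /J mulrC -CintZ; last first.
  by apply: cint_F; rewrite normcR gtr0_norm.
apply: Cint_eq => z _; rewrite /F mulrCA; congr (_ * _).
rewrite exprMn rmorphM /= rmorphXn /=; congr (_ ^+ n * _); exact: conjc_real.
Qed.

End moments.

(** * Bessel inequality and expansion in monomials *)

Section orthogonal_expansion.
Variable R : realType.
Local Notation I := (@dA1_integral R).
Local Notation E := (@dA1_Rintegral R).
Local Notation D := (@plane_disk R).
Local Notation mu2 := (@plane_measure R).
Implicit Types F G : R[i] -> R[i].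

Let mD : measurable D.
Proof. exact: measurable_plane_disk. Qed.
Hint Resolve mD : core.

Lemma disk_moment_ge0 n : 0 <= disk_moment R n.
Proof. by apply: Eint_ge0 => z _; rewrite exprn_ge0// sqr_ge0. Qed.

Definition trig_poly (c : nat -> R[i]) (m N : nat) (z : R[i]) : R[i] :=
  \sum_(m <= n < N) c n * z ^+ n.

Lemma cmeas_trig_poly c m N : cmeas (trig_poly c m N).
Proof.
apply: cmeas_sum => n; apply: cmeasM; first exact: cmeas_cst.
by apply: cmeasX; exact: cmeas_id.
Qed.

Lemma L2_trig_poly c m N : L2_dA1 (trig_poly c m N).
Proof.
apply: (@L2_bounded _ _ (\sum_(m <= n < N) normc (c n))); first exact: cmeas_trig_poly.
move=> z Dz; apply: le_trans (normc_sum _ _ _) _; apply: ler_sum => n _.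
by rewrite normcM ler_piMr ?normc_ge0 ?normc_expr_le1.
Qed.

Lemma Cint_mul_trig_poly F c m N : L2_dA1 F ->
  I (fun z => F z * (trig_poly c m N z)^*) =
  \sum_(m <= n < N) (c n)^* * I (fun z => F z * (z ^+ n)^*).
Proof.
move=> FL; have ci n : cint (fun z => F z * (z ^+ n)^*).
  exact: L2_cint_mul FL (L2_monomial R n).
under eq_bigr do rewrite -CintZ//.
rewrite -Cint_sum; last by move=> n; exact: cintZ.
apply: Cint_eq => z _; rewrite rmorph_sum /= mulr_sumr.
by apply: eq_bigr => n _; rewrite rmorphM /= mulrCA.
Qed.

Lemma Eint_sqr_normc F : E (fun z => normc (F z) ^+ 2) = Re (I (fun z => F z * (F z)^*)).
Proof. by apply: Eint_eq => z _; rewrite mulc_conj. Qed.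

Lemma Eint_trig_poly c m N :
  E (fun z => normc (trig_poly c m N z) ^+ 2) =
  \sum_(m <= n < N) normc (c n) ^+ 2 * disk_moment R n.
Proof.
rewrite Eint_sqr_normc Cint_mul_trig_poly; last exact: L2_trig_poly.
suff -> : \sum_(m <= n < N) (c n)^* * I (fun z => trig_poly c m N z * (z ^+ n)^*) =
    (\sum_(m <= n < N) normc (c n) ^+ 2 * disk_moment R n)%:C by [].
rewrite rmorph_sum /=; apply: eq_big_nat => n mnN.
have -> : I (fun z => trig_poly c m N z * (z ^+ n)^*) = c n * (disk_moment R n)%:C.
  have ci j : cint (fun z : R[i] => z ^+ j * (z ^+ n)^*).
    by apply: L2_cint_mul; exact: L2_monomial.
  rewrite (@Cint_eq _ _ (fun z => \sum_(m <= j < N) c j * (z ^+ j * (z ^+ n)^*))); last first.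
    by move=> z _; rewrite mulr_suml; apply: eq_bigr => j _; rewrite mulrA.
  rewrite Cint_sum; last by move=> j; exact: cintZ.
  under eq_bigr do rewrite CintZ// Cint_monomial.
  rewrite (bigD1_seq n) ?iota_uniq ?mem_index_iota//= eqxx mulr1n big1 ?addr0//.
  by move=> j jn; rewrite (negbTE jn) mulr0n mulr0.
by rewrite mulrA [_^* * _]mulrC mulc_conj [RHS]rmorphM.
Qed.

(** With S the partial sum, both Re <F, S> and the squared norm of S equal [X], so 2 Re <F, S> <=
    |F|^2 + |S|^2 integrates to the claim. *)
Lemma bessel F (a : nat -> R[i]) : L2_dA1 F ->
  (forall n, I (fun z => F z * (z ^+ n)^*) = a n * (disk_moment R n)%:C) ->
  forall N, \sum_(0 <= n < N) normc (a n) ^+ 2 * disk_moment R n <=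
    E (fun z => normc (F z) ^+ 2).
Proof.
move=> FL Fa N; set X := \sum_(0 <= n < N) _.
have SL := L2_trig_poly a 0 N.
have FS : E (fun z => Re (F z * (trig_poly a 0 N z)^*)) = X.
  rewrite -[LHS]/(Re (I (fun z => F z * (trig_poly a 0 N z)^*))) Cint_mul_trig_poly//.
under eq_bigr do rewrite Fa mulrA [_^* * _]mulrC mulc_conj.
  by rewrite -[RHS]/(Re X%:C) /X rmorph_sum /=; under [in RHS]eq_bigr do rewrite rmorphM.
have SS := Eint_trig_poly a 0 N; rewrite -/X in SS.
have [iFS _] := L2_cint_mul FL SL.
suff : 2 * X <= E (fun z => normc (F z) ^+ 2) + X by lra.
rewrite -{1}FS -SS -EintD; [|exact: L2_intg|exact: L2_intg].
rewrite -EintZ//.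
apply: Eint_le; [exact: intgZ|by apply: intgD; exact: L2_intg|].
move=> z _; have := normr_Re_le (F z * (trig_poly a 0 N z)^*).
rewrite normcM normc_conj => /(le_trans (ler_norm _)).
have := sqr_ge0 (normc (F z) - normc (trig_poly a 0 N z)); rewrite sqrrB.
lra.
Qed.

(** Passes from pointwise convergence of partial sums on the disk to membership in [L^2] and norm
    bounds, both for [sk] and for remainders of series. *)
Lemma fatou_L2 (S : nat -> R[i] -> R[i]) F (B : R) : (forall n, L2_dA1 (S n)) ->
  (forall z, unit_disk z -> S n z @[n --> \oo] --> F z) ->
  (forall n, E (fun z => normc (S n z) ^+ 2) <= B) ->
  L2_dA1 F /\ E (fun z => normc (F z) ^+ 2) <= B.
Proof.
move=> SL SF SB.
have mF : cmeas F.
  split.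
    apply: (@measurable_fun_cvg _ _ R D (fun n => (fun z => Re (S n z)) \o @cplx R)) => [n|p Dp].
      by have [] := L2_cmeas (SL n).
    by apply: cvgc_Re; exact: SF.
  apply: (@measurable_fun_cvg _ _ R D (fun n => (fun z => Im (S n z)) \o @cplx R)) => [n|p Dp].
    by have [] := L2_cmeas (SL n).
  by apply: cvgc_Im; exact: SF.
pose s n (p : R * R) := (normc (S n (cplx p)) ^+ 2 * dA1_density p)%:E.
have ms n : measurable_fun D (s n).
  by apply/measurable_EFinP; exact: (meas_dens (cmeas_sqr_normc (L2_cmeas (SL n)))).
have s0 n p : D p -> (0 <= s n p)%E.
  by move=> Dp; rewrite lee_fin mulr_ge0 ?sqr_ge0 ?dens_ge0.
have fat := @fatou _ _ _ mu2 D (@measurable_plane_disk R) s ms s0.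
have le : (\int[mu2]_(p in D) (normc (F (cplx p)) ^+ 2 * dA1_density p)%:E <= B%:E)%E.
  rewrite (_ : integral _ _ _ = \int[mu2]_(p in D) limn_einf (s^~ p))%E; last first.
    apply: eq_integral => p; rewrite inE => Dp.
    have c : s n p @[n --> \oo] --> (normc (F (cplx p)) ^+ 2 * dA1_density p)%:E.
      apply: cvg_EFin; first exact: nearW.
      have cn := cvgc_norm (SF _ Dp).
      by apply: cvgM; [exact: cvgM|exact: cvg_cst].
    rewrite is_cvg_limn_einfE; first by apply/esym/cvg_lim.
    by apply/cvg_ex; eexists; exact: c.
  apply: le_trans fat _; rewrite limn_einf_lim; apply: lime_le; first exact: is_cvg_einfs.
  apply: nearW => n; apply: (@le_trans _ _ (\int[mu2]_(p in D) s n p)%E).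
    by apply: ereal_inf_lbound; exists n => /=.
  have [_ isn] := L2_intg (SL n).
  rewrite -[X in (X <= _)%E]fineK; last exact: integrable_fin_num.
  by rewrite lee_fin; exact: SB.
have FL : L2_dA1 F.
  case: (mF) => m1 m2; split => //; apply/integrableP; split.
    by apply/measurable_EFinP; exact: (meas_dens (cmeas_sqr_normc mF)).
  apply: le_lt_trans (ltry B); apply: le_trans le.
  rewrite le_eqVlt; apply/predU1P; left; apply: eq_integral => p; rewrite inE => Dp.
  by rewrite gee0_abs// lee_fin mulr_ge0 ?sqr_ge0 ?dens_ge0.
split => //; have [_ iF] := L2_intg FL.
rewrite -lee_fin; apply: le_trans le; rewrite le_eqVlt; apply/predU1P; left.
by apply: fineK; exact: integrable_fin_num.
Qed.

(* The error of the N-th partial sum is estimated by Fatou's lemma, and its pairing with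
   F by [2 x y <= e x^2 + y^2 / e]. *)
Lemma Cint_mul_series F G (b : nat -> R[i]) (B : nat -> R) :
  L2_dA1 F -> L2_dA1 G ->
  (forall z, unit_disk z -> series (fun n => b n * z ^+ n) @ \oo --> G z) ->
  (forall m N, \sum_(m <= n < N) normc (b n) ^+ 2 * disk_moment R n <= B m) ->
  B @ \oo --> (0 : R) ->
  (fun N => \sum_(0 <= n < N) (b n)^* * I (fun z => F z * (z ^+ n)^*)) @ \oo -->
    I (fun z => F z * (G z)^*).
Proof.
move=> FL GL sG bB cB; apply/cvgc_normP/cvgrPdist_le => e e0.
set EF := E (fun z => normc (F z) ^+ 2).
have EF0 : 0 <= EF by apply: Eint_ge0 => z _; exact: sqr_ge0.
(* Weight in the inequality for products: [d * EF] is at most e/2, and the added 1 keeps the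
   denominator positive. *)
pose d := e / (2 * (EF + 1)).
have d0 : 0 < d by rewrite divr_gt0// mulr_gt0// ltr_wpDl.
have de0 : 0 < d * (e / 2) by rewrite mulr_gt0// divr_gt0.
near=> N; rewrite sub0r normrN ger0_norm ?normc_ge0//.
have BN : B N <= d * (e / 2).
  near: N; move/cvgrPdist_le : cB => /(_ _ de0); apply: filterS => N.
  by rewrite sub0r normrN => /(le_trans (ler_norm _)).
pose T z := G z - trig_poly b 0 N z.
have [TL ET] : L2_dA1 T /\ E (fun z => normc (T z) ^+ 2) <= B N.
  apply: (@fatou_L2 (fun M => trig_poly b N M)) => [M|z Dz|M].
  - exact: L2_trig_poly.
  - have c := cvgcB (sG _ Dz) (@cvgc_cst R (trig_poly b 0 N z)).
    apply/cvgc_normP; move/cvgc_normP : c.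
    apply: cvg_trans; apply: near_eq_cvg; near=> M.
    have NM : (N <= M)%N by near: M; exact: nbhs_infty_ge.
    congr (normc (_ - _)).
    by rewrite /trig_poly /series/= [X in X - _](big_cat_nat (n := N))//= [X in X - _]addrC addrK.
  - by rewrite Eint_trig_poly.
rewrite -Cint_mul_trig_poly// normc_distC -CintB; last 2 first.
  exact: L2_cint_mul.
  by apply: L2_cint_mul => //; exact: L2_trig_poly.
rewrite (@Cint_eq _ _ (fun z => F z * (T z)^*)); last first.
  by move=> z _; rewrite /T rmorphB /= mulrBr.
have iB : intg (fun z => 2^-1 * (d * normc (F z) ^+ 2 + d^-1 * normc (T z) ^+ 2)).
  by apply/intgZ/intgD; apply: intgZ; exact: L2_intg.
apply: (@le_trans _ _ (2 * E (fun z => 2^-1 * (d * normc (F z) ^+ 2 + d^-1 * normc (T z) ^+ 2)))).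
  apply: normc_Cint_le => //.
    by apply: cmeasM; [|apply: cmeasJ]; exact: L2_cmeas.
  move=> z _; rewrite normcM normc_conj; set x := normc _; set y := normc _.
  have : 0 <= d^-1 * (d * x - y) ^+ 2 by rewrite mulr_ge0 ?sqr_ge0// invr_ge0 ltW.
  have -> : d^-1 * (d * x - y) ^+ 2 = d * x ^+ 2 + d^-1 * y ^+ 2 - 2 * (x * y).
    by field; rewrite gt_eqF.
  lra.
rewrite EintZ; last by apply: intgD; apply: intgZ; exact: L2_intg.
rewrite mulrA mulfV// mul1r EintD; [|exact/intgZ/L2_intg|exact/intgZ/L2_intg].
rewrite !EintZ; [|exact: L2_intg|exact: L2_intg].
rewrite [e]splitr; apply: lerD.
  have -> : e / 2 = d * (EF + 1) by rewrite /d; field; rewrite gt_eqF// ltr_wpDl.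
  by rewrite ler_wpM2l ?(ltW d0)// -/EF lerDl.
rewrite ler_pdivrMl//; exact: le_trans ET BN.
Unshelve. all: by end_near. Qed.

End orthogonal_expansion.

(** * The functions s_k *)

Section analytic_closure.
Variable R : realType.
Implicit Types (f g : R[i] -> R[i]) (z : R[i]).

Lemma psum_analytic_at f a z0 (rho : R) : 0 < rho -> psum f a z0 rho -> analytic_at f z0.
Proof.
move=> r0 fa; exists rho%:C, a; split; first by rewrite -[0]/(0%:C) ltcR.
move=> z; rewrite norm_normc ltcR => zr.
by have := fa _ zr; rewrite subrKC.
Qed.

Lemma analytic_atD f g z0 : analytic_at f z0 -> analytic_at g z0 ->
  analytic_at (fun z => f z + g z) z0.
Proof.
move=> /analytic_at_psum[r r0 [a fa]] /analytic_at_psum[s s0 [b gb]].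
apply: (@psum_analytic_at _ (fun n => a n + b n) _ (Num.min r s)); first by rewrite lt_min r0.
move=> w; rewrite lt_min => /andP[wr ws].
have h := cvgcD (fa _ wr) (gb _ ws).
rewrite (_ : series _ = (fun n => series (fun n => a n * w ^+ n) n +
  series (fun n => b n * w ^+ n) n)); first exact: h.
apply/funext => N; rewrite /series/= -big_split/=; apply: eq_bigr => n _.
by rewrite mulrDl.
Qed.

Lemma analytic_atZ c f z0 : analytic_at f z0 -> analytic_at (fun z => c * f z) z0.
Proof.
move=> /analytic_at_psum[r r0 [a fa]].
apply: (psum_analytic_at (a := fun n => c * a n) r0) => w wr.
have h := cvgcM (@cvgc_cst R c) (fa _ wr).
rewrite (_ : series _ = (fun n => c * series (fun n => a n * w ^+ n) n)); first exact: h.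
apply/funext => N; rewrite /series/= mulr_sumr; apply: eq_bigr => n _.
by rewrite mulrA.
Qed.

Lemma cvgc_expr0 (x : R[i]) : normc x < 1 -> (fun n => x ^+ n) @ \oo --> (0 : R[i]).
Proof.
move=> x1; apply/cvgc_normP; under eq_cvg do rewrite subr0 normcX.
by apply: cvg_expr; rewrite ger0_norm ?normc_ge0.
Qed.

Lemma cvgc_geometric (x : R[i]) : normc x < 1 ->
  (fun N => \sum_(0 <= n < N) x ^+ n) @ \oo --> ((1 - x)^-1 : R[i]).
Proof.
move=> x1.
have x0 : 1 - x != 0.
  apply/eqP => /eqP; rewrite subr_eq0 => /eqP xE; move: x1.
  by rewrite -xE normc1 ltxx.
have h := cvgcM (cvgcB (@cvgc_cst R 1) (cvgc_expr0 x1)) (@cvgc_cst R (1 - x)^-1).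
rewrite subr0 mul1r in h.
rewrite (_ : (fun N => _) = (fun N => (1 - x ^+ N) * (1 - x)^-1)); first exact: h.
apply/funext => N; apply: (mulIf x0); rewrite divfK//.
by rewrite big_mkord mulrC -opprB mulNr -subrX1 opprB.
Qed.

(** Geometric series in w / (c - z0), with radius the distance to the pole. *)
Lemma analytic_atV (c z0 : R[i]) : c != z0 -> analytic_at (fun z => (c - z)^-1) z0.
Proof.
move=> cz; have d0 : c - z0 != 0 by rewrite subr_eq0.
apply: (@psum_analytic_at _ (fun n => (c - z0)^-1 ^+ n.+1) _ (normc (c - z0))).
  by rewrite lt_neqAle eq_sym normc_eq0 d0 normc_ge0.
move=> w wr; pose x := w / (c - z0).
have x1 : normc x < 1.
  rewrite /x normcM normcV ltr_pdivrMr ?mul1r//.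
  by rewrite lt_neqAle eq_sym normc_eq0 d0 normc_ge0.
have h := cvgcM (@cvgc_cst R (c - z0)^-1) (cvgc_geometric x1).
rewrite (_ : (c - (z0 + w))^-1 = (c - z0)^-1 * (1 - x)^-1); last first.
  rewrite -invfM; congr (_^-1); rewrite /x mulrBr mulr1 mulrCA mulfV// mulr1.
  by rewrite opprD addrA.
rewrite (_ : series _ = (fun N => (c - z0)^-1 * \sum_(0 <= n < N) x ^+ n)); first exact: h.
apply/funext => N; rewrite /series/= mulr_sumr; apply: eq_bigr => n _.
by rewrite /x exprMn exprS; ring.
Qed.

Lemma analytic_at0 z0 : analytic_at (fun=> 0 : R[i]) z0.
Proof.
apply: (psum_analytic_at (a := fun=> 0) (@ltr01 R)) => w _.
rewrite (_ : series _ = fun=> 0); first exact: cvgc_cst.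
by apply/funext => N; rewrite /series/= big1// => n _; rewrite mul0r.
Qed.

Lemma analytic_at_sum (J : eqType) (s : seq J) (F : J -> R[i] -> R[i]) z0 :
  (forall j, j \in s -> analytic_at (F j) z0) ->
  analytic_at (fun z => \sum_(j <- s) F j z) z0.
Proof.
elim: s => [|j s ih] FA.
  rewrite (_ : (fun z => _) = fun=> 0); first exact: analytic_at0.
  by apply/funext => z; rewrite big_nil.
have h := analytic_atD (FA j (mem_head _ _)) (ih (fun i si => FA i (mem_behead (s := j :: s) si))).
rewrite (_ : (fun z => _) = (fun z => F j z + \sum_(j <- s) F j z)); first exact: h.
by apply/funext => z; rewrite big_cons.
Qed.

(** Values outside the disk are arbitrary, so the radius is shrunk until the ball lies inside the
    disk. *)
Lemma analytic_at_eq f g z0 : unit_disk z0 -> (forall z, unit_disk z -> f z = g z) ->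
  analytic_at f z0 -> analytic_at g z0.
Proof.
rewrite unit_diskE => D0 fg /analytic_at_psum[r r0 [a fa]].
pose s := Num.min r (1 - normc z0).
apply: (@psum_analytic_at _ a _ s); first by rewrite lt_min r0 subr_gt0.
move=> w; rewrite lt_min => /andP[wr ws]; rewrite -fg; first exact: fa.
by rewrite unit_diskE (le_lt_trans (normcD _ _))// -ltrBrDl.
Qed.

End analytic_closure.

Section sk.
Variables (R : realType) (k : nat).
Hypothesis k2 : (2 <= k)%N.
Local Notation sk := (@sk R k).

Let k0 : (0 < k)%N. Proof. exact: ltnW. Qed.

Definition sk_coef (n : nat) : R := (n.+1 %% k)%N%:R.

Lemma sk_coef_le n : `|sk_coef n| <= k%:R.
Proof. by rewrite normr_nat ler_nat ltnW// ltn_pmod. Qed.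

Let powk_neq1 (z : R[i]) : unit_disk z -> 1 - z ^+ k != 0.
Proof.
rewrite unit_diskE => z1; apply/eqP => /eqP; rewrite subr_eq0 => /eqP /(congr1 (@normc R)).
rewrite normc1 normcX => h; have : normc z ^+ k < 1 by rewrite exprn_ilt1// ?normc_ge0// -lt0n.
by rewrite -h ltxx.
Qed.

(* The coefficients n + 1 mod k are k-periodic, so the partial sums satisfy
   S_(N+k) = S_k + z^k S_N. *)
Lemma cvg_sk (z : R[i]) : unit_disk z ->
  series (fun n => (sk_coef n)%:C * z ^+ n) @ \oo --> sk z.
Proof.
move=> Dz; have z1 : normc z < 1 by rewrite -unit_diskE.
set S := series _.
have SkN N : S (N + k)%N = S k + z ^+ k * S N.
  elim: N => [|N ih]; first by rewrite add0n {3}/S /series/= big_geq// mulr0 addr0.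
  have SS M : S M.+1 = S M + (sk_coef M)%:C * z ^+ M by rewrite /S seriesSr.
  rewrite addSn !SS ih (_ : sk_coef (N + k) = sk_coef N); last first.
    by rewrite /sk_coef -addSn modnDr.
  by rewrite exprD; ring.
have Sk : S k = \sum_(1 <= j < k) j%:R * z ^+ j.-1.
  rewrite /S /series/= -(prednK k0) big_nat_recr//= prednK// {2}/sk_coef prednK// modnn.
  rewrite mul0r addr0 big_add1 /=; apply: eq_big_nat => i /andP[_ ik].
  rewrite /sk_coef modn_small; last by rewrite -(prednK k0) ltnS.
  by rewrite (rmorph_nat (real_complex R)).
(* The recursion determines the limit only once convergence is known, which follows by comparison
   with k |z|^n. *)
have cS : exists l : R[i], S @ \oo --> l.
  have geo : cvgn (series (fun n => k%:R * normc z ^+ n)).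
    apply: (@is_cvg_geometric_series R k%:R (normc z)).
    by rewrite ger0_norm ?normc_ge0.
  have hb n : normc ((sk_coef n)%:C * z ^+ n) <= k%:R * normc z ^+ n.
    by rewrite normcM normcR normcX ler_wpM2r ?exprn_ge0 ?normc_ge0 ?sk_coef_le.
  have c1 : cvgn (series (fun n => Re ((sk_coef n)%:C * z ^+ n))).
    apply: normed_cvg; apply: series_le_cvg geo => n.
    - exact: normr_ge0.
    - by rewrite mulr_ge0 ?exprn_ge0 ?normc_ge0.
    - exact: le_trans (normr_Re_le _) (hb n).
  have c2 : cvgn (series (fun n => Im ((sk_coef n)%:C * z ^+ n))).
    apply: normed_cvg; apply: series_le_cvg geo => n.
    - exact: normr_ge0.
    - by rewrite mulr_ge0 ?exprn_ge0 ?normc_ge0.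
    - exact: le_trans (normr_Im_le _) (hb n).
  have sumP (P : R[i] -> R) : P 0 = 0 -> (forall x y, P (x + y) = P x + P y) ->
      forall N, P (S N) = series (fun n => P ((sk_coef n)%:C * z ^+ n)) N.
    move=> P0 PD; elim => [|N ih]; first by rewrite /S /series/= !big_geq.
    rewrite [RHS]seriesSr -[in RHS]/(series _ N + P ((sk_coef N)%:C * z ^+ N)).
    by rewrite -ih -PD /S seriesSr.
  pose l1 : R := limn (series (fun n => Re ((sk_coef n)%:C * z ^+ n))).
  pose l2 : R := limn (series (fun n => Im ((sk_coef n)%:C * z ^+ n))).
  exists (l1 +i* l2).
  apply: cvgc_ReIm => /=.
    by under eq_cvg do rewrite (sumP (@complex.Re R) erefl (@cReD R)); exact: c1.
  by under eq_cvg do rewrite (sumP (@complex.Im R) erefl (@cImD R)); exact: c2.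
have [l Sl] := cS.
suff -> : sk z = l by exact: Sl.
have Sl' : (fun N => S (N + k)%N) @ \oo --> l by rewrite cvg_shiftn.
have h := cvgcD (@cvgc_cst R (S k)) (cvgcM (@cvgc_cst R (z ^+ k)) Sl).
have lE : l = S k + z ^+ k * l.
  apply: (cvgc_unique Sl').
  by rewrite (_ : (fun N => _) = (fun N => S k + z ^+ k * S N)); [exact: h|apply/funext].
rewrite /Defs.sk -Sk; apply: (mulIf (powk_neq1 Dz)); rewrite divfK ?powk_neq1//.
by rewrite mulrBr mulr1 {1}lE; ring.
Qed.

(** The coefficients are at most k and the moments are c / ((n+1)(n+2)), so the sum telescopes. The
    bound is uniform in [N] and null in [m], as [Cint_mul_series] demands. *)
Let sk_tail : exists C : R, forall m N,
  \sum_(m <= n < N) normc (sk_coef n)%:C ^+ 2 * disk_moment R n <= C / m.+1%:R.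
Proof.
have [c c0 mE] := @disk_momentE R; pose C := k%:R ^+ 2 * c.
have C0 : 0 <= C by rewrite mulr_ge0 ?exprn_ge0// ltW.
exists C => m N.
apply: (@le_trans _ _ (\sum_(m <= n < N) (C / n.+1%:R - C / n.+2%:R))).
  apply: ler_sum => n _; rewrite mE normcR.
  apply: (@le_trans _ _ (k%:R ^+ 2 * (c / (n.+1%:R * n.+2%:R)))).
    rewrite ler_wpM2r ?divr_ge0 ?mulr_ge0//; first exact: ltW.
    by rewrite lerXn2r// ?nnegrE ?normr_ge0 ?sk_coef_le.
  rewrite le_eqVlt; apply/predU1P; left; rewrite /C -[n.+2%:R]natr1.
  have x0 : 0 < n.+1%:R :> R by rewrite ltr0n.
  by field; apply/andP; split; apply: lt0r_neq0; lra.
have [mN|Nm] := leqP m N; last by rewrite big_geq ?divr_ge0// ltnW.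
under eq_bigr do rewrite -opprB; rewrite sumrN.
by rewrite (telescope_sumr (fun n => C / n.+1%:R))// opprB lerBlDr lerDl divr_ge0.
Qed.

Lemma sk_L2 : L2_dA1 sk.
Proof.
have [C hC] := sk_tail.
have [] // := @fatou_L2 R (fun N => trig_poly (fun n => (sk_coef n)%:C) 0 N) sk (C / 1%:R).
- by move=> N; exact: L2_trig_poly.
- by move=> z Dz; exact: cvg_sk.
- by move=> N; rewrite Eint_trig_poly; exact: hC.
Qed.

Lemma Cint_mul_sk (F : R[i] -> R[i]) : L2_dA1 F ->
  (fun N => \sum_(0 <= n < N) (sk_coef n)%:C * dA1_integral (fun z => F z * (z ^+ n)^*))
    @ \oo --> dA1_integral (fun z => F z * (sk z)^*).
Proof.
move=> FL; have [C hC] := sk_tail.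
have cB : (fun m => C / m.+1%:R) @ \oo --> (0 : R).
  rewrite -(mulr0 C); apply: cvgM; first exact: cvg_cst.
  exact: cvg_harmonic.
have h := Cint_mul_series FL sk_L2 cvg_sk hC cB.
rewrite (_ : (fun N => _) = (fun N => \sum_(0 <= n < N) ((sk_coef n)%:C)^* *
  dA1_integral (fun z => F z * (z ^+ n)^*))); first exact: h.
by apply/funext => N; apply: eq_bigr => n _; congr (_ * _); apply/esym; exact: conjc_real.
Qed.

Let log_derivative (s : seq R[i]) (z : R[i]) :
  let p : {poly R[i]} := \prod_(x <- s) ('X - x%:P) in
  p.[z] != 0 -> p^`().[z] / p.[z] = \sum_(x <- s) (z - x)^-1.
Proof.
elim: s => [|x s ih] /=; first by rewrite !big_nil -[1]/(1%:P) derivC horner0 mul0r.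
rewrite !big_cons; set p := \prod_(_ <- s) _ in ih *.
rewrite !hornerE mulf_eq0 negb_or => /andP[zx pz].
rewrite -ih// derivM derivXsubC mul1r !hornerE.
by field; rewrite zx pz.
Qed.

(* sk k is a combination of simple fractions 1/(1-z) and 1/(x-z), with x a root of unity. *)
Lemma sk_analytic : analytic_on (@unit_disk R) sk.
Proof.
pose q : {poly R[i]} := \sum_(j < k) 'X^j.
have qE z : (1 - z) * q.[z] = 1 - z ^+ k.
  have -> : q.[z] = \sum_(j < k) z ^+ j.
    by rewrite horner_sum; apply: eq_bigr => j _; rewrite hornerXn.
  by rewrite -opprB mulNr -subrX1 opprB.
have q1 : q.[1] = k%:R.
  rewrite horner_sum; under eq_bigr do rewrite hornerXn expr1n.
  by rewrite sumr_const card_ord.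
have kn0 : k%:R != 0 :> R[i].
  by rewrite -(rmorph_nat (real_complex R)) eq_complex /= negb_and pnatr_eq0 -lt0n k0.
have [s qs] := closed_field_poly_normal q.
have lc0 : lead_coef q != 0.
  by rewrite lead_coef_eq0; apply: contra kn0 => /eqP q0; rewrite -q1 q0 horner0.
(* Roots of [q] are k-th roots of unity because (1 - z) q = 1 - z^k, and they differ from 1 because
   q(1) = k. *)
have root x : x \in s -> normc x = 1 /\ x != 1.
  move=> xs; have qx : q.[x] = 0.
    by rewrite qs hornerZ; apply/eqP; rewrite mulf_eq0 -/(root _ x) root_prod_XsubC xs orbT.
  split; last by apply/eqP => x1; move: kn0; rewrite -q1 -x1 qx eqxx.
  have := qE x; rewrite qx mulr0 => /eqP; rewrite eq_sym subr_eq0 => /eqP /(congr1 (@normc R)).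
  rewrite normc1 normcX => /esym/eqP; rewrite pexpr_eq1 ?normc_ge0//.
  by move=> /eqP.
(* The logarithmic derivative of [q] is the sum of the 1/(z - x); each product with 1/(1 - z) is
   then split into partial fractions. *)
have skE z : unit_disk z ->
    sk z = \sum_(x <- s) (1 - x)^-1 * ((1 - z)^-1 + (-1) * (x - z)^-1).
  move=> Dz; have z1 : 1 - z != 0.
    rewrite subr_eq0; apply/eqP => zE; move: Dz.
    by rewrite unit_diskE -zE normc1 ltxx.
  have qz : q.[z] != 0.
    apply/eqP => q0; have := qE z; rewrite q0 mulr0 => /eqP.
    by rewrite eq_sym (negbTE (powk_neq1 Dz)).
  rewrite sk_log_derivative -/q qs derivZ !hornerZ -mulf_div mulfV// mul1r.
  rewrite log_derivative; last first.
    by apply: contra qz => /eqP p0; rewrite qs hornerZ p0 mulr0.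
  rewrite mulr_sumr; apply: eq_big_seq => x /root[x1 xn1].
  have xz : z - x != 0.
    rewrite subr_eq0; apply/eqP => zE; move: Dz.
    by rewrite unit_diskE zE x1 ltxx.
  have xz' : x - z != 0 by rewrite -opprB oppr_eq0.
  have x1' : 1 - x != 0 by rewrite subr_eq0 eq_sym.
  by field; rewrite ?xz ?xz' ?x1' ?z1.
move=> z0 Dz0.
have neq (x : R[i]) : normc x = 1 -> x != z0.
  by move=> x1; apply/eqP => xE; move: Dz0; rewrite unit_diskE -xE x1 ltxx.
apply: (analytic_at_eq Dz0 (fun z Dz => esym (skE z Dz))).
apply: (analytic_at_sum (F := fun x z => (1 - x)^-1 * ((1 - z)^-1 + (-1) * (x - z)^-1))).
move=> x /root[x1 _].
have h := analytic_atZ (-1) (analytic_atV (neq x x1)).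
exact: (analytic_atZ (1 - x)^-1 (analytic_atD (analytic_atV (neq 1 (normc1 R))) h)).
Qed.

Lemma sk_bergman : bergman sk.
Proof. by split; [exact: sk_analytic|exact: sk_L2]. Qed.

Lemma sk_H0 : H0 sk.
Proof.
split; first exact: sk_bergman.
move=> e e0; exists sk.
  exists 1%N, (fun=> 1), (fun=> sk); split; first by move=> _; exists k.
  by apply/funext => z; rewrite big_ord1 mul1r.
rewrite /bergman_norm (_ : inner _ _ = 0); first by rewrite sqrtr0.
rewrite /inner -[RHS](@Cint0 R); apply: Cint_eq => z _.
by rewrite subrr mul0r.
Qed.

End sk.

(** * Orthogonality to all s_k *)

Section final.
Variables (R : realType) (g : R[i] -> R[i]).
Local Notation I := (@dA1_integral R).
Hypothesis gH : bergman g.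
Hypothesis hH : bergman (fun z : R[i] => g z / (1 - z)).
Hypothesis g_orth : forall k, (2 <= k)%N -> I (fun z => g z * (sk k z)^*) = 0.
Variables (a : nat -> R[i]) (rho : R).
Hypothesis rho0 : 0 < rho.
Hypothesis ha : psum (fun z : R[i] => g z / (1 - z)) a 0 rho.

Let b n := a n - (if n is m.+1 then a m else 0).

(** The series of g / (1 - z) is multiplied by 1 - w; capping the radius at 1 ensures that 1 - w
    does not vanish. *)
Let psum_g : psum g b 0 (Num.min rho 1).
Proof.
move=> w; rewrite lt_min => /andP[wr w1].
have wn1 : 1 - w != 0.
  rewrite subr_eq0; apply/eqP => wE; move: w1.
  by rewrite -wE normc1 ltxx.
have c := ha wr; rewrite add0r in c; set S := series _ in c.
have cS : (fun N => S N.+1) @ \oo --> g w / (1 - w) by rewrite (cvg_shiftS S).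
have h := cvgcB cS (cvgcM (@cvgc_cst R w) c).
have gE : g w / (1 - w) - w * (g w / (1 - w)) = g w by field.
rewrite gE in h; rewrite add0r -(cvg_shiftS (series _)).
rewrite (_ : (fun N => _) = (fun N => S N.+1 - w * S N)); first exact: h.
apply/funext => N; rewrite /=.
have SS u M : series u M.+1 = series u M + u M :> R[i] by rewrite seriesSr.
elim: N => [|N ih]; first by rewrite SS /S SS /series/= !big_geq// /b !add0r mulr0 !subr0.
rewrite SS ih /S !SS /b exprS; ring.
Qed.

Let moment_g n : I (fun z => g z * (z ^+ n)^*) = b n * (disk_moment R n)%:C.
Proof.
have r0 : 0 < Num.min rho 1 by rewrite lt_min rho0 ltr01.
exact: (Cint_moment gH.1 gH.2 r0 psum_g).
Qed.

(** Bessel's inequality makes |a_n|^2 times the moment summable, and the moments themselves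
    telescope. The comparison then uses 2x <= x^2 + 1 and y(y+1) <= 2y^2 for y = n+1. *)
Let summable_a : cvgn (series (fun n => normc (a n) / n.+1%:R ^+ 2)).
Proof.
have [c c0 mE] := @disk_momentE R.
have B := bessel hH.2 (Cint_moment hH.1 hH.2 rho0 ha).
set EB := dA1_Rintegral _ in B.
have c1 : cvgn (series (fun n => normc (a n) ^+ 2 * disk_moment R n)).
  apply: nondecreasing_is_cvgn.
    by apply: nondecreasing_series => n _ _; rewrite mulr_ge0 ?sqr_ge0 ?disk_moment_ge0.
  by exists EB => _ [n _ <-]; exact: B.
have c2 : cvgn (series (fun n => disk_moment R n)).
  apply: nondecreasing_is_cvgn.
    by apply: nondecreasing_series => n _ _; rewrite disk_moment_ge0.
  exists c => _ [n _ <-]; rewrite /series/=.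
  have -> : \sum_(0 <= i < n) disk_moment R i = - \sum_(0 <= i < n) (c / i.+2%:R - c / i.+1%:R).
    rewrite -sumrN; apply: eq_bigr => i _; rewrite mE -[i.+2%:R]natr1.
    have x0 : 0 < i.+1%:R :> R by rewrite ltr0n.
    by field; apply/andP; split; apply: lt0r_neq0; lra.
  rewrite (telescope_sumr (fun i => c / i.+1%:R))// opprB divr1 lerBlDr lerDl divr_ge0//.
  exact: ltW.
have c3 : cvgn (series (c^-1 *: ((fun n => normc (a n) ^+ 2 * disk_moment R n) +
    (fun n => disk_moment R n)))).
  by apply: is_cvg_seriesZ; exact: is_cvg_seriesD.
apply: series_le_cvg c3 => n.
- by rewrite divr_ge0 ?normc_ge0 ?sqr_ge0.
- rewrite !fctE /GRing.scale/= mulr_ge0 ?invr_ge0 ?(ltW c0)// addr_ge0 ?disk_moment_ge0//.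
  by rewrite mulr_ge0 ?sqr_ge0 ?disk_moment_ge0.
- rewrite !fctE /GRing.scale/= mE; set x := normc _.
  have y0 : 0 < n.+1%:R :> R by rewrite ltr0n.
  rewrite (_ : c^-1 * _ = (x ^+ 2 + 1) / (n.+1%:R * n.+2%:R)); last first.
    rewrite -[n.+2%:R]natr1; field.
    by apply/and3P; split; apply: lt0r_neq0 => //; lra.
  have y1 : 1 <= n.+1%:R :> R by rewrite ler1n.
  rewrite -[n.+2%:R]natr1; move: (n.+1%:R) y0 y1 => y y0 y1.
  rewrite ler_pdivrMr ?exprn_gt0// mulrAC ler_pdivlMr; last first.
    by rewrite mulr_gt0//; lra.
  have x2 : 2 * x <= x ^+ 2 + 1.
    by have := sqr_ge0 (x - 1); rewrite sqrrB expr1n mulr1; lra.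
  apply: (@le_trans _ _ (2 * x * y ^+ 2)).
    have -> : 2 * x * y ^+ 2 = x * (y * (2 * y)) by ring.
    rewrite ler_wpM2l ?normc_ge0// ler_wpM2l ?(ltW y0)//; lra.
  by rewrite ler_wpM2r// sqr_ge0.
Qed.

Let sk_sum k : (2 <= k)%N ->
  (fun N => \sum_(0 <= n < N) (sk_coef R k n)%:C * (b n * (disk_moment R n)%:C)) @ \oo --> 0.
Proof.
move=> k2; have := Cint_mul_sk k2 gH.2; rewrite g_orth//.
by under eq_fun do under eq_bigr do rewrite moment_g.
Qed.

(** Reduction to the real statement [difference_eq0], with [P] the real or imaginary part; the
    factor [c^-1] removes the constant of the moments. *)
Let ReIm_b (P : R[i] -> R) : (forall z w, P (z - w) = P z - P w) -> P 0 = 0 ->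
  (forall z, `|P z| <= normc z) -> (forall z (x : R), P (z * x%:C) = P z * x) ->
  (forall (x : nat -> R[i]) l, x @ \oo --> l -> P (x n) @[n --> \oo] --> P l) ->
  (forall z w, P (z + w) = P z + P w) ->
  forall n, P (b n) = 0.
Proof.
move=> PB P0 Ple PZ Pcvg PD n.
have [c c0 mE] := @disk_momentE R.
have ch : cvgn (series (fun n => `|P (a n)| / n.+1%:R ^+ 2)).
  apply: series_le_cvg summable_a => m.
  - by rewrite divr_ge0.
  - by rewrite divr_ge0 ?normc_ge0.
  - by rewrite ler_wpM2r ?invr_ge0.
have bE m : P (b m) = P (a m) - (if m is m'.+1 then P (a m') else 0).
  by case: m => [|m]; rewrite /b PB ?P0.
rewrite bE; apply: (difference_eq0 (h := fun n => P (a n)) ch) => k k2.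
pose s N := P (\sum_(0 <= n < N) (sk_coef R k n)%:C * (b n * (disk_moment R n)%:C)).
have h : c^-1 * s N @[N --> \oo] --> c^-1 * P 0.
  by apply: cvgM; [exact: cvg_cst|exact: Pcvg (sk_sum k2)].
rewrite P0 mulr0 in h; rewrite (_ : series _ = (fun N => c^-1 * s N)); first exact: h.
apply/funext => N; rewrite /series/= /s.
elim: N => [|N ih]; first by rewrite !big_geq// P0 mulr0.
rewrite !big_nat_recr//= PD [RHS]mulrDr -ih; congr (_ + _).
set t := (sk_coef R k N)%:C * _.
have -> : t = b N * (disk_moment R N * sk_coef R k N)%:C.
  by rewrite rmorphM mulrA [LHS]mulrC.
rewrite PZ bE mE /sk_coef.
have c1 : c != 0 by rewrite lt0r_neq0.
move: (P (a N) - _) (_ * _)^-1 (_ %% _)%:R => D q m.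
by field.
Qed.

(** Vanishing coefficients give g = 0 only near 0; the identity theorem extends this to the disk. *)
Lemma orthogonal_eq0 z : unit_disk z -> g z = 0.
Proof.
have b0 n : b n = 0.
  apply/eqP; rewrite eq_complex; apply/andP; split; apply/eqP.
  - apply: (@ReIm_b (@complex.Re R)) => //.
    + by move=> u v; rewrite cReB.
    + exact: normr_Re_le.
    + by move=> [x y] t /=; rewrite mulr0 subr0.
    + by move=> x l; exact: cvgc_Re.
    + exact: cReD.
  - apply: (@ReIm_b (@complex.Im R)) => //.
    + by move=> u v; rewrite cImB.
    + exact: normr_Im_le.
    + by move=> [x y] t /=; rewrite mulr0 add0r.
    + by move=> x l; exact: cvgc_Im.
    + exact: cImD.
apply: (@analytic_identity R g gH.1 (Num.min rho 1)).
  by rewrite lt_min rho0 ltr01.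
move=> w wr; have := psum_g wr; rewrite add0r => h.
apply: (cvgc_unique h); rewrite (_ : series _ = fun=> 0); first exact: (@cvgc_cst R 0).
by apply/funext => N; rewrite /series/= big1// => i _; rewrite b0 mul0r.
Qed.

End final.

Theorem theorem1p2 (R : realType) (g : R[i] -> R[i])
    (g_in_H : bergman g)
    (g_neq0 : exists2 z : R[i], unit_disk z & g z != 0)
    (g_div_in_H : bergman (fun z : R[i] => g z / (1 - z))) :
  ~ orthogonal_complement (@H0 R) g.
Proof.
move=> [_ orth]; have [z Dz /eqP] := g_neq0; apply.
have D0 : unit_disk (0 : R[i]) by rewrite /unit_disk/= normr0 ltr01.
have [rho rho0 [a ha]] := analytic_at_psum (g_div_in_H.1 0 D0).
apply: (orthogonal_eq0 g_in_H g_div_in_H _ rho0 ha) => // k k2.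
have := orth _ (sk_H0 R k2); rewrite /inner => o.
(* The hypothesis pairs [sk] with the conjugate of [g]; conjugating the integral exchanges the two
   roles. *)
rewrite -[RHS](conjc0 R) -o -CintJ; last exact: L2_cint_mul (sk_bergman R k2).2 g_in_H.2.
apply: Cint_eq => w _; move: (sk k w) (g w) => [x y] [u v].
by apply/eqP; rewrite eq_complex; apply/andP; split; apply/eqP => /=; ring.
Qed.
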